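(* Let $(C,\Delta,d_C)$ be a dg coassociative coalgebra and let $(A,\cdot,d_A)$ be a dg associative algebra. Let $(s^{-1}B,\{b_{m,n}\},\{d_m\})$ be a $\mathcal B_\infty$-algebra, let $\{\beta_m\}$ be an action of $s^{-1}B$ on $C$, and $\{\beta'_m\}$ an action of $s^{-1}B$ on $A$. Then the cobar construction $\Omega(C)$ of $C$ is an algebra over $s^{-1}B$ (i.e. a dg associative algebra with an action of $s^{-1}B$), with the operations $\{\Omega(\beta_m)\}$ uniquely defined by $$\Omega(\beta_m)(b_1,\dots,b_{m-1},s^{-1}c):=s^{-1}\beta_m(b_1,\dots,b_{m-1},c),\qquad s^{-1}c\in s^{-1}C\subset\Omega(C),\ b_i\in B.$$ Similarly, the bar construction $\mathfrak B(A)$ of $A$ is a coalgebra over $s^{-1}B$ (i.e. a dg coassociative coalgebra with an action of $s^{-1}B$), with the operations $\{\mathfrak B(\beta'_m)\}$ uniquely defined by the condition that the corestriction of $\mathfrak B(\beta'_m)(b_1,\dots,b_{m-1},-)$ to the cogenerators $sA$ vanishes on $(sA)^{\otimes n}$ for $n>1$ and $$\mathfrak B(\beta'_m)(b_1,\dots,b_{m-1},sa):=s\beta'_m(b_1,\dots,b_{m-1},a),\qquad sa\in sA\subset\mathfrak B(A),\ b_i\in B.$$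
   Context: $\mathbf{k}$ is a field of characteristic $0$; spaces are $\mathbb{Z}$-graded, differentials raise degree by $1$, $s$ is suspension, $s^{-1}$ desuspension, $\deg(s^{-1}x)=\deg x+1$. In an exponent of $-1$ a homogeneous element stands for its degree. **$\mathcal B_\infty$-algebra.** A $\mathcal B_\infty$-structure on $s^{-1}B$ is a set of linear maps $b_{m,n}:B^{\otimes(m+n)}\to B$ of degree $0$ ($m,n\ge0$) and $d_m:B^{\otimes m}\to B$ of degree $1$ ($m>0$), with $b_{0,1}=b_{1,0}=\mathrm{Id}_B$, $b_{0,m}=b_{m,0}=0$ for $m\ne1$, such that the coderivation $\sum_p\widehat d_p$ of the cofree coalgebra $T^c(B)=\bigoplus_{n>0}B^{\otimes n}$, $\widehat d_p(v_1,\dots,v_n)=\sum_i(-1)^{v_1+\dots+v_i}v_1\otimes\dots\otimes d_p(v_{i+1},\dots,v_{i+p})\otimes\dots\otimes v_n$, squares to zero and, with $$b_p(u_1,\dots,u_m;v_1,\dots,v_n):=\sum\pm\bigotimes_{1\le q\le p}b_{i_q,j_q}(u_{\bar i_{q-1}+1},\dots,u_{\bar i_q},v_{\bar j_{q-1}+1},\dots,v_{\bar j_q})$$ (sum over $i_q,j_q\ge0$, $\sum i_q=m$, $\sum j_q=n$; $\bar i_q=\sum_{r\le q}i_r$, $\bar j_q=\sum_{r\le q}j_r$; Koszul sign), the product $(u_1,\dots,u_m)\cdot(v_1,\dots,v_n)=\sum_{p>0}b_p(u_1,\dots,u_m;v_1,\dots,v_n)$ on $T^c(B)$ is associative and $\sum_p\widehat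 d_p$ is a graded derivation of it. **Module over $s^{-1}B$.** A module structure on a dg space $(W,d_W)$ is a set of degree $0$ linear maps $\beta_m:B^{\otimes(m-1)}\otimes W\to W$, $m>1$, with $$\sum_{p>1}\beta_p(b_{p-1}(u_1,\dots,u_m;v_1,\dots,v_n),w)=\beta_{m+1}(u_1,\dots,u_m,\beta_{n+1}(v_1,\dots,v_n,w)),$$ $$d_W(\beta_m(v_1,\dots,v_{m-1},w))=\sum_{p=1}^{m-1}\beta_{m-p+1}(\widehat d_p(v_1,\dots,v_{m-1}),w)+(-1)^{v_1+\dots+v_{m-1}}\beta_m(v_1,\dots,v_{m-1},d_W(w)).$$ **Action on a dg associative algebra** $A$: a module structure on $A$ such that, with $\beta_1=\mathrm{Id}$, $$\beta_m(v_1,\dots,v_{m-1},a_1a_2)=\sum_{i=0}^{m-1}(-1)^{a_1(v_{i+1}+\dots+v_{m-1})}\beta_{i+1}(v_1,\dots,v_i,a_1)\cdot\beta_{m-i}(v_{i+1},\dots,v_{m-1},a_2).$$ **Action on a dg coassociative coalgebra** $(C,\Delta)$: a module structure on $C$ such that, with $\beta_1=\mathrm{Id}$ and $\Delta(c)=\sum c_1\otimes c_2$, $$\Delta(\beta_m(v_1,\dots,v_{m-1},c))=\sum\sum_{i=0}^{m-1}(-1)^{c_1(v_{i+1}+\dots+v_{m-1})}\beta_{i+1}(v_1,\dots,v_i,c_1)\otimes\beta_{m-i}(v_{i+1},\dots,v_{m-1},c_2).$$ **Cobar and bar constructions.** $\Omega(C)=\bigoplus_{n>0}(s^{-1}C)^{\otimes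 n}$ is the free algebra on $s^{-1}C$ with the derivation differential given on generators by $s^{-1}c\mapsto s^{-1}d_C(c)+\sum(-1)^{c_1+1}s^{-1}c_1\otimes s^{-1}c_2$, where $\Delta(c)=\sum c_1\otimes c_2$. $\mathfrak B(A)=\bigoplus_{n>0}(sA)^{\otimes n}$ is the cofree coalgebra on $sA$ with the codifferential cogenerated by $sa\mapsto s\,d_A(a)$ and $sa_1\otimes sa_2\mapsto(-1)^{a_1+1}s(a_1a_2)$. *)

(* Defs.v *)
From HB Require Import structures.
From mathcomp Require Import all_boot all_order all_algebra.
From mathcomp Require Import finmap monalg generic_quotient.
From mathcomp Require Import boolp.

Set Implicit Arguments.
Unset Strict Implicit.
Unset Printing Implicit Defensive.

Import GRing.Theory.
Local Open Scope ring_scope.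
Local Open Scope quotient_scope.

Section LinearTheory.
Context (k : fieldType) (V W : lmodType k) (f : V -> W).
Hypothesis fL : linear f.

Lemma lin0 : f 0 = 0.
Proof. by have := fL (-1) 0 0; rewrite scaler0 addr0 scaleN1r addNr. Qed.

Lemma linD x y : f (x + y) = f x + f y.
Proof. by have := fL 1 x y; rewrite !scale1r. Qed.

Lemma linZ a x : f (a *: x) = a *: f x.
Proof. by have := fL a x 0; rewrite lin0 !addr0. Qed.

Lemma lin_sum I (r : seq I) F : f (\sum_(i <- r) F i) = \sum_(i <- r) f (F i).
Proof. exact: (big_morph f linD lin0). Qed.
End LinearTheory.

(** [presented G] is the free module on [X] modulo the submodule spanned by [G];
    the tensor products below are instances of it. *)
Section Presented.
Context (k : fieldType) (X : choiceType).

Definition mext (W : lmodType k) (f : X -> W) (m : {malg k[X]}) : W :=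
  \sum_(x <- msupp m) m@_x *: f x.

Lemma mextEw (W : lmodType k) (f : X -> W) m (D : {fset X}) :
  (msupp m `<=` D)%fset -> mext f m = \sum_(x <- D) m@_x *: f x.
Proof.
move=> sD; rewrite /mext; apply: (big_fset_incl _ sD) => x _ /mcoeff_outdom ->.
by rewrite scale0r.
Qed.

Lemma mext_linear (W : lmodType k) (f : X -> W) : linear (mext f).
Proof.
move=> a m n.
pose D := (msupp m `|` msupp n `|` msupp (a *: m + n))%fset.
rewrite !(@mextEw _ f _ D); do ?by apply/fsubsetP => x; rewrite !inE => ->; rewrite ?orbT.
rewrite scaler_sumr -big_split /=; apply: eq_bigr => x _.
by rewrite mcoeffD mcoeffZ scalerDl scalerA.
Qed.

Lemma mextU (W : lmodType k) (f : X -> W) x : mext f << x >> = f x.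
Proof.
rewrite (mextEw _ (@msuppU_le _ _ x 1)) big_seq_fset1 mcoeffU eqxx.
by rewrite scale1r.
Qed.

Context (G : {malg k[X]} -> Prop).

Inductive lspan : {malg k[X]} -> Prop :=
| lspan0 : lspan 0
| lspanZD a g m : G g -> lspan m -> lspan (a *: g + m).

Lemma lspanD m n : lspan m -> lspan n -> lspan (m + n).
Proof.
elim=> [|a g m' Gg _ IH] Ln; first by rewrite add0r.
by rewrite -addrA; apply: lspanZD => //; apply: IH.
Qed.

Lemma lspanZ a m : lspan m -> lspan (a *: m).
Proof.
elim=> [|b g m' Gg _ IH]; first by rewrite scaler0; apply: lspan0.
by rewrite scalerDr scalerA; apply: lspanZD.
Qed.

Lemma lspanG g : G g -> lspan g.
Proof.
by move=> Gg; rewrite -[g]scale1r -[_ *: g]addr0; apply: lspanZD => //; apply: lspan0.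
Qed.

Definition eqmod_span (m n : {malg k[X]}) : bool := `[< lspan (m - n) >].

Lemma eqmod_span_equiv : equiv_class_of eqmod_span.
Proof.
split=> [m|m n|n m p].
- by apply/asboolP; rewrite subrr; apply: lspan0.
- apply/asboolP/asboolP => /(lspanZ (-1)); rewrite scaleN1r opprB //.
- move=> /asboolP mn /asboolP np; apply/asboolP.
  by have := lspanD mn np; rewrite addrA subrK.
Qed.

Canonical eqmod_span_rel := EquivRelPack eqmod_span_equiv.
Definition presented := {eq_quot eqmod_span_rel}.
HB.instance Definition _ := Choice.on presented.
HB.instance Definition _ := EqQuotient.on presented.

Local Notation Q := presented.
Implicit Types p q r : Q.

Lemma pi_eqP m n : reflect (lspan (m - n)) (\pi_Q m == \pi_Q n).
Proof.
by rewrite -[_ == _]/(\pi_{eq_quot eqmod_span_rel} m == \pi_{eq_quot eqmod_span_rel} n)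
  eqmodE; apply: asboolP.
Qed.

Definition qadd p q : Q := \pi_Q (repr p + repr q).
Definition qopp p : Q := \pi_Q (- repr p).
Definition qscale (a : k) p : Q := \pi_Q (a *: repr p).

Lemma lspan_repr m : lspan (m - repr (\pi_Q m)).
Proof. by apply/pi_eqP; rewrite reprK. Qed.

Lemma qaddE m n : qadd (\pi_Q m) (\pi_Q n) = \pi_Q (m + n).
Proof.
apply/esym/eqP/pi_eqP.
by rewrite opprD addrACA; apply: lspanD; apply: lspan_repr.
Qed.

Lemma qoppE m : qopp (\pi_Q m) = \pi_Q (- m).
Proof.
apply/esym/eqP/pi_eqP; rewrite -opprD -scaleN1r.
by apply: lspanZ; apply: lspan_repr.
Qed.

Lemma qscaleE a m : qscale a (\pi_Q m) = \pi_Q (a *: m).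
Proof.
apply/esym/eqP/pi_eqP; rewrite -scalerBr.
by apply: lspanZ; apply: lspan_repr.
Qed.

Lemma qaddA : associative qadd.
Proof.
elim/quotW=> x; elim/quotW=> y; elim/quotW=> z.
by rewrite (qaddE y z) (qaddE x y) !qaddE addrA.
Qed.
Lemma qaddC : commutative qadd.
Proof. by elim/quotW=> x; elim/quotW=> y; rewrite !qaddE addrC. Qed.
Lemma qadd0 : left_id (\pi_Q 0) qadd.
Proof. by elim/quotW=> x; rewrite !qaddE add0r. Qed.
Lemma qaddN : left_inverse (\pi_Q 0) qopp qadd.
Proof. by elim/quotW=> x; rewrite (qoppE x) qaddE addNr. Qed.

HB.instance Definition _ := GRing.isZmodule.Build Q qaddA qaddC qadd0 qaddN.

Lemma qscaleA a b p : qscale a (qscale b p) = qscale (a * b) p.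
Proof. by elim/quotW: p => x; rewrite (qscaleE b x) !qscaleE scalerA. Qed.
Lemma qscale1 : left_id 1 qscale.
Proof. by elim/quotW=> x; rewrite qscaleE scale1r. Qed.
Lemma qscaleDr : right_distributive qscale +%R.
Proof.
move=> a; elim/quotW=> x; elim/quotW=> y.
by rewrite /GRing.add /= (qaddE x y) (qscaleE a x) (qscaleE a y) qscaleE qaddE scalerDr.
Qed.
Lemma qscaleDl p : {morph qscale^~ p : a b / a + b}.
Proof.
move=> a b; elim/quotW: p => x.
by rewrite (qscaleE a x) (qscaleE b x) qscaleE [RHS]qaddE scalerDl.
Qed.

HB.instance Definition _ :=
  GRing.Zmodule_isLmodule.Build k Q qscaleA qscale1 qscaleDr qscaleDl.

Lemma pi_linear : linear (\pi_Q : {malg k[X]} -> Q).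
Proof. by move=> a m n; rewrite -qaddE -qscaleE. Qed.

Definition qgen (x : X) : Q := \pi_Q << x >>.

(** The linear map sending the generator [x] to [f x].  It is only meaningful
    when [f] respects the relations, see [qlift_linear] and [qlift_gen]. *)
Definition qlift (W : lmodType k) (f : X -> W) (p : Q) : W := mext f (repr p).

Section Lift.
Context (W : lmodType k) (f : X -> W).
Hypothesis fG : forall g, G g -> mext f g = 0.
HB.instance Definition _ :=
  GRing.isLinear.Build k {malg k[X]} W _ (mext f) (mext_linear f).

Lemma mext_lspan m : lspan m -> mext f m = 0.
Proof.
elim=> [|a g m' Gg _ IH]; first by rewrite linear0.
by rewrite linearP /= fG // IH scaler0 addr0.
Qed.

Lemma qlift_pi m : qlift f (\pi_Q m) = mext f m.
Proof.
apply/esym/eqP; rewrite /qlift -subr_eq0 -linearB /=.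
by apply/eqP/mext_lspan; apply: lspan_repr.
Qed.

Lemma qlift_linear : linear (qlift f).
Proof.
move=> a; elim/quotW=> x; elim/quotW=> y.
by rewrite -[a *: _ + _]pi_linear !qlift_pi linearP.
Qed.

Lemma qlift_gen x : qlift f (qgen x) = f x.
Proof. by rewrite qlift_pi mextU. Qed.
End Lift.

Lemma presented_ind (P : Q -> Prop) :
  P 0 -> (forall a x p, P p -> P (a *: qgen x + p)) -> forall p, P p.
Proof.
move=> P0 PD; elim/quotW=> m; rewrite (monalgE m).
elim: (msupp m : seq X) => [|x s IH]; first by rewrite big_nil.
rewrite big_cons; have -> : << m@_x *g x >> = m@_x *: (<< x >> : {malg k[X]}).
  by apply/malgP => y; rewrite mcoeffZ !mcoeffU mulr_natr.
by rewrite pi_linear; apply: PD.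
Qed.
End Presented.

Section Tensor.
Context (k : fieldType).

Section Def.
Context (U V : lmodType k).

Inductive bilin_rel : {malg k[(U * V)%type]} -> Prop :=
| BilinL a u u' v :
    bilin_rel (<< (a *: u + u', v) >> - (a *: << (u, v) >> + << (u', v) >>))
| BilinR a u v v' :
    bilin_rel (<< (u, a *: v + v') >> - (a *: << (u, v) >> + << (u, v') >>)).

Definition tens : Type := presented bilin_rel.
HB.instance Definition _ := GRing.Lmodule.copy tens (presented bilin_rel).

Definition pure (u : U) (v : V) : tens := qgen bilin_rel (u, v).

Definition tens_lift (W : lmodType k) (f : U -> V -> W) (t : tens) : W :=
  qlift (fun p => f p.1 p.2) t.

Definition bilinear_map (W : lmodType k) (f : U -> V -> W) : Prop :=
  (forall v, linear (f^~ v)) /\ (forall u, linear (f u)).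

Lemma pure_bilinear : bilinear_map pure.
Proof.
split=> [v a u u'|u a v v']; apply/eqP;
  rewrite /pure /qgen -[X in _ == X]pi_linear; apply/pi_eqP;
  apply: lspanG; [exact: BilinL|exact: BilinR].
Qed.

Section LiftTheory.
Context (W : lmodType k) (f : U -> V -> W).
Hypothesis f_bilin : bilinear_map f.

Lemma tens_lift_rel g : bilin_rel g -> mext (fun p => f p.1 p.2) g = 0.
Proof.
have D a m n : mext (fun p => f p.1 p.2) (a *: m + n) = _ := mext_linear _ a m n.
case=> *; rewrite -scaleN1r addrC D D !mextU /= ?f_bilin.1 ?f_bilin.2;
  by rewrite scaleN1r addNr.
Qed.

Lemma tens_lift_linear : linear (tens_lift f).
Proof. exact: qlift_linear tens_lift_rel. Qed.

Lemma tens_lift_pure u v : tens_lift f (pure u v) = f u v.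
Proof. exact: (qlift_gen tens_lift_rel (u, v)). Qed.
End LiftTheory.

Lemma tens_ind (P : tens -> Prop) :
  P 0 -> (forall a u v t, P t -> P (a *: pure u v + t)) -> forall t, P t.
Proof. by move=> P0 PD; apply: presented_ind => // a [u v] t; apply: PD. Qed.
End Def.

Section Words.
Context (V : lmodType k).

Definition multilinear (W : lmodType k) (f : seq V -> W) : Prop :=
  forall s1 s2 a x y,
    f (s1 ++ (a *: x + y) :: s2) = a *: f (s1 ++ x :: s2) + f (s1 ++ y :: s2).

Definition mword (s : seq V) : {malg k[(V * seq V)%type]} :=
  if s is v :: t then << (v, t) >> else 0.

Inductive multilin_rel : {malg k[(V * seq V)%type]} -> Prop :=
| Multilin s1 s2 a x y :
    multilin_rel (mword (s1 ++ (a *: x + y) :: s2)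
                  - (a *: mword (s1 ++ x :: s2) + mword (s1 ++ y :: s2))).

(** The sum of the tensor powers of [V] of exponent [n > 0].  The free module is on
    nonempty lists, [(v, t)] standing for [v :: t], and [word [::] = 0]. *)
Definition Tplus : Type := presented multilin_rel.
HB.instance Definition _ := GRing.Lmodule.copy Tplus (presented multilin_rel).

Definition word (s : seq V) : Tplus := \pi_(presented multilin_rel) (mword s).

Definition tlift (W : lmodType k) (f : seq V -> W) (t : Tplus) : W :=
  qlift (fun p => f (p.1 :: p.2)) t.

Lemma word_nil : word [::] = 0.
Proof. by []. Qed.

Lemma word_multilinear : multilinear word.
Proof.
move=> s1 s2 a x y; apply/eqP; rewrite /word -[X in _ == X]pi_linear.
by apply/pi_eqP; apply: lspanG; exact: Multilin.
Qed.

Section LiftTheory.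
Context (W : lmodType k) (f : seq V -> W).
Hypothesis f_multi : multilinear f.

Lemma mext_mword s : s != [::] -> mext (fun p => f (p.1 :: p.2)) (mword s) = f s.
Proof. by case: s => // v s _; rewrite mextU. Qed.

Lemma tlift_rel g : multilin_rel g -> mext (fun p => f (p.1 :: p.2)) g = 0.
Proof.
have D a m n : mext (fun p => f (p.1 :: p.2)) (a *: m + n) = _ := mext_linear _ a m n.
case=> s1 s2 a x y; rewrite -scaleN1r addrC D D !mext_mword; try by case: s1.
by rewrite f_multi scaleN1r addNr.
Qed.

Lemma tlift_linear : linear (tlift f).
Proof. exact: qlift_linear tlift_rel. Qed.

Lemma tlift_word s : s != [::] -> tlift f (word s) = f s.
Proof. by move=> s0; rewrite /tlift /word (qlift_pi tlift_rel) mext_mword. Qed.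
End LiftTheory.

Lemma Tplus_ind (P : Tplus -> Prop) :
  P 0 -> (forall a s t, s != [::] -> P t -> P (a *: word s + t)) -> forall t, P t.
Proof.
move=> P0 PD; apply: presented_ind => // a [v s] t.
exact: (PD a (v :: s)).
Qed.
End Words.
End Tensor.

Lemma big_uniq_sub (I : eqType) (W : nmodType) (F : I -> W) (q r : seq I) :
  uniq q -> uniq r -> {subset q <= r} -> (forall i, i \notin q -> F i = 0) ->
  \sum_(i <- q) F i = \sum_(i <- r) F i.
Proof.
move=> uq ur qr q_out.
rewrite [RHS](bigID (mem q)) /= [X in _ + X]big1 ?addr0 => [|i /q_out //].
rewrite -[RHS]big_filter; apply: perm_big; apply: uniq_perm; rewrite ?filter_uniq //.
by move=> i; rewrite mem_filter; apply/idP/andP => [/[dup] iq /qr|[]].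
Qed.

Section LocallyFinite.
Context (k : fieldType) (V : lmodType k) (P : int -> V -> V).
Hypothesis P_linear : forall i, linear (P i).

Definition locally_finite (x : V) : Prop := exists s : seq int,
  [/\ uniq s, forall i, i \notin s -> P i x = 0 & x = \sum_(i <- s) P i x].

Lemma locally_finite0 : locally_finite 0.
Proof. by exists [::]; split=> // [i _|]; [exact: lin0|rewrite big_nil]. Qed.

Lemma locally_finiteD a x y :
  locally_finite x -> locally_finite y -> locally_finite (a *: x + y).
Proof.
move=> [s [us os xs]] [t [ut ot yt]].
exists (undup (s ++ t)); split=> [|i|]; first exact: undup_uniq.
  rewrite mem_undup mem_cat negb_or => /andP[/os x0 /ot y0].
  by rewrite P_linear x0 y0 scaler0 addr0.
rewrite (eq_bigr (fun i => a *: P i x + P i y)) => [|i _]; last exact: P_linear.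
rewrite big_split -scaler_sumr /= -(@big_uniq_sub _ _ (P^~ x) s) ?undup_uniq //; last first.
  by move=> i is_; rewrite mem_undup mem_cat is_.
rewrite -(@big_uniq_sub _ _ (P^~ y) t) ?undup_uniq //; last first.
  by move=> i it; rewrite mem_undup mem_cat it orbT.
by rewrite -xs -yt.
Qed.
End LocallyFinite.

(** A grading is given by the projections [gproj i] to the homogeneous components. *)
HB.mixin Record Lmodule_isGraded (k : fieldType) (V : Type) of GRing.Lmodule k V := {
  gproj : int -> V -> V;
  gproj_linear : forall i, linear (gproj i);
  gproj_proj : forall i j x, gproj i (gproj j x) = if i == j then gproj j x else 0;
  gproj_fin : forall x, locally_finite gproj x
}.

#[short(type="gradedType")]
HB.structure Definition Graded (k : fieldType) :=
  {V of Lmodule_isGraded k V & GRing.Lmodule k V}.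

Section GradedTheory.
Context (k : fieldType) (V : gradedType k).
Implicit Types (x y : V).

Definition homog (i : int) x : Prop := gproj i x = x.

Definition gsupp x : seq int := sval (cid (gproj_fin x)).

Lemma gsupp_uniq x : uniq (gsupp x).
Proof. by rewrite /gsupp; case: cid => s []. Qed.

Lemma gsupp_out x i : i \notin gsupp x -> gproj i x = 0.
Proof. by rewrite /gsupp; case: cid => s [] /= _ + _; apply. Qed.

Lemma gsupp_sum x : x = \sum_(i <- gsupp x) gproj i x.
Proof. by rewrite /gsupp; case: cid => s []. Qed.

HB.instance Definition _ i :=
  GRing.isLinear.Build k V V _ (gproj i) (gproj_linear i).

Lemma homog_gproj i x : homog i (gproj i x).
Proof. by rewrite /homog gproj_proj eqxx. Qed.

(** [gsum F x] is the sum over [i] of [F i] at the degree [i] component of [x]. *)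
Definition gsum (W : lmodType k) (F : int -> V -> W) x : W :=
  \sum_(i <- gsupp x) F i (gproj i x).

Lemma gsumE (W : lmodType k) (F : int -> V -> W) x (r : seq int) :
  (forall i, F i 0 = 0) -> uniq r -> (forall i, i \notin r -> gproj i x = 0) ->
  gsum F x = \sum_(i <- r) F i (gproj i x).
Proof.
move=> F0 r_uniq r_out.
pose t := undup (gsupp x ++ r).
rewrite /gsum (@big_uniq_sub _ _ _ (gsupp x) t) ?gsupp_uniq ?undup_uniq //.
- apply/esym/big_uniq_sub; rewrite ?undup_uniq // => i; last by move/r_out->.
  by rewrite mem_undup mem_cat => ->; rewrite orbT.
- by move=> i ix; rewrite mem_undup mem_cat ix.
- by move=> i /gsupp_out ->.
Qed.

Lemma gsum_linear (W : lmodType k) (F : int -> V -> W) :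
  (forall i, linear (F i)) -> linear (gsum F).
Proof.
move=> FL a x y.
have F0 i : F i 0 = 0 by apply: lin0.
pose t := undup (gsupp x ++ gsupp y).
have tx i : i \notin t -> gproj i x = 0.
  by rewrite mem_undup mem_cat negb_or => /andP[/gsupp_out].
have ty i : i \notin t -> gproj i y = 0.
  by rewrite mem_undup mem_cat negb_or => /andP[_ /gsupp_out].
rewrite !(@gsumE _ F _ t) ?undup_uniq //; last first.
  by move=> i it; rewrite linearP /= tx // ty // scaler0 addr0.
rewrite scaler_sumr -big_split /=; apply: eq_bigr => i _.
by rewrite linearP FL.
Qed.

Lemma gsum_homog (W : lmodType k) (F : int -> V -> W) i x :
  (forall i, F i 0 = 0) -> homog i x -> gsum F x = F i x.
Proof.
move=> F0 hx; rewrite (@gsumE _ F _ [:: i]) ?big_seq1 ?hx // => j.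
by rewrite inE -hx gproj_proj => /negPf ->.
Qed.

(** [gsign e x] is [(-1)^(e * i) x] for [x] homogeneous of degree [i]. *)
Definition gsign (e : int) : V -> V := gsum (fun i y => (-1) ^ (e * i) *: y).

(** A homogeneous word is a list of pairs (degree, element). *)
Definition hword (s : seq (int * V)) : Prop := forall p, p \in s -> homog p.1 p.2.
Definition wdeg (s : seq (int * V)) : int := \sum_(p <- s) p.1.
Definition wval (s : seq (int * V)) : seq V := [seq p.2 | p <- s].

Fixpoint hcomps (s : seq V) : seq (seq (int * V)) :=
  if s is v :: s' then
    [seq (i, gproj i v) :: t | i <- gsupp v, t <- hcomps s']
  else [:: [::]].

(** The multilinear extension of a formula given on homogeneous words, see
    [hext_hword].  [hcomps s] lists the words of components of the entries of [s]. *)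
Definition hext (W : lmodType k) (f : seq (int * V) -> W) (s : seq V) : W :=
  \sum_(t <- hcomps s) f t.

Definition hmultilinear (W : lmodType k) (f : seq (int * V) -> W) : Prop :=
  forall s1 s2 i a x y,
    f (s1 ++ (i, a *: x + y) :: s2)
    = a *: f (s1 ++ (i, x) :: s2) + f (s1 ++ (i, y) :: s2).

Lemma hcomps_hword s t : t \in hcomps s -> hword t.
Proof.
elim: s t => [|v s IH] t /=; first by rewrite inE => /eqP -> p.
case/allpairsP=> -[i t'] /= [_ /IH ht' ->] p; rewrite inE => /predU1P[-> /=|/ht' //].
exact: homog_gproj.
Qed.

Lemma hext_cons (W : lmodType k) (f : seq (int * V) -> W) v s :
  hext f (v :: s) = gsum (fun i y => hext (fun t => f ((i, y) :: t)) s) v.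
Proof. by rewrite /hext /= big_allpairs_dep. Qed.

Lemma hmulti_cons (W : lmodType k) (f : seq (int * V) -> W) p :
  hmultilinear f -> hmultilinear (fun t => f (p :: t)).
Proof. by move=> fm s1 s2 i a x y; apply: (fm (p :: s1)). Qed.

Lemma hext_head_linear (W : lmodType k) (f : seq (int * V) -> W) i s :
  hmultilinear f -> linear (fun y => hext (fun t => f ((i, y) :: t)) s).
Proof.
move=> fm a x y; rewrite /hext scaler_sumr -big_split /=.
by apply: eq_bigr => t _; apply: (fm [::]).
Qed.

Lemma hext_multilinear (W : lmodType k) (f : seq (int * V) -> W) :
  hmultilinear f -> multilinear (hext f).
Proof.
move=> fm s1 s2 a x y; elim: s1 f fm => [|v s1 IH] f fm /=.
  rewrite !hext_cons; apply: gsum_linear => i; exact: hext_head_linear.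
rewrite !hext_cons /gsum scaler_sumr -big_split /=.
by apply: eq_bigr => i _; apply: IH; apply: hmulti_cons.
Qed.

Lemma hext_hword (W : lmodType k) (f : seq (int * V) -> W) t :
  hmultilinear f -> hword t -> hext f (wval t) = f t.
Proof.
elim: t f => [|[i x] t IH] f fm ht; first by rewrite /hext big_seq1.
rewrite hext_cons (@gsum_homog _ _ i x) /=.
- by apply: (IH (fun t => f ((i, x) :: t))) => [|p pt];
    [exact: hmulti_cons|apply: ht; rewrite inE pt orbT].
- by move=> j; apply: (lin0 (hext_head_linear j (wval t) fm)).
- exact: (ht (i, x) (mem_head _ _)).
Qed.

Lemma hext_wval (W : lmodType k) (f : seq V -> W) s :
  multilinear f -> hext (f \o wval) s = f s.
Proof.
elim: s f => [|v s IH] f fm; first by rewrite /hext big_seq1.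
rewrite hext_cons /gsum [in RHS](gsupp_sum v).
have fL : linear (fun y => f (y :: s)) by move=> a x y; apply: (fm [::]).
transitivity (\sum_(i <- gsupp v) f (gproj i v :: s)).
  apply: eq_bigr => i _.
  by apply: (IH (fun t => f (gproj i v :: t))) => s1 *; apply: (fm (_ :: s1)).
by rewrite (lin_sum fL).
Qed.
End GradedTheory.

Definition graded_map (k : fieldType) (V W : gradedType k) (e : int) (f : V -> W) : Prop :=
  linear f /\ forall i x, homog i x -> homog (i + e) (f x).

Section GradedTensor.
Context (k : fieldType) (U V : gradedType k).

Definition tens_proj (n : int) : tens U V -> tens U V :=
  tens_lift (fun u v => gsum (fun i x => pure x (gproj (n - i) v)) u).

Lemma tens_proj_bilinear n :
  bilinear_map (fun u v => gsum (fun i x => pure x (gproj (n - i) v)) u : tens U V).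
Proof.
split=> [v|u a v v']; first by apply: gsum_linear => i; apply: (pure_bilinear U V).1.
rewrite /gsum scaler_sumr -big_split; apply: eq_bigr => i _ /=.
by rewrite linearP (pure_bilinear U V).2.
Qed.

Lemma tens_proj_linear n : linear (tens_proj n).
Proof. exact/tens_lift_linear/tens_proj_bilinear. Qed.

Lemma tens_proj_pure n u v :
  tens_proj n (pure u v) = gsum (fun i x => pure x (gproj (n - i) v)) u.
Proof. by rewrite /tens_proj tens_lift_pure //; apply: tens_proj_bilinear. Qed.

Lemma pure0l v : pure 0 v = 0 :> tens U V.
Proof. exact: lin0 ((pure_bilinear U V).1 v). Qed.

Lemma pure0r u : pure u 0 = 0 :> tens U V.
Proof. exact: lin0 ((pure_bilinear U V).2 u). Qed.

Lemma tens_proj_proj m n t :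
  tens_proj m (tens_proj n t) = if m == n then tens_proj n t else 0.
Proof.
elim/tens_ind: t => [|a u v t IH].
  by rewrite !(lin0 (tens_proj_linear _)) if_same.
rewrite !tens_proj_linear IH tens_proj_pure; set S := gsum _ _.
suff -> : tens_proj m S = if m == n then S else 0.
  by case: ifP; rewrite // scaler0 addr0.
rewrite /S /gsum (lin_sum (tens_proj_linear m)).
transitivity (\sum_(i <- gsupp u)
    if m == n then pure (gproj i u) (gproj (n - i) v) else 0 : tens U V); last first.
  by case: eqP => // _; rewrite big1.
apply: eq_bigr => i _; rewrite tens_proj_pure.
rewrite (@gsum_homog _ _ _ _ i); [|by move=> j; rewrite pure0l|exact: homog_gproj].
rewrite gproj_proj (inj_eq (addIr _)).
by case: eqP => // _; rewrite pure0r.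
Qed.

Lemma tens_proj_fin t : locally_finite tens_proj t.
Proof.
elim/tens_ind: t => [|a u v t IH]; first exact/locally_finite0/tens_proj_linear.
apply: locally_finiteD => //; first exact: tens_proj_linear.
pose s := undup [seq i + j | i <- gsupp u, j <- gsupp v].
have sP i n : i \in gsupp u -> n \notin s -> gproj (n - i) v = 0.
  move=> iu; rewrite mem_undup => /negP ns; apply: gsupp_out; apply/negP => nv.
  by apply: ns; apply/allpairsP; exists (i, n - i); split=> //=; rewrite addrC subrK.
exists s; split; [exact: undup_uniq| |] => [n ns|].
  rewrite tens_proj_pure /gsum big_seq big1 // => i iu.
  by rewrite sP // pure0r.
under eq_bigr do rewrite tens_proj_pure.
rewrite /gsum exchange_big /= {1}(gsupp_sum u).
rewrite (lin_sum ((pure_bilinear U V).1 v)) [LHS]big_seq [RHS]big_seq.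
apply: eq_bigr => i iu.
rewrite -(lin_sum ((pure_bilinear U V).2 (gproj i u))); congr pure.
rewrite {1}(gsupp_sum v); transitivity (gsum (fun _ y => y) v) => //.
rewrite (@gsumE _ _ _ _ _ [seq n - i | n <- s]) ?big_map //.
  by rewrite map_inj_uniq ?undup_uniq //; apply: addIr.
move=> j js; have /(sP _ _ iu) : j + i \notin s; last by rewrite addrK.
by apply: contra js => js; apply/mapP; exists (j + i); rewrite ?addrK.
Qed.

HB.instance Definition _ := Lmodule_isGraded.Build k (tens U V)
  tens_proj_linear tens_proj_proj tens_proj_fin.
End GradedTensor.

Section GradedWords.
Context (k : fieldType) (V : gradedType k).

Definition word_part (n : int) (t : seq (int * V)) : Tplus V :=
  if wdeg t == n then word (wval t) else 0.

Lemma wdeg_cat (s t : seq (int * V)) : wdeg (s ++ t) = wdeg s + wdeg t.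
Proof. exact: big_cat. Qed.

Lemma wdeg_cons p (t : seq (int * V)) : wdeg (p :: t) = p.1 + wdeg t.
Proof. exact: big_cons. Qed.

Lemma word_part_hmultilinear n : hmultilinear (word_part n).
Proof.
move=> s1 s2 i a x y; rewrite /word_part !wdeg_cat !wdeg_cons /=.
case: ifP => _; last by rewrite scaler0 addr0.
by rewrite /wval !map_cat /= word_multilinear.
Qed.

Definition Tproj (n : int) : Tplus V -> Tplus V := tlift (hext (word_part n)).

Lemma Tproj_linear n : linear (Tproj n).
Proof. exact/tlift_linear/hext_multilinear/word_part_hmultilinear. Qed.

Lemma Tproj_word n s : Tproj n (word s) = hext (word_part n) s.
Proof.
case: s => [|v s]; last first.
  by rewrite /Tproj tlift_word //; apply/hext_multilinear/word_part_hmultilinear.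
rewrite word_nil (lin0 (Tproj_linear n)) /hext big_seq1 /word_part.
by rewrite word_nil if_same.
Qed.

Lemma Tproj_proj m n t : Tproj m (Tproj n t) = if m == n then Tproj n t else 0.
Proof.
elim/Tplus_ind: t => [|a s t _ IH].
  by rewrite !(lin0 (Tproj_linear _)) if_same.
rewrite !Tproj_linear IH Tproj_word; set S := hext _ _.
suff -> : Tproj m S = if m == n then S else 0.
  by case: ifP; rewrite // scaler0 addr0.
rewrite /S /hext (lin_sum (Tproj_linear m)).
transitivity (\sum_(w <- hcomps s) if m == n then word_part n w else 0); last first.
  by case: eqP => // _; rewrite big1.
rewrite [LHS]big_seq [RHS]big_seq; apply: eq_bigr => w /hcomps_hword hw.
rewrite /word_part; case: eqP => [<-|_]; last by rewrite (lin0 (Tproj_linear m)) if_same.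
rewrite Tproj_word hext_hword //; last exact: word_part_hmultilinear.
by rewrite /word_part eq_sym.
Qed.

Lemma Tproj_fin t : locally_finite Tproj t.
Proof.
elim/Tplus_ind: t => [|a s t _ IH]; first exact/locally_finite0/Tproj_linear.
apply: locally_finiteD => //; first exact: Tproj_linear.
exists (undup [seq wdeg w | w <- hcomps s]); split; first exact: undup_uniq.
  move=> n ns; rewrite Tproj_word /hext big_seq big1 // => w ws.
  rewrite /word_part; case: eqP => // wn; case/negP: ns.
  by rewrite mem_undup -wn map_f.
under eq_bigr do rewrite Tproj_word.
rewrite /hext exchange_big /= -[LHS](hext_wval s (@word_multilinear k V)).
rewrite /hext [LHS]big_seq [RHS]big_seq; apply: eq_bigr => w ws.
rewrite (bigD1_seq (wdeg w)) ?undup_uniq ?mem_undup ?map_f //= big1 ?addr0.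
  by rewrite /word_part eqxx.
by move=> n nw; rewrite /word_part eq_sym (negPf nw).
Qed.

HB.instance Definition _ := Lmodule_isGraded.Build k (Tplus V)
  Tproj_linear Tproj_proj Tproj_fin.
End GradedWords.

Section Shift.
Context (k : fieldType).

(** [V] with all degrees raised by [n], so that [s] is [shift (-1)] and [s^-1] is
    [shift 1]. *)
Definition shift (n : int) (V : lmodType k) : Type := V.
HB.instance Definition _ n V := GRing.Lmodule.copy (shift n V) V.

Section Instance.
Context (n : int) (V : gradedType k).

Definition shift_proj (i : int) : shift n V -> shift n V := @gproj k V (i - n).

Lemma shift_proj_linear i : linear (shift_proj i).
Proof. exact: gproj_linear. Qed.

Lemma shift_proj_proj i j x :
  shift_proj i (shift_proj j x) = if i == j then shift_proj j x else 0.
Proof. by rewrite /shift_proj gproj_proj (inj_eq (addIr _)). Qed.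

Lemma shift_proj_fin x : locally_finite shift_proj x.
Proof.
have [s [us os xs]] := @gproj_fin k V x.
exists [seq i + n | i <- s]; split=> [|i|].
- by rewrite map_inj_uniq //; apply: addIr.
- move=> /negP is_; apply: os; apply/negP => is'; apply: is_.
  by apply/mapP; exists (i - n); rewrite ?subrK.
- rewrite big_map {1}xs; apply: eq_bigr => i _.
  by rewrite /shift_proj addrK.
Qed.

HB.instance Definition _ := Lmodule_isGraded.Build k (shift n V)
  shift_proj_linear shift_proj_proj shift_proj_fin.
End Instance.
End Shift.

Notation susp V := (shift (-1) V).
Notation desusp V := (shift 1 V).

Definition to_susp (k : fieldType) (V : lmodType k) (x : V) : susp V := x.
Definition of_susp (k : fieldType) (V : lmodType k) (x : susp V) : V := x.
Definition to_desusp (k : fieldType) (V : lmodType k) (x : V) : desusp V := x.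
Definition of_desusp (k : fieldType) (V : lmodType k) (x : desusp V) : V := x.

Section DgStructures.
Context (k : fieldType).

Definition is_differential (V : gradedType k) (d : V -> V) : Prop :=
  graded_map 1 d /\ forall x, d (d x) = 0.

Record is_dgalg (A : gradedType k) (mul : A -> A -> A) (d : A -> A) : Prop := {
  dgalg_diff : is_differential d;
  dgalg_bilinear : bilinear_map mul;
  dgalg_degree : forall i j x y, homog i x -> homog j y -> homog (i + j) (mul x y);
  dgalg_assoc : associative mul;
  dgalg_leibniz : forall i x y, homog i x ->
    d (mul x y) = mul (d x) y + (-1) ^ i *: mul x (d y)
}.

Definition tens_assoc (U V W : lmodType k) : tens (tens U V) W -> tens U (tens V W) :=
  tens_lift (fun t z => tens_lift (fun x y => pure x (pure y z)) t).

Record is_dgcoalg (C : gradedType k) (Delta : C -> tens C C) (d : C -> C) : Prop := {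
  dgcoalg_diff : is_differential d;
  dgcoalg_graded : graded_map 0 Delta;
  dgcoalg_coassoc : forall c,
    tens_assoc (tens_lift (fun x y => pure (Delta x) y) (Delta c))
    = tens_lift (fun x y => pure x (Delta y)) (Delta c);
  dgcoalg_coleibniz : forall c,
    Delta (d c)
    = tens_lift (fun x y => pure (d x) y + pure (gsign 1 x) (d y)) (Delta c)
}.
End DgStructures.

Section TensorAlgebra.
Context (k : fieldType) (V : gradedType k).

Definition tmul (x y : Tplus V) : Tplus V :=
  tlift (fun s => tlift (fun t => word (s ++ t)) y) x.

(** Deconcatenation, without counit. *)
Definition deconc : Tplus V -> tens (Tplus V) (Tplus V) :=
  tlift (fun s => \sum_(1 <= i < size s) pure (word (take i s)) (word (drop i s))).

(** The degree 1 derivation of the free algebra given by [g] on generators; the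
    Leibniz sign is produced by [gsign 1] on the entries to the left. *)
Definition der_ext (g : V -> Tplus V) : Tplus V -> Tplus V :=
  tlift (fun s => \sum_(0 <= i < size s)
    tlift (fun t => word ([seq gsign 1 v | v <- take i s] ++ t ++ drop i.+1 s))
          (g (nth 0 s i))).

(** The summand of arity [p] of the degree 1 coderivation of the cofree coalgebra
    with corestriction [f]; the value of [f] on the empty list is not used. *)
Definition coder_word (f : seq V -> V) (p : nat) (s : seq V) : Tplus V :=
  \sum_(0 <= i < ((size s).+1 - p)%N)
    word ([seq gsign 1 v | v <- take i s] ++ f (take p (drop i s)) :: drop (i + p)%N s).

Definition coder_ext (f : seq V -> V) : Tplus V -> Tplus V :=
  tlift (fun s => \sum_(1 <= p < (size s).+1) coder_word f p s).

Definition corest : Tplus V -> V := tlift (fun s => if s is [:: v] then v else 0).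
End TensorAlgebra.

(** A family of linear maps [B^{\otimes m} -> W], [m >= 0], is encoded as one
    function [seq B -> W] which is linear in each entry of its argument. *)

Section Binfinity.
Context (k : fieldType) (B : gradedType k).
Variables (b : seq B -> seq B -> B) (d : seq B -> B).

(** Koszul sign of the permutation taking [(U_1,...,U_p,V_1,...,V_p)] to
    [(U_1,V_1,...,U_p,V_p)]. *)
Definition koszul (U V : seq (seq (int * B))) : k :=
  (-1) ^ (\sum_(0 <= r < size U) \sum_(0 <= q < r)
            wdeg (nth [::] V q) * wdeg (nth [::] U r)).

(** The terms [b_p(u;v)] of the product: [I] and [J] are the block sizes
    [(i_1,...,i_p)] and [(j_1,...,j_p)]. *)
Definition bprod (p : nat) (u v : seq (int * B)) : Tplus B :=
  \sum_(I : p.-tuple 'I_(size u).+1 | sumn [seq val i | i <- I] == size u)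
  \sum_(J : p.-tuple 'I_(size v).+1 | sumn [seq val j | j <- J] == size v)
    let U := reshape [seq val i | i <- I] u in
    let V := reshape [seq val j | j <- J] v in
    koszul U V *: word [seq b (wval x.1) (wval x.2) | x <- zip U V].

(** The sum over all [p > 0] is cut at [p = size u + size v]: beyond that some block
    pair is empty and the term vanishes because [b [::] [::] = 0]. *)
Definition binf_mul (x y : Tplus B) : Tplus B :=
  tlift (fun u => tlift (fun v =>
    hext (fun u' => hext (fun v' =>
      \sum_(1 <= p < (size u' + size v').+1) bprod p u' v') v) u) y) x.

Definition binf_diff : Tplus B -> Tplus B := coder_ext d.

Record is_Binf : Prop := {
  binf_b_linear : (forall v, multilinear (b^~ v)) /\ (forall u, multilinear (b u));
  binf_b_degree : forall u v, hword u -> hword v ->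
    homog (wdeg u + wdeg v) (b (wval u) (wval v));
  binf_d_linear : multilinear d;
  binf_d_degree : forall v, v != [::] -> hword v -> homog (wdeg v + 1) (d (wval v));
  binf_b01 : forall x, b [::] [:: x] = x;
  binf_b10 : forall x, b [:: x] [::] = x;
  binf_b0n : forall v, size v != 1%N -> b [::] v = 0;
  binf_bn0 : forall u, size u != 1%N -> b u [::] = 0;
  binf_diff2 : forall x, binf_diff (binf_diff x) = 0;
  binf_mulA : associative binf_mul;
  binf_leibniz : forall i x y, homog i x ->
    binf_diff (binf_mul x y)
    = binf_mul (binf_diff x) y + (-1) ^ i *: binf_mul x (binf_diff y)
}.

(** [beta v w] is [beta_{m+1}(v_1,...,v_m,w)], with [beta_1 = Id]. *)
Record is_module (W : gradedType k) (dW : W -> W) (beta : seq B -> W -> W) : Prop := {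
  mod_linear : (forall w, multilinear (beta^~ w)) /\ (forall v, linear (beta v));
  mod_degree : forall v i w, hword v -> homog i w ->
    homog (wdeg v + i) (beta (wval v) w);
  mod_id : forall w, beta [::] w = w;
  mod_assoc : forall u v w, u != [::] -> v != [::] ->
    tlift (beta^~ w) (binf_mul (word u) (word v)) = beta u (beta v w);
  mod_diff : forall v w, hword v ->
    dW (beta (wval v) w)
    = tlift (beta^~ w) (binf_diff (word (wval v)))
      + (-1) ^ (wdeg v) *: beta (wval v) (dW w)
}.

Record is_alg_action (A : gradedType k) (mul : A -> A -> A) (dA : A -> A)
    (beta : seq B -> A -> A) : Prop := {
  alg_action_module : is_module dA beta;
  alg_action_mul : forall v j a1 a2, hword v -> homog j a1 ->
    beta (wval v) (mul a1 a2)
    = \sum_(0 <= i < (size v).+1)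
        (-1) ^ (j * wdeg (drop i v))
        *: mul (beta (wval (take i v)) a1) (beta (wval (drop i v)) a2)
}.

(** The sign [(-1)^(c1 (v_{i+1} + ... + v_m))] is produced by [gsign] acting on [c1]. *)
Record is_coalg_action (C : gradedType k) (Delta : C -> tens C C) (dC : C -> C)
    (beta : seq B -> C -> C) : Prop := {
  coalg_action_module : is_module dC beta;
  coalg_action_comul : forall v c, hword v ->
    Delta (beta (wval v) c)
    = \sum_(0 <= i < (size v).+1)
        tens_lift (fun c1 c2 =>
          pure (beta (wval (take i v)) (gsign (wdeg (drop i v)) c1))
               (beta (wval (drop i v)) c2)) (Delta c)
}.
End Binfinity.

Notation cobar C := (Tplus (desusp C)).
Notation bar A := (Tplus (susp A)).

Section CobarBar.
Context (k : fieldType).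

(** The sign [(-1)^(c1 + 1)] is written as [- gsign 1 c1], with [c1] in its degree in
    [C]; likewise for [a1] in [bar_cogen]. *)
Definition cobar_gen (C : gradedType k) (Delta : C -> tens C C) (dC : C -> C)
    (x : desusp C) : cobar C :=
  word [:: to_desusp (dC (of_desusp x))]
  + tens_lift (fun c1 c2 => - word [:: to_desusp (gsign 1 c1); to_desusp c2])
      (Delta (of_desusp x)).

Definition cobar_diff (C : gradedType k) (Delta : C -> tens C C) (dC : C -> C) :
  cobar C -> cobar C := der_ext (cobar_gen Delta dC).

Definition bar_cogen (A : gradedType k) (mul : A -> A -> A) (dA : A -> A)
    (s : seq (susp A)) : susp A :=
  match s with
  | [:: x] => to_susp (dA (of_susp x))
  | [:: x; y] => to_susp (- mul (gsign 1 (of_susp x)) (of_susp y))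
  | _ => 0
  end.

Definition bar_diff (A : gradedType k) (mul : A -> A -> A) (dA : A -> A) :
  bar A -> bar A := coder_ext (bar_cogen mul dA).
End CobarBar.

(* Main.v *)
(** The tensor coalgebra [T^c(B)] acts on words by distributing the letters of a word
    of [B], in order and with Koszul signs, over the letters of a word [x_1 ... x_n].
    The same formula defines the action on the cobar and on the bar construction; it is
    compatible with concatenation and with deconcatenation, and, because the product of
    [T^c(B)] is a morphism of coalgebras, it is a module structure as soon as this holds on
    letters.  Compatibility with the differentials is proved on the cobar side by checking
    it on letters (the set of elements where it holds is closed under products), and on the
    bar side by induction on word length, since an element is determined by its
    deconcatenation together with its corestriction.  Uniqueness follows in the same two
    ways. *)

Require Import Defs.
From mathcomp Require Import all_boot all_order all_algebra.
From mathcomp Require Import ring zify.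
From mathcomp Require Import boolp.
Import GRing.Theory.
Local Open Scope ring_scope.
Set Implicit Arguments.
Unset Strict Implicit.
Unset Printing Implicit Defensive.

(** Signs depend on degrees, while the structures live on all of [Tplus] by multilinear extension
    from homogeneous words. The three operations involved (the action, the coderivation, the product
    of $T^c(B)$) are therefore first written as formal linear combinations of lists of pairs
    (degree, element). Signs are read off the labels and the identities follow by recursion on
    lists; homogeneity enters only on returning to tensors. Empty words are the second point. In
    [Tplus] the empty word is 0, but on labelled lists it is kept and behaves as a unit, so the
    identities become sums over all cuts of a list, without boundary cases. In a deconcatenation the
    trivial cuts then contribute 0. Suspension only relabels degrees: [desusp C] and [C] are the
    same module, as are [susp A] and [A]. The signs that distribute the letters of [B] thus have
    exponents differing by one in the two gradings. The discrepancy is absorbed by the signs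
    $(-1)^{c_1+1}$ and $(-1)^{a_1+1}$ of the two differentials together with the sign $(-1)^v$ in
    the module axiom for differentials. *)

Arguments wval {k V} s.
Arguments word {k V} s.

(** * Signs, splittings, formal linear combinations *)

Section Signs.
Context (k : fieldType).

Lemma signD (m n : int) : (-1) ^ (m + n) = (-1) ^ m * (-1) ^ n :> k.
Proof. by rewrite expfzDr // oppr_eq0 oner_eq0. Qed.

Lemma sign_even (m : int) : (-1) ^ (m * 2) = 1 :> k.
Proof.
rewrite mulrC -exprz_exp; have -> : ((-1) ^ (2 : int) : k) = 1 by rewrite -exprnP sqrrN expr1n.
by rewrite exp1rz.
Qed.

(** Signs are compared by exhibiting half the difference of two exponents: [q] is that half, and the
    remaining polynomial identity between degrees is left to [ring]. *)
Lemma sign_eq (q m n : int) : m = n + q * 2 -> (-1) ^ m = (-1) ^ n :> k.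
Proof. by move=> ->; rewrite signD sign_even mulr1. Qed.

Lemma sign_opp (q m n : int) : m = n + 1 + q * 2 -> (-1) ^ m = - (-1) ^ n :> k.
Proof. by move=> /sign_eq ->; rewrite signD expr1z mulrN1. Qed.

Lemma sign_sqr (m : int) : (-1) ^ m * (-1) ^ m = 1 :> k.
Proof. by rewrite -signD (_ : m + m = m * 2) ?sign_even //; ring. Qed.
End Signs.

Lemma scalerCD (k : fieldType) (W : lmodType k) (a c : k) (x y : W) :
  a *: (c *: x) + c *: y = c *: (a *: x + y).
Proof. by rewrite scalerDr !scalerA mulrC. Qed.

Section Splits.
Context (T : Type).
Implicit Types (s t : seq T).

(** Deconcatenation with both trivial cuts, as in the counital tensor coalgebra. The recursive form
    allows induction on the list; [big_splits] translates to the [take]/[drop] sums of the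
    definitions. *)
Fixpoint splits s : seq (seq T * seq T) :=
  if s is x :: s' then ([::], s) :: [seq (x :: a.1, a.2) | a <- splits s']
  else [:: ([::], [::])].

Lemma splitsE s : splits s = [seq (take i s, drop i s) | i <- iota 0 (size s).+1].
Proof.
elim: s => [|x s IH] //; rewrite [splits _]/= IH -map_comp.
by rewrite -[(size (x :: s)).+1]/(1 + (size s).+1)%N iotaD (iotaDl 1 0) map_cat -map_comp.
Qed.

Lemma big_splits (W : nmodType) (F : seq T -> seq T -> W) s :
  \sum_(a <- splits s) F a.1 a.2
  = \sum_(0 <= i < (size s).+1) F (take i s) (drop i s).
Proof. by rewrite splitsE big_map /index_iota subn0. Qed.

Lemma big_splits_cons (W : nmodType) (F : seq T -> seq T -> W) x s :
  \sum_(a <- splits (x :: s)) F a.1 a.2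
  = F [::] (x :: s) + \sum_(a <- splits s) F (x :: a.1) a.2.
Proof. by rewrite /= big_cons big_map. Qed.

Lemma big_splits_cat (W : nmodType) (F : seq T -> seq T -> W) s x t :
  \sum_(a <- splits (s ++ x :: t)) F a.1 a.2
  = \sum_(a <- splits s) F a.1 (a.2 ++ x :: t)
    + \sum_(a <- splits t) F (s ++ x :: a.1) a.2.
Proof.
elim: s F => [|y s IH] F; first by rewrite big_splits_cons /= big_seq1.
rewrite cat_cons !big_splits_cons (IH (fun a => F (y :: a))) addrA.
by rewrite (big_splits_cons (fun a b => F a (b ++ x :: t))).
Qed.

(** Coassociativity of deconcatenation: both sides run over the cuts into three pieces. Most
    reindexings of sums below are instances of it. *)
Lemma splits_coassoc (W : nmodType) (F : seq T -> seq T -> seq T -> W) s :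
  \sum_(a <- splits s) \sum_(c <- splits a.1) F c.1 c.2 a.2
  = \sum_(a <- splits s) \sum_(c <- splits a.2) F a.1 c.1 c.2.
Proof.
elim: s F => [|x s IH] F; first by rewrite /= !big_seq1.
rewrite (big_splits_cons (fun a b => \sum_(c <- splits a) F c.1 c.2 b)).
rewrite (big_splits_cons (fun a b => \sum_(c <- splits b) F a c.1 c.2)).
rewrite [in RHS](big_splits_cons (F [::])).
rewrite /= big_seq1 /= -addrA; congr (_ + _).
under eq_bigr do rewrite big_cons big_map /=.
by rewrite big_split /= (IH (fun a => F (x :: a))).
Qed.

End Splits.

Lemma mem_splits (T : eqType) (s : seq T) a : a \in splits s -> s = a.1 ++ a.2.
Proof. by rewrite splitsE => /mapP[i _ ->]; rewrite cat_take_drop. Qed.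

Lemma splits_map (T U : Type) (f : T -> U) s :
  splits (map f s) = [seq (map f a.1, map f a.2) | a <- splits s].
Proof. by elim: s => //= x s ->; rewrite -!map_comp. Qed.

Lemma splits2_coassoc (T U : Type) (W : nmodType)
    (F : seq T -> seq T -> seq T -> seq U -> seq U -> seq U -> W) u v :
  \sum_(a <- splits u) \sum_(c <- splits v)
    \sum_(a' <- splits a.1) \sum_(c' <- splits c.1) F a'.1 a'.2 a.2 c'.1 c'.2 c.2
  = \sum_(a <- splits u) \sum_(c <- splits v)
    \sum_(a' <- splits a.2) \sum_(c' <- splits c.2) F a.1 a'.1 a'.2 c.1 c'.1 c'.2.
Proof.
under eq_bigr do rewrite exchange_big.
under [RHS]eq_bigr do rewrite exchange_big.
rewrite (splits_coassoc (fun a1 a2 a3 =>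
  \sum_(c <- splits v) \sum_(c' <- splits c.1) F a1 a2 a3 c'.1 c'.2 c.2)).
apply: eq_bigr => a _; apply: eq_bigr => a' _.
exact: (splits_coassoc (F a.1 a'.1 a'.2)).
Qed.

Lemma splits_nilp (T : Type) (W : nmodType) (F : seq T -> seq T -> W) u :
  (forall x a c, F (x :: a) c = 0) -> \sum_(a <- splits u) F a.1 a.2 = F [::] u.
Proof.
move=> F0; case: u => [|x u]; first by rewrite big_seq1.
by rewrite big_splits_cons big1 ?addr0 // => a _; apply: F0.
Qed.

Lemma splits_nilr (T : Type) (W : nmodType) (F : seq T -> seq T -> W) u :
  (forall x a c, F a (x :: c) = 0) -> \sum_(a <- splits u) F a.1 a.2 = F u [::].
Proof.
elim: u F => [|x u IH] F F0; first by rewrite big_seq1.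
by rewrite big_splits_cons F0 add0r (IH (fun a => F (x :: a))).
Qed.

(** A list [l : seq (k * X)] is a formal linear combination of elements of [X]. Below, [X]
    is a type of lists of pairs (degree, element), so that the sign identities only see the
    degree labels and hold without any homogeneity assumption. *)
Section Eval.
Context (k : fieldType) (X : Type).
Implicit Types (l : seq (k * X)).

Definition ev (W : lmodType k) l (F : X -> W) : W := \sum_(x <- l) x.1 *: F x.2.

Lemma evZ (W : lmodType k) a l (F : X -> W) :
  ev l (fun x => a *: F x) = a *: ev l F.
Proof. by rewrite /ev scaler_sumr; apply: eq_bigr => x _; rewrite !scalerA mulrC. Qed.

Lemma evD (W : lmodType k) l (F G : X -> W) :
  ev l (fun x => F x + G x) = ev l F + ev l G.
Proof. by rewrite /ev -big_split; apply: eq_bigr => x _; rewrite scalerDr. Qed.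

Lemma ev_sum (W : lmodType k) I (r : seq I) l (F : I -> X -> W) :
  ev l (fun x => \sum_(i <- r) F i x) = \sum_(i <- r) ev l (F i).
Proof. by rewrite /ev exchange_big; apply: eq_bigr => x _; rewrite scaler_sumr. Qed.

Lemma ev_lin (W W' : lmodType k) (f : W -> W') l F :
  linear f -> f (ev l F) = ev l (f \o F).
Proof.
by move=> fL; rewrite /ev (lin_sum fL); apply: eq_bigr => x _; rewrite (linZ fL).
Qed.

Lemma ev0 (W : lmodType k) l : ev l (fun=> 0 : W) = 0.
Proof. by rewrite /ev big1 // => x _; rewrite scaler0. Qed.

Lemma ev1 (W : lmodType k) x (F : X -> W) : ev [:: (1, x)] F = F x.
Proof. by rewrite /ev big_seq1 scale1r. Qed.

Lemma eq_ev_all (W : lmodType k) l (F G : X -> W) :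
  (forall x, F x = G x) -> ev l F = ev l G.
Proof. by move=> FG; apply: eq_bigr => x _; rewrite FG. Qed.

Lemma ev_cat (W : lmodType k) l l' (F : X -> W) : ev (l ++ l') F = ev l F + ev l' F.
Proof. exact: big_cat. Qed.

Lemma ev_flatten (W : lmodType k) I (r : seq I) (L : I -> seq (k * X)) (F : X -> W) :
  ev (flatten [seq L i | i <- r]) F = \sum_(i <- r) ev (L i) F.
Proof. by rewrite /ev big_flatten big_map. Qed.
End Eval.

Lemma eq_ev (k : fieldType) (X : eqType) (W : lmodType k) (l : seq (k * X)) (F G : X -> W) :
  (forall x, x \in l -> F x.2 = G x.2) -> ev l F = ev l G.
Proof.
by move=> FG; rewrite /ev [LHS]big_seq [RHS]big_seq; apply: eq_bigr => x /FG ->.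
Qed.

(** * Homogeneous words and homogeneous elements *)

Section Words.
Context (k : fieldType) (V : gradedType k).
Implicit Types (s : seq (int * V)).

Lemma hword_cat s t : hword (s ++ t) <-> hword s /\ hword t.
Proof.
split=> [h|[hs ht] p]; last by rewrite mem_cat => /orP[/hs|/ht].
by split=> p ps; apply: h; rewrite mem_cat ps ?orbT.
Qed.

Lemma hword_cons (p : int * V) s : hword (p :: s) <-> homog p.1 p.2 /\ hword s.
Proof.
split=> [h|[hp ht] q]; last by rewrite inE => /predU1P[->|/ht].
by split=> [|q qt]; apply: h; rewrite inE ?eqxx ?qt ?orbT.
Qed.

Lemma hword_splits s a : hword s -> a \in splits s -> hword a.1 /\ hword a.2.
Proof. by move=> hs /mem_splits es; apply/hword_cat; rewrite -es. Qed.

Lemma wdeg_splits s a : a \in splits s -> wdeg s = wdeg a.1 + wdeg a.2.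
Proof. by move=> /mem_splits ->; rewrite wdeg_cat. Qed.

Lemma wdeg_nil : @wdeg k V [::] = 0. Proof. exact: big_nil. Qed.

Lemma size_hcomps (s : seq V) t : t \in hcomps s -> size t = size s.
Proof.
elim: s t => [|v s IH] t /=; first by rewrite inE => /eqP ->.
by case/allpairsP=> -[i t'] /= [_ /IH <- ->].
Qed.

(** The length is kept among the hypotheses so that a nonempty argument is tested on nonempty words
    only. *)
Lemma multilinear_eq (W : lmodType k) (f g : seq V -> W) (s : seq V) :
  multilinear f -> multilinear g ->
  (forall t, hword t -> size t = size s -> f (wval t) = g (wval t)) -> f s = g s.
Proof.
move=> fm gm fg; rewrite -(hext_wval s fm) -(hext_wval s gm) /hext.
rewrite [LHS]big_seq [RHS]big_seq; apply: eq_bigr => t ts /=.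
by rewrite fg ?(size_hcomps ts) //; apply: hcomps_hword ts.
Qed.

Lemma multilinear_hmulti (W : lmodType k) (f : seq V -> W) :
  multilinear f -> hmultilinear (f \o wval).
Proof. by move=> fm s1 s2 i a x y; rewrite /= /wval !map_cat /= fm. Qed.

(** Homogeneous words span: by [hext_wval] a word is the sum of the words formed from the components
    of its letters. *)
Lemma Tplus_hind (P : Tplus V -> Prop) :
  P 0 ->
  (forall a s t, s != [::] -> hword s -> P t -> P (a *: word (wval s) + t)) ->
  forall t, P t.
Proof.
move=> P0 PD; elim/Tplus_ind => // a s t s0 Pt.
rewrite -(hext_wval s (@word_multilinear k V)) /hext scaler_sumr big_seq.
elim/big_rec: _ t Pt => [|w x /[dup] ws /size_hcomps sw IH] t Pt; first by rewrite add0r.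
rewrite -addrA; apply: PD; [|exact: hcomps_hword ws|exact: IH].
by rewrite -size_eq0 sw size_eq0.
Qed.

(** An element of degree [i] is its own projection. So the induction runs over an arbitrary element
    and proves [P] for its projection, which for a word is a sum of homogeneous words of degree
    [i]. *)
Lemma Tplus_homog_ind (i : int) (P : Tplus V -> Prop) :
  P 0 ->
  (forall a s t, s != [::] -> hword s -> wdeg s = i -> P t ->
     P (a *: word (wval s) + t)) ->
  forall t, homog i t -> P t.
Proof.
move=> P0 PD t; rewrite /homog => <-; rewrite /gproj /= .
elim/Tplus_ind: t => [|a s t s0 Pt]; first by rewrite (lin0 (Tproj_linear _)).
rewrite Tproj_linear Tproj_word /hext scaler_sumr big_seq.
elim/big_rec: _ {t} (Tproj i t) Pt => [|w x /[dup] ws /size_hcomps sw IH] t Pt.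
  by rewrite add0r.
rewrite -addrA /word_part; case: eqP => [wi|_]; last by rewrite scaler0 add0r; apply: IH.
apply: PD => //; [|exact: hcomps_hword ws|exact: IH].
by rewrite -size_eq0 sw size_eq0.
Qed.

Lemma homog0 (U : gradedType k) i : homog i (0 : U).
Proof. exact: lin0 (gproj_linear i). Qed.

Lemma homog_lin (U : gradedType k) i a (x y : U) :
  homog i x -> homog i y -> homog i (a *: x + y).
Proof. by rewrite /homog gproj_linear => -> ->. Qed.

Lemma homogZ (U : gradedType k) i a (x : U) : homog i x -> homog i (a *: x).
Proof. by move=> hx; rewrite -[_ *: x]addr0; apply: homog_lin hx (homog0 _ _). Qed.

Lemma homogD (U : gradedType k) i (x y : U) : homog i x -> homog i y -> homog i (x + y).
Proof. by move=> hx hy; rewrite -[x]scale1r; apply: homog_lin. Qed.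

Lemma homogN (U : gradedType k) i (x : U) : homog i x -> homog i (- x).
Proof. by move=> hx; rewrite -scaleN1r; apply: homogZ. Qed.

Lemma homog_sum (U : gradedType k) i I (r : seq I) (F : I -> U) :
  (forall j, homog i (F j)) -> homog i (\sum_(j <- r) F j).
Proof. by move=> hF; elim/big_ind: _ => //; [exact: homog0|move=> *; apply: homogD]. Qed.

Lemma homog_sum_seq (U : gradedType k) i (I : eqType) (r : seq I) (F : I -> U) :
  (forall j, j \in r -> homog i (F j)) -> homog i (\sum_(j <- r) F j).
Proof.
by move=> hF; rewrite big_seq; elim/big_ind: _ => //; [exact: homog0|move=> *; apply: homogD].
Qed.

Lemma homog_ev (U : gradedType k) i (X : eqType) (l : seq (k * X)) (F : X -> U) :
  (forall x, x \in l -> homog i (F x.2)) -> homog i (ev l F).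
Proof. by move=> hF; apply: homog_sum_seq => x /hF; apply: homogZ. Qed.

Lemma word_homog s : hword s -> homog (wdeg s) (word (wval s)).
Proof.
move=> hs; rewrite /homog /gproj /= Tproj_word hext_hword //; last exact: word_part_hmultilinear.
by rewrite /word_part eqxx.
Qed.

Lemma gsign_linear e : linear (@gsign k V e).
Proof. by apply: gsum_linear => i a x y; rewrite scalerDr !scalerA mulrC. Qed.

Lemma gsign_homog e i (x : V) : homog i x -> gsign e x = (-1) ^ (e * i) *: x.
Proof. by move=> hx; rewrite /gsign (gsum_homog _ hx) // => j; rewrite scaler0. Qed.

Lemma gsum_eq (W : lmodType k) (f g : V -> W) x : linear f -> linear g ->
  (forall i y, homog i y -> f y = g y) -> f x = g x.
Proof.
move=> fL gL fg; rewrite (gsupp_sum x) (lin_sum fL) (lin_sum gL).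
by apply: eq_bigr => i _; apply: fg (homog_gproj _ _).
Qed.
End Words.

Lemma homog_pure (k : fieldType) (U V : gradedType k) i j (u : U) (v : V) :
  homog i u -> homog j v -> homog (i + j) (pure u v).
Proof.
move=> hu hv; rewrite /homog /gproj /= tens_proj_pure (gsum_homog _ hu) => [|l].
  by rewrite addrC addKr hv.
exact: pure0l.
Qed.

Lemma eq_linear_Tplus (k : fieldType) (V : gradedType k) (W : lmodType k)
    (f g : Tplus V -> W) t : linear f -> linear g ->
  (forall s, s != [::] -> hword s -> f (word (wval s)) = g (word (wval s))) -> f t = g t.
Proof.
move=> fL gL fg; elim/Tplus_hind: t => [|a s t s0 hs IH].
  by rewrite (lin0 fL) (lin0 gL).
by rewrite fL gL fg // IH.
Qed.

Lemma eq_linear_homog (k : fieldType) (V : gradedType k) (W : lmodType k)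
    (f g : Tplus V -> W) j t : linear f -> linear g -> homog j t ->
  (forall s, s != [::] -> hword s -> wdeg s = j ->
     f (word (wval s)) = g (word (wval s))) -> f t = g t.
Proof.
move=> fL gL ht fg; elim/Tplus_homog_ind: ht => [|a s t' s0 hs sj IH].
  by rewrite (lin0 fL) (lin0 gL).
by rewrite fL gL fg // IH.
Qed.

Lemma eq_linear_tens (k : fieldType) (U V : lmodType k) (W : lmodType k)
    (f g : tens U V -> W) t : linear f -> linear g ->
  (forall u v, f (pure u v) = g (pure u v)) -> f t = g t.
Proof.
move=> fL gL fg; elim/tens_ind: t => [|a u v t IH]; first by rewrite (lin0 fL) (lin0 gL).
by rewrite fL gL fg IH.
Qed.

Lemma Tplus_graded_map (k : fieldType) (V W : gradedType k) e (f : Tplus V -> W) :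
  linear f ->
  (forall s, s != [::] -> hword s -> homog (wdeg s + e) (f (word (wval s)))) ->
  graded_map e f.
Proof.
move=> fL fh; split=> // i t; elim/Tplus_homog_ind => [|a s t' s0 hs <- IH].
  by rewrite (lin0 fL); apply: homog0.
by rewrite fL; apply: homog_lin IH; apply: fh.
Qed.

Section LabelledWords.
Context (k : fieldType) (V : gradedType k) (W : lmodType k).
Implicit Types (F : seq (int * V) -> W).

(** A given entry falls into exactly one of the two pieces of each cut, so linearity in each piece
    suffices. *)
Lemma big_splits_hmultilinear (F : seq (int * V) -> seq (int * V) -> W) :
  (forall c, hmultilinear (F^~ c)) -> (forall a, hmultilinear (F a)) ->
  hmultilinear (fun v => \sum_(a <- splits v) F a.1 a.2).
Proof.
move=> Fl Fr s1 s2 i a x y; rewrite !big_splits_cat scalerDr addrACA !scaler_sumr.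
by rewrite -!big_split /=; congr (_ + _); apply: eq_bigr => c _; rewrite ?Fl ?Fr.
Qed.

Lemma big_splits_multilinear (F : seq V -> seq V -> W) :
  (forall c, multilinear (F^~ c)) -> (forall a, multilinear (F a)) ->
  multilinear (fun v => \sum_(a <- splits v) F a.1 a.2).
Proof.
move=> Fl Fr s1 s2 a x y; rewrite !big_splits_cat scalerDr addrACA !scaler_sumr.
by rewrite -!big_split /=; congr (_ + _); apply: eq_bigr => c _; rewrite ?Fl ?Fr.
Qed.

Lemma wdeg_entry (s1 s2 : seq (int * V)) i x y :
  wdeg (s1 ++ (i, x) :: s2) = wdeg (s1 ++ (i, y) :: s2).
Proof. by rewrite !wdeg_cat !wdeg_cons. Qed.

Lemma hmultilinear_wdeg (c : int -> k) F :
  hmultilinear F -> hmultilinear (fun s => c (wdeg s) *: F s).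
Proof.
move=> Fm s1 s2 i a x y; rewrite Fm (wdeg_entry s1 s2 i _ 0).
by rewrite (wdeg_entry s1 s2 i x 0) (wdeg_entry s1 s2 i y 0) scalerDr !scalerA mulrC.
Qed.

Lemma hmultilinear_sum I (r : seq I) (F : I -> seq (int * V) -> W) :
  (forall j, hmultilinear (F j)) -> hmultilinear (fun s => \sum_(j <- r) F j s).
Proof.
by move=> Fm s1 s2 i a x y; rewrite scaler_sumr -big_split; apply: eq_bigr => j _; apply: Fm.
Qed.

(** The only consequence of multilinearity that the formal identities below rely on. *)
Definition kills F := forall s1 s2 i, F (s1 ++ (i, 0) :: s2) = 0.

Lemma hmultilinear_kills F : hmultilinear F -> kills F.
Proof.
move=> Fm s1 s2 i; have fL : linear (fun x => F (s1 ++ (i, x) :: s2)) by move=> *; apply: Fm.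
exact: lin0 fL.
Qed.

Lemma kills_cons F x : kills F -> kills (fun s => F (x :: s)).
Proof. by move=> Fk s1 s2 i; apply: (Fk (x :: s1)). Qed.

Lemma kills_head F i s : kills F -> F ((i, 0) :: s) = 0.
Proof. by move=> Fk; apply: (Fk [::]). Qed.
End LabelledWords.

(** * Signed distributions of words *)

Section ActWords.
Context (k : fieldType) (B V : gradedType k) (theta : seq B -> V -> V).
Implicit Types (v : seq (int * B)) (s t : seq (int * V)).

(** The letters of [s] receive consecutive, possibly empty, blocks of [v]. *)
Fixpoint act_words v s : seq (k * seq (int * V)) :=
  if s is c :: s' then
    [seq ((-1) ^ (c.1 * wdeg a.2) * x.1,
          (wdeg a.1 + c.1, theta (wval a.1) c.2) :: x.2)
       | a <- splits v, x <- act_words a.2 s']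
  else if v is [::] then [:: (1, [::])] else [::].

Lemma ev_act_cons (W : lmodType k) v c s (F : _ -> W) :
  ev (act_words v (c :: s)) F
  = \sum_(a <- splits v) (-1) ^ (c.1 * wdeg a.2) *:
      ev (act_words a.2 s) (fun x => F ((wdeg a.1 + c.1, theta (wval a.1) c.2) :: x)).
Proof.
rewrite /ev /= big_allpairs_dep; apply: eq_bigr => a _.
by rewrite scaler_sumr; apply: eq_bigr => x _; rewrite scalerA.
Qed.

Lemma ev_act_nil (W : lmodType k) v (F : _ -> W) :
  ev (act_words v [::]) F = if v is [::] then F [::] else 0.
Proof. by case: v => [|x v] /=; rewrite ?ev1 // /ev big_nil. Qed.

Lemma ev_act1 (W : lmodType k) v c (F : _ -> W) :
  ev (act_words v [:: c]) F = F [:: (wdeg v + c.1, theta (wval v) c.2)].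
Proof.
rewrite ev_act_cons (splits_nilr (F := fun a1 a2 => (-1) ^ (c.1 * wdeg a2) *:
  ev (act_words a2 [::]) (fun x => F ((wdeg a1 + c.1, theta (wval a1) c.2) :: x)))).
  by rewrite ev_act_nil wdeg_nil mulr0 expr0z scale1r.
by move=> x a e; rewrite ev_act_nil scaler0.
Qed.

(** The letters of [v] given to [t] travel across [s], whence the sign. This one formula yields the
    compatibility with concatenation and the one with deconcatenation. *)
Lemma ev_act_cat (W : lmodType k) v s t (F : _ -> W) :
  ev (act_words v (s ++ t)) F
  = \sum_(a <- splits v) (-1) ^ (wdeg s * wdeg a.2) *:
      ev (act_words a.1 s) (fun x => ev (act_words a.2 t) (fun y => F (x ++ y))).
Proof.
elim: s v F => [|c s IH] v F.
  under eq_bigr do rewrite ev_act_nil.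
  case: v => [|z v]; first by rewrite big_seq1 /= wdeg_nil mul0r expr0z scale1r.
  rewrite (big_splits_cons (fun a1 a2 => (-1) ^ (wdeg [::] * wdeg a2) *:
     match a1 with [::] => ev (act_words a2 t) (fun y => F ([::] ++ y)) | _ => 0 end)).
  by rewrite big1 ?addr0 => [|a _]; rewrite ?scaler0 // wdeg_nil mul0r expr0z scale1r.
rewrite cat_cons ev_act_cons.
under eq_bigr do rewrite IH.
under [RHS]eq_bigr do rewrite ev_act_cons.
(* Both sides are sums over the cuts of [v] into three blocks: [x] for the letter [c], [y] for [s],
   [z] for [t]. *)
pose H x y z : W := (-1) ^ (c.1 * (wdeg y + wdeg z) + wdeg s * wdeg z) *:
  ev (act_words y s) (fun u => ev (act_words z t) (fun w =>
     F ((wdeg x + c.1, theta (wval x) c.2) :: u ++ w))).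
transitivity (\sum_(a <- splits v) \sum_(e <- splits a.2) H a.1 e.1 e.2).
  apply: eq_bigr => a _; rewrite scaler_sumr; apply: eq_big_seq => e /wdeg_splits ea.
  by rewrite scalerA -signD /H ea.
rewrite -splits_coassoc; apply: eq_bigr => a _; rewrite scaler_sumr.
apply: eq_big_seq => e /wdeg_splits ea; rewrite scalerA -signD /H wdeg_cons.
by congr (_ ^ _ *: _); ring.
Qed.

Lemma act_wordsP v s x : x \in act_words v s ->
  wdeg x.2 = wdeg v + wdeg s /\ size x.2 = size s.
Proof.
elim: s v x => [|c s IH] v x.
  by case: v => [|y v] //=; rewrite inE => /eqP -> /=; rewrite !wdeg_nil addr0.
case/allpairsPdep=> a [z [/wdeg_splits ea /IH[dz sz] ->]] /=.
by rewrite !wdeg_cons ea dz sz; split=> //=; ring.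
Qed.

Section Theory.
Hypothesis theta_linear : (forall w, multilinear (theta^~ w)) /\ (forall u, linear (theta u)).
Hypothesis theta_degree : forall v i w, hword v -> homog i w ->
    homog (wdeg v + i) (theta (wval v) w).

Lemma act_words_hword v s x : x \in act_words v s ->
  hword v -> hword s -> hword x.2.
Proof.
elim: s v x => [|c s IH] v x; first by case: v => [|y v] //=; rewrite inE => /eqP ->.
move=> /allpairsPdep[a [z [av /IH hz ->]]] hv /hword_cons[hc hs] /=.
have [h1 h2] := hword_splits hv av.
by apply/hword_cons; split; [apply: theta_degree|apply: hz].
Qed.

Context (W : lmodType k) (F : seq (int * V) -> W).
Hypothesis F_multi : hmultilinear F.

Lemma theta_entry_hmulti x s : hmultilinear
  (fun a : seq (int * B) => F ((wdeg a + x.1, theta (wval a) x.2) :: s)).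
Proof.
move=> s1 s2 i a y z; rewrite [wdeg _](wdeg_entry _ _ _ _ 0).
rewrite [wdeg (_ ++ (i, y) :: _)](wdeg_entry _ _ _ _ 0).
rewrite [wdeg (_ ++ (i, z) :: _)](wdeg_entry _ _ _ _ 0).
by rewrite {1}/wval !map_cat /= (theta_linear.1 x.2) (F_multi [::]) /wval !map_cat.
Qed.
End Theory.

Lemma act_words_hmultil (W : lmodType k) (F : seq (int * V) -> W) s :
  (forall w, multilinear (theta^~ w)) /\ (forall u, linear (theta u)) ->
  hmultilinear F -> hmultilinear (fun v => ev (act_words v s) F).
Proof.
move=> tl; elim: s F => [|c s IH] F Fm.
  move=> s1 s2 i a x y; rewrite !ev_act_nil.
  by case: s1 => [|? ?] /=; rewrite scaler0 addr0.
move=> s1 s2 i a x y; rewrite !ev_act_cons; move: s1 s2 i a x y.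
apply: (big_splits_hmultilinear (F := fun a1 a2 => (-1) ^ (c.1 * wdeg a2) *:
      ev (act_words a2 s) (fun x => F ((wdeg a1 + c.1, theta (wval a1) c.2) :: x)))).
  move=> a s1 s2 i e x y; rewrite scalerCD; congr (_ *: _).
  rewrite -evZ -evD; apply: eq_ev_all => z; exact: (theta_entry_hmulti tl Fm c z).
move=> a; apply: (hmultilinear_wdeg (fun n => (-1) ^ (c.1 * n))).
by apply: IH; apply: hmulti_cons.
Qed.

Lemma act_words_hmultir (W : lmodType k) (F : seq (int * V) -> W) v :
  (forall u, linear (theta u)) ->
  hmultilinear F -> hmultilinear (fun s => ev (act_words v s) F).
Proof.
move=> tl Fm s1; elim: s1 v F Fm => [|c s1 IH] v F Fm s2 i a x y.
  rewrite !cat0s !ev_act_cons scaler_sumr -big_split; apply: eq_bigr => e _ /=.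
  rewrite scalerCD; congr (_ *: _); rewrite -evZ -evD.
  by apply: eq_ev_all => z; rewrite tl (Fm [::]).
rewrite !cat_cons !ev_act_cons scaler_sumr -big_split; apply: eq_bigr => e _ /=.
by rewrite scalerCD; congr (_ *: _); apply: IH; apply: hmulti_cons.
Qed.
End ActWords.

(** * Coderivations on labelled words *)

Section CoderWords.
Context (k : fieldType) (V : gradedType k) (f : seq V -> V).
Implicit Types (s t : seq (int * V)).

(** The block fed to [f] either starts at the first letter [x], its end being a cut of the tail, or
    starts later and then crosses [x] with a sign. All positive arities are treated at once. *)
Fixpoint coder_words s : seq (k * seq (int * V)) :=
  if s is x :: s' then
    [seq (1, (wdeg (x :: c.1) + 1, f (wval (x :: c.1))) :: c.2) | c <- splits s']
    ++ [seq ((-1) ^ x.1 * y.1, x :: y.2) | y <- coder_words s']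
  else [::].

Lemma ev_coder_cons (W : lmodType k) x s (F : _ -> W) :
  ev (coder_words (x :: s)) F
  = \sum_(c <- splits s) F ((wdeg (x :: c.1) + 1, f (wval (x :: c.1))) :: c.2)
    + (-1) ^ x.1 *: ev (coder_words s) (fun y => F (x :: y)).
Proof.
rewrite [coder_words _]/= ev_cat /ev !big_map scaler_sumr; congr (_ + _).
  by apply: eq_bigr => c _; rewrite scale1r.
by apply: eq_bigr => c _; rewrite scalerA.
Qed.

Lemma ev_coder_nil (W : lmodType k) (F : _ -> W) : ev (coder_words [::]) F = 0.
Proof. exact: big_nil. Qed.

(** The coderivation property. The block on which [f] has acted is a single letter of the result,
    hence lies entirely on one side of a cut; on the right side it has crossed the whole left
    piece. *)
Lemma coder_words_splits (W : lmodType k) s (H : _ -> _ -> W) :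
  ev (coder_words s) (fun w => \sum_(a <- splits w) H a.1 a.2)
  = \sum_(a <- splits s) (ev (coder_words a.1) (H^~ a.2)
      + (-1) ^ wdeg a.1 *: ev (coder_words a.2) (H a.1)).
Proof.
elim: s H => [|x s IH] H; first by rewrite big_seq1 /= !ev_coder_nil scaler0 addr0.
rewrite ev_coder_cons; under eq_bigr do rewrite big_splits_cons.
rewrite big_split /=.
under [X in (-1) ^ x.1 *: X]eq_ev_all do rewrite big_splits_cons.
rewrite evD (IH (fun a => H (x :: a))) scalerDr addrACA.
rewrite (big_splits_cons (fun a1 a2 => ev (coder_words a1) (H^~ a2)
      + (-1) ^ wdeg a1 *: ev (coder_words a2) (H a1))).
rewrite ev_coder_nil add0r wdeg_nil expr0z scale1r ev_coder_cons; congr (_ + _).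
rewrite [RHS]big_split /=; under [X in _ = X + _]eq_bigr do rewrite ev_coder_cons.
rewrite [X in _ = X + _]big_split /= (splits_coassoc (fun c1 c2 a2 =>
    H ((wdeg (x :: c1) + 1, f (wval (x :: c1))) :: c2) a2)) -addrA; congr (_ + _).
rewrite scaler_sumr -big_split; apply: eq_bigr => a _ /=.
by rewrite scalerDr scalerA wdeg_cons signD.
Qed.

Lemma coder_wordsP s x : x \in coder_words s ->
  wdeg x.2 = wdeg s + 1 /\ x.2 != [::].
Proof.
elim: s x => [|c s IH] x //=; rewrite mem_cat => /orP[]/mapP[y ys ->] /=.
  by rewrite !wdeg_cons (wdeg_splits ys); split=> //=; ring.
by have [dy _] := IH _ ys; rewrite !wdeg_cons dy; split=> //=; ring.
Qed.

Lemma coder_words_hword s x :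
  (forall v, v != [::] -> hword v -> homog (wdeg v + 1) (f (wval v))) ->
  x \in coder_words s -> hword s -> hword x.2.
Proof.
move=> fd; elim: s x => [|c s IH] x //=; rewrite mem_cat => /orP[]/mapP[y ys ->] /=.
  move=> /hword_cons[hc hs]; have [h1 h2] := hword_splits hs ys.
  by apply/hword_cons; split=> //=; apply: (fd (c :: y.1)) => //; apply/hword_cons.
by move=> /hword_cons[hc hs]; apply/hword_cons; split=> //; apply: IH hs.
Qed.
End CoderWords.

(** * The product of the tensor coalgebra on labelled words *)

Section MulWords.
Context (k : fieldType) (B : gradedType k) (b : seq B -> seq B -> B).
Implicit Types (u v w : seq (int * B)).

(** The terms of word length exactly [p]. The sign moves the first block of [v] past the rest of
    [u]; for [p = 0] only the product of two empty words survives. *)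
Fixpoint mul_words p u v : seq (k * seq (int * B)) :=
  if p is q.+1 then
    flatten [seq [seq ((-1) ^ (wdeg c.1 * wdeg a.2) * x.1,
                       (wdeg a.1 + wdeg c.1, b (wval a.1) (wval c.1)) :: x.2)
                    | c <- splits v, x <- mul_words q a.2 c.2] | a <- splits u]
  else if nilp u && nilp v then [:: (1, [::])] else [::].

Lemma ev_mul0 (W : lmodType k) u v (F : _ -> W) :
  ev (mul_words 0 u v) F = if nilp u && nilp v then F [::] else 0.
Proof. by rewrite /=; case: ifP => _; rewrite ?ev1 // /ev big_nil. Qed.

Lemma ev_mulS (W : lmodType k) p u v (F : _ -> W) :
  ev (mul_words p.+1 u v) F
  = \sum_(a <- splits u) \sum_(c <- splits v) (-1) ^ (wdeg c.1 * wdeg a.2) *: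
      ev (mul_words p a.2 c.2)
         (fun x => F ((wdeg a.1 + wdeg c.1, b (wval a.1) (wval c.1)) :: x)).
Proof.
rewrite [mul_words _ _ _]/= ev_flatten; apply: eq_bigr => a _.
rewrite /ev big_allpairs_dep; apply: eq_bigr => c _.
by rewrite scaler_sumr; apply: eq_bigr => x _; rewrite scalerA.
Qed.

(** The product is a morphism of coalgebras for any family [b]: cutting a product after its [l]-th
    letter separates the blocks of [u] and of [v] used by the first [l] letters from the others. *)
Lemma mul_words_splits (W : lmodType k) p u v (H : _ -> _ -> W) :
  ev (mul_words p u v) (fun w => \sum_(a <- splits w) H a.1 a.2)
  = \sum_(0 <= l < p.+1) \sum_(a <- splits u) \sum_(c <- splits v)
      (-1) ^ (wdeg c.1 * wdeg a.2) *:
        ev (mul_words l a.1 c.1) (fun w => ev (mul_words (p - l) a.2 c.2) (H w)).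
Proof.
(* The summand [l = 0]: a left factor without letters forces both left pieces to be empty. *)
have E0 q u' v' H' : \sum_(a <- splits u') \sum_(c <- splits v')
      (-1) ^ (wdeg c.1 * wdeg a.2) *:
        ev (mul_words 0 a.1 c.1) (fun w => ev (mul_words q a.2 c.2) (H' w))
    = ev (mul_words q u' v') (H' [::]) :> W.
  under eq_bigr do under eq_bigr do rewrite ev_mul0.
  pose F (a1 a2 c1 c2 : seq (int * B)) : W := (-1) ^ (wdeg c1 * wdeg a2) *:
      (if nilp a1 && nilp c1 then ev (mul_words q a2 c2) (H' [::]) else 0).
  rewrite (splits_nilp (F := fun a1 a2 => \sum_(c <- splits v') F a1 a2 c.1 c.2)).
    rewrite (splits_nilp (F := F [::] u')) => [|x a c]; last by rewrite /F scaler0.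
    by rewrite /F /= wdeg_nil mul0r expr0z scale1r.
  by move=> x a c; rewrite big1 // => e _; rewrite /F scaler0.
elim: p u v H => [|p IH] u v H.
  rewrite big_nat1 E0 !ev_mul0; case: ifP => // _.
  by rewrite big_seq1.
rewrite big_nat_recl // E0 ev_mulS.
have -> : \sum_(a <- splits u) \sum_(c <- splits v) (-1) ^ (wdeg c.1 * wdeg a.2) *:
      ev (mul_words p a.2 c.2) (fun x => \sum_(e <-
        splits ((wdeg a.1 + wdeg c.1, b (wval a.1) (wval c.1)) :: x)) H e.1 e.2)
    = ev (mul_words p.+1 u v) (H [::])
    + \sum_(a <- splits u) \sum_(c <- splits v) (-1) ^ (wdeg c.1 * wdeg a.2) *:
      ev (mul_words p a.2 c.2) (fun x => \sum_(e <- splits x)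
        H ((wdeg a.1 + wdeg c.1, b (wval a.1) (wval c.1)) :: e.1) e.2).
  rewrite ev_mulS -big_split; apply: eq_bigr => a _.
  rewrite -big_split; apply: eq_bigr => c _ /=.
  by rewrite -scalerDr -evD; under eq_ev_all do rewrite big_splits_cons.
congr (_ + _).
(* After the first letter has been produced from [x] and [x'], the cut divides what remains into
   [y, y'] on its left and [z, z'] on its right; the exponent is the Koszul sign of this
   rearrangement of three pairs of blocks. *)
pose F l x y z x' y' z' : W := (-1) ^ (wdeg x' * (wdeg y + wdeg z) + wdeg y' * wdeg z) *:
   ev (mul_words l y y') (fun w => ev (mul_words (p - l) z z') (H
     ((wdeg x + wdeg x', b (wval x) (wval x')) :: w))).
transitivity (\sum_(0 <= l < p.+1) \sum_(a <- splits u) \sum_(c <- splits v)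
    \sum_(a' <- splits a.2) \sum_(c' <- splits c.2) F l a.1 a'.1 a'.2 c.1 c'.1 c'.2).
  rewrite [RHS]exchange_big; apply: eq_bigr => a _.
  rewrite [RHS]exchange_big; apply: eq_bigr => c _.
  rewrite (IH _ _ (fun w => H (_ :: w))) scaler_sumr; apply: eq_bigr => l _.
  rewrite scaler_sumr; apply: eq_big_seq => a' /wdeg_splits ea.
  rewrite scaler_sumr; apply: eq_bigr => c' _.
  by rewrite scalerA -signD ea.
apply: eq_bigr => l _; rewrite -(splits2_coassoc (F l)).
apply: eq_bigr => a _; apply: eq_big_seq => c /wdeg_splits ec.
rewrite ev_mulS scaler_sumr; apply: eq_big_seq => a' /wdeg_splits ea.
rewrite scaler_sumr; apply: eq_big_seq => c' /wdeg_splits ec'.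
rewrite scalerA -signD subSS /F ec'.
by congr (_ ^ _ *: _); ring.
Qed.

Lemma mul_wordsP p u v x : x \in mul_words p u v ->
  wdeg x.2 = wdeg u + wdeg v /\ size x.2 = p.
Proof.
elim: p u v x => [|p IH] u v x /=.
  by case: u v => [|? ?] [|? ?] //=; rewrite inE => /eqP-> /=; rewrite !wdeg_nil.
case/flatten_mapP=> a /wdeg_splits ea /allpairsPdep[c [y [/wdeg_splits ec /IH[dy sy] ->]]].
by rewrite /= wdeg_cons dy sy ea ec; split=> //=; ring.
Qed.

Lemma mul_words_hword p u v x :
  (forall u v, hword u -> hword v -> homog (wdeg u + wdeg v) (b (wval u) (wval v))) ->
  x \in mul_words p u v -> hword u -> hword v -> hword x.2.
Proof.
move=> bd; elim: p u v x => [|p IH] u v x /=.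
  by case: ifP => // _; rewrite inE => /eqP->.
case/flatten_mapP=> a au /allpairsPdep[c [y [cv /IH hy ->]]] hu hv.
have [h1 h2] := hword_splits hu au; have [h3 h4] := hword_splits hv cv.
by apply/hword_cons; split; [apply: bd|apply: hy].
Qed.

Section Unital.
Hypothesis b00 : b [::] [::] = 0.

(** With more factors than letters some pair of blocks is empty. In the induction either the first
    pair is, or it uses up a letter and the inequality persists for the rest. *)
Lemma mul_words_vanish (W : lmodType k) p u v (F : seq (int * B) -> W) :
  kills F -> (size u + size v < p)%N -> ev (mul_words p u v) F = 0.
Proof.
elim: p u v F => [|p IH] u v F Fk sp //; rewrite ev_mulS.
rewrite big_seq big1 // => a /mem_splits ea; rewrite big_seq big1 // => c /mem_splits ec.
case ha: (nilp a.1 && nilp c.1).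
  case/andP: ha => /nilP -> /nilP ->; rewrite b00.
  by under eq_ev_all do rewrite kills_head //; rewrite ev0 scaler0.
rewrite IH ?scaler0 //; first exact: kills_cons.
move: sp ha; rewrite ea ec !size_cat /nilp.
move: (size a.1) (size a.2) (size c.1) (size c.2) => n1 n2 n3 n4.
by lia.
Qed.

(** When [u] is empty only blocks of [v] of size one survive, and [b] is the identity on them. This
    makes the empty word a left unit. *)
Lemma mul_words_nil1 (W : lmodType k) p v (F : seq (int * B) -> W) :
  (forall x, b [::] [:: x] = x) -> (forall y, size y != 1%N -> b [::] y = 0) ->
  kills F -> ev (mul_words p [::] v) F = if p == size v then F v else 0.
Proof.
move=> b1 bn; elim: p v F => [|p IH] v F Fk; first by rewrite ev_mul0 /=; case: v.
rewrite ev_mulS big_seq1 /=.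
under eq_bigr do rewrite (IH _ _ (kills_cons _ Fk)) wdeg_nil mulr0 expr0z scale1r.
pose G (c1 c2 : seq (int * B)) : W := if p == size c2 then
   F ((0 + wdeg c1, b [::] (wval c1)) :: c2) else 0.
rewrite -[LHS]/(\sum_(a <- splits v) G a.1 a.2).
have G0 c : G [::] c = 0 by rewrite /G /= b00 kills_head ?if_same.
case: v => [|[i x] v]; first by rewrite big_seq1 G0.
rewrite big_splits_cons G0 add0r (splits_nilp (F := fun c1 c2 => G (_ :: c1) c2)).
  by rewrite /G /= b1 wdeg_cons wdeg_nil add0r addr0.
by move=> y a c; rewrite /G bn // kills_head ?if_same.
Qed.

Lemma mul_words_nil2 (W : lmodType k) p u (F : seq (int * B) -> W) :
  (forall x, b [:: x] [::] = x) -> (forall y, size y != 1%N -> b y [::] = 0) ->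
  kills F -> ev (mul_words p u [::]) F = if p == size u then F u else 0.
Proof.
move=> b1 bn; elim: p u F => [|p IH] u F Fk; first by rewrite ev_mul0 andbT; case: u.
rewrite ev_mulS; under eq_bigr do rewrite big_seq1 /=.
under eq_bigr do rewrite (IH _ _ (kills_cons _ Fk)) wdeg_nil mul0r expr0z scale1r.
pose G (c1 c2 : seq (int * B)) : W := if p == size c2 then
   F ((wdeg c1 + 0, b (wval c1) [::]) :: c2) else 0.
rewrite -[LHS]/(\sum_(a <- splits u) G a.1 a.2).
have G0 c : G [::] c = 0 by rewrite /G /= b00 kills_head ?if_same.
case: u => [|[i x] u]; first by rewrite big_seq1 G0.
rewrite big_splits_cons G0 add0r (splits_nilp (F := fun c1 c2 => G (_ :: c1) c2)).
  by rewrite /G /= b1 wdeg_cons wdeg_nil !addr0.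
by move=> y a c; rewrite /G bn // kills_head ?if_same.
Qed.
End Unital.
End MulWords.

(** * Comparison with the product and the coderivations *)

Section NatSums.
Context (W : nmodType).

Lemma big_nat_cond (n m : nat) (F : nat -> W) : (m <= n)%N ->
  \sum_(0 <= i < m) F i = \sum_(0 <= i < n) if (i < m)%N then F i else 0.
Proof. by move=> mn; rewrite (big_nat_widen _ _ _ _ _ mn) big_mkcond. Qed.

Lemma exchange_triangle n (F : nat -> nat -> W) :
  \sum_(0 <= p < n.+1) \sum_(0 <= i < (n.+1 - p)%N) F i p
  = \sum_(0 <= i < n.+1) \sum_(0 <= p < (n.+1 - i)%N) F i p.
Proof.
under eq_bigr do rewrite (@big_nat_cond n.+1) ?leq_subr //.
under [RHS]eq_bigr do rewrite (@big_nat_cond n.+1) ?leq_subr //.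
rewrite exchange_big; apply: eq_bigr => i _; apply: eq_bigr => p _.
by rewrite !ltn_subRL addnC.
Qed.

Lemma sum_diagonals n (F : nat -> nat -> W) :
  \sum_(0 <= p < n.+1) \sum_(0 <= l < p.+1) F l (p - l)%N
  = \sum_(0 <= l < n.+1) \sum_(0 <= m < (n.+1 - l)%N) F l m.
Proof.
elim: n F => [|n IH] F; first by rewrite !big_nat1.
rewrite big_nat_recr //= IH [RHS]big_nat_recr //= subSnn big_nat1.
rewrite [X in _ + X]big_nat_recr //= subnn addrA; congr (_ + _).
rewrite -big_split; apply: eq_big_nat => l /andP[_ ln] /=.
by rewrite [in RHS](subSn (ltnW ln)) big_nat_recr.
Qed.

(** The triangle [l + m <= A + B] contains the box [l <= A], [m <= B], outside of which [F]
    vanishes. *)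
Lemma sum_box (A B : nat) (F : nat -> nat -> W) :
  (forall l m, (A < l)%N || (B < m)%N -> F l m = 0) ->
  \sum_(0 <= p < (A + B).+1) \sum_(0 <= l < p.+1) F l (p - l)%N
  = \sum_(0 <= l < A.+1) \sum_(0 <= m < B.+1) F l m.
Proof.
move=> F0; rewrite sum_diagonals (@big_nat_cond (A + B).+1 A.+1) ?ltnS ?leq_addr //.
apply: eq_bigr => l _; case: ltnP => lA; last by rewrite big1 // => m _; rewrite F0 ?lA.
rewrite [RHS](@big_nat_cond ((A + B).+1 - l)); last by lia.
apply: eq_bigr => m _; case: ltnP => // mB.
by rewrite F0 // mB orbT.
Qed.
End NatSums.

Section Compositions.

(** Weak compositions of [n] into [p] parts, zero parts allowed. Listing them by their first part
    gives the recursion that the sums over tuples in [bprod] do not display. *)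
Fixpoint comps p n : seq (seq nat) :=
  if p is q.+1 then [seq i :: c | i <- iota 0 n.+1, c <- comps q (n - i)%N]
  else if n == 0%N then [:: [::]] else [::].

Lemma compsS p n : comps p.+1 n = [seq i :: c | i <- iota 0 n.+1, c <- comps p (n - i)%N].
Proof. by []. Qed.

Lemma mem_comps p n c : (c \in comps p n) = (size c == p) && (sumn c == n).
Proof.
elim: p n c => [|p IH] n c.
  rewrite /=; by case: c => [|i c]; case: (n =P 0%N) => [->|/eqP n0] //=; rewrite eq_sym (negPf n0).
rewrite compsS; apply/allpairsPdep/idP => [[i [c' [+ + ->]]]|].
  rewrite IH mem_iota add0n /= => le /andP[/eqP -> /eqP ->]; rewrite eqxx /=.
  by rewrite subnKC.
case: c => [|i c] //= /andP[/eqP[sc] /eqP sn]; exists i, c; split=> //.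
  by rewrite -[_ :: _]/(iota 0 n.+1) mem_iota add0n /= ltnS -sn leq_addr.
by rewrite IH sc eqxx /= -sn addKn.
Qed.

Lemma comps_uniq p n : uniq (comps p n).
Proof.
elim: p n => [|p IH] n; first by rewrite /=; case: ifP.
rewrite compsS; apply: allpairs_uniq_dep; [exact: iota_uniq| by move=> i _; apply: IH|].
by move=> [i c] [j e] _ _ /= [-> ->].
Qed.

Lemma big_tuple_comps (W : nmodType) p n (F : seq nat -> W) :
  \sum_(I : p.-tuple 'I_n.+1 | sumn [seq val i | i <- I] == n) F [seq val i | i <- I]
  = \sum_(c <- comps p n) F c.
Proof.
rewrite -big_filter -(big_map (fun I : p.-tuple 'I_n.+1 => [seq val i | i <- I]) xpredT F).
apply: perm_big; apply: uniq_perm; rewrite ?comps_uniq //.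
  rewrite map_inj_uniq ?filter_uniq ?index_enum_uniq // => I J /inj_map IJ.
  by apply: val_inj; apply: IJ; apply: val_inj.
move=> c; rewrite mem_comps; apply/mapP/andP => [[I + ->]|[/eqP sc /eqP sn]].
  by rewrite mem_filter size_map size_tuple => /andP[-> _].
(* Each part is bounded by the sum, so [inord] below loses nothing. *)
have le i : i \in c -> (i < n.+1)%N.
  by rewrite ltnS -sn => /perm_to_rem/perm_sumn -> /=; exact: leq_addr.
have sI : size [seq (inord i : 'I_n.+1) | i <- c] == p by rewrite size_map sc.
have cE : c = [seq val i | i <- Tuple sI].
  by rewrite /= -map_comp map_id_in // => i /le ic /=; rewrite inordK.
by exists (Tuple sI) => //; rewrite mem_filter -cE sn eqxx mem_index_enum.
Qed.

Lemma big_compsS (W : nmodType) p n (F : seq nat -> W) :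
  \sum_(c <- comps p.+1 n) F c
  = \sum_(0 <= i < n.+1) \sum_(c <- comps p (n - i)%N) F (i :: c).
Proof. by rewrite compsS big_allpairs_dep /index_iota subn0. Qed.
End Compositions.

Section Product.
Context (k : fieldType) (B : gradedType k) (b : seq B -> seq B -> B).
Implicit Types (u v : seq (int * B)).

Lemma sum_wdeg (U : seq (seq (int * B))) :
  \sum_(0 <= r < size U) wdeg (nth [::] U r) = wdeg (flatten U).
Proof.
rewrite -(big_nth [::] xpredT (@wdeg k B)).
by elim: U => [|u U IH]; rewrite ?big_nil ?wdeg_nil // big_cons IH /= wdeg_cat.
Qed.

Lemma koszul_cons u0 v0 (U V : seq (seq (int * B))) :
  koszul (u0 :: U) (v0 :: V) = (-1) ^ (wdeg v0 * wdeg (flatten U)) * koszul U V :> k.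
Proof.
rewrite /koszul -signD; congr (_ ^ _).
rewrite big_nat_recl // [X in X + _]big_geq // add0r -sum_wdeg mulr_sumr -big_split.
by apply: eq_bigr => r _; rewrite big_nat_recl.
Qed.

Lemma bprodE p u v :
  bprod b p u v = ev (mul_words b p u v) (fun w => word (wval w)).
Proof.
have -> : bprod b p u v = \sum_(I <- comps p (size u)) \sum_(J <- comps p (size v))
    koszul (reshape I u) (reshape J v) *:
      word [seq b (wval x.1) (wval x.2) | x <- zip (reshape I u) (reshape J v)].
  rewrite /bprod -big_tuple_comps; apply: eq_bigr => I _.
  by rewrite -(big_tuple_comps p (size v) (fun J => koszul (reshape _ u) (reshape J v) *:
    word [seq b (wval x.1) (wval x.2) | x <- zip (reshape _ u) (reshape J v)])).
(* [word] is replaced by an arbitrary function on lists, so that in the induction the first letter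
   of the product can be absorbed into [F]. *)
suff E (W : lmodType k) (F : seq B -> W) :
   \sum_(I <- comps p (size u)) \sum_(J <- comps p (size v))
    koszul (reshape I u) (reshape J v) *:
      F [seq b (wval x.1) (wval x.2) | x <- zip (reshape I u) (reshape J v)]
  = ev (mul_words b p u v) (fun w => F (wval w)) by exact: E.
elim: p u v F => [|p IH] u v F.
  rewrite ev_mul0 /nilp /=; case: (_ == _); last by rewrite big_nil.
  rewrite big_seq1 /=; case: (_ == _); last by rewrite big_nil.
  by rewrite big_seq1 /= /koszul big_geq // expr0z scale1r.
pose G a1 a2 c1 c2 := (-1) ^ (wdeg c1 * wdeg a2) *: ev (mul_words b p a2 c2)
  (fun w => F (b (wval a1) (wval c1) :: wval w)).
rewrite ev_mulS [RHS](big_splits (fun a1 a2 => \sum_(c <- splits v) G a1 a2 c.1 c.2)).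
rewrite big_compsS; apply: eq_big_nat => i /andP[_ iu].
rewrite [RHS](big_splits (G _ _)) exchange_big big_compsS.
apply: eq_big_nat => j /andP[_ jv].
rewrite /G -(IH _ _ (fun w => F (_ :: w))) !size_drop scaler_sumr exchange_big.
apply: eq_big_seq => I.
rewrite mem_comps -size_drop => /andP[_ /eqP sI]; rewrite scaler_sumr.
apply: eq_bigr => J _; rewrite /= koszul_cons scalerA.
by rewrite reshapeKr // sI.
Qed.

(** The sum starts at [p = 0], unlike the one in [binf_mul]. The additional term is the empty word
    and occurs only when both [u] and [v] are empty, so the empty word becomes a unit and
    [binf_words_splits] has no exceptional cuts. *)
Definition binf_words u v : seq (k * seq (int * B)) :=
  flatten [seq mul_words b p u v | p <- iota 0 (size u + size v).+1].

Lemma ev_binf_words (W : lmodType k) u v (F : _ -> W) :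
  ev (binf_words u v) F = \sum_(0 <= p < (size u + size v).+1) ev (mul_words b p u v) F.
Proof. by rewrite ev_flatten /index_iota subn0. Qed.

Lemma binf_wordsP u v x : x \in binf_words u v ->
  wdeg x.2 = wdeg u + wdeg v /\ (u != [::] -> x.2 != [::]).
Proof.
case/flatten_mapP=> p _ /[dup] xp /mul_wordsP[-> sx]; split=> //.
by apply: contra => /eqP x0; move: xp sx; rewrite x0 => + /= p0; rewrite -p0 /=; case: u.
Qed.

Lemma binf_words_hword u v x :
  (forall u v, hword u -> hword v -> homog (wdeg u + wdeg v) (b (wval u) (wval v))) ->
  x \in binf_words u v -> hword u -> hword v -> hword x.2.
Proof. by move=> bd /flatten_mapP[p _ /(mul_words_hword bd)]. Qed.

Section Unital.
Hypothesis b00 : b [::] [::] = 0.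

(** On the left the total length of the product is bounded, on the right the lengths of the two
    factors are bounded separately: a triangle against a box. The terms outside the box vanish by
    [mul_words_vanish], which is why [H] has to kill zero letters. *)
Lemma binf_words_splits (W : lmodType k) u v (H : _ -> _ -> W) :
  (forall x, kills (H x)) -> (forall y, kills (H^~ y)) ->
  ev (binf_words u v) (fun w => \sum_(a <- splits w) H a.1 a.2)
  = \sum_(a <- splits u) \sum_(c <- splits v) (-1) ^ (wdeg c.1 * wdeg a.2) *:
      ev (binf_words a.1 c.1) (fun w => ev (binf_words a.2 c.2) (H w)).
Proof.
move=> Hr Hl; rewrite ev_binf_words; under eq_bigr do rewrite mul_words_splits.
under eq_bigr do rewrite exchange_big.
rewrite exchange_big; apply: eq_big_seq => a /mem_splits ea.
under eq_bigr do rewrite exchange_big.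
rewrite exchange_big; apply: eq_big_seq => c /mem_splits ec /=.
under eq_bigr do rewrite -scaler_sumr; rewrite -scaler_sumr; congr (_ *: _).
rewrite ev_binf_words.
under [RHS]eq_bigr do (under eq_ev_all do rewrite ev_binf_words; rewrite ev_sum).
rewrite -(sum_box (F := fun l m => ev (mul_words b l a.1 c.1)
   (fun w => ev (mul_words b m a.2 c.2) (H w)))).
  by rewrite {1}ea {1}ec !size_cat addnACA.
move=> l m /orP[lt|lt].
  apply: mul_words_vanish => // s1 s2 i; under eq_ev_all do rewrite Hl; exact: ev0.
by under eq_ev_all do rewrite mul_words_vanish //; exact: ev0.
Qed.

Lemma binf_words_nil1 (W : lmodType k) v (F : seq (int * B) -> W) :
  (forall x, b [::] [:: x] = x) -> (forall y, size y != 1%N -> b [::] y = 0) ->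
  kills F -> ev (binf_words [::] v) F = F v.
Proof.
move=> b1 bn Fk; rewrite ev_binf_words; under eq_bigr do rewrite mul_words_nil1 //.
by rewrite -big_mkcond big_mkord (big_pred1 ord_max) //.
Qed.

Lemma binf_words_nil2 (W : lmodType k) u (F : seq (int * B) -> W) :
  (forall x, b [:: x] [::] = x) -> (forall y, size y != 1%N -> b y [::] = 0) ->
  kills F -> ev (binf_words u [::]) F = F u.
Proof.
move=> b1 bn Fk; rewrite ev_binf_words; under eq_bigr do rewrite mul_words_nil2 //.
by rewrite -big_mkcond big_mkord addn0 (big_pred1 ord_max) //.
Qed.
End Unital.
End Product.

Section MulMulti.
Context (k : fieldType) (B : gradedType k) (b : seq B -> seq B -> B).
Hypothesis b_linear : (forall v, multilinear (b^~ v)) /\ (forall u, multilinear (b u)).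

Lemma mul_words_hmultil (W : lmodType k) p v (F : seq (int * B) -> W) :
  hmultilinear F -> hmultilinear (fun u => ev (mul_words b p u v) F).
Proof.
elim: p v F => [|p IH] v F Fm.
  move=> s1 s2 i a x y; rewrite !ev_mul0 /nilp !size_cat /= addnS /=.
  by rewrite scaler0 addr0.
move=> s1 s2 i a x y; rewrite !ev_mulS; move: s1 s2 i a x y.
apply: (big_splits_hmultilinear (F := fun a1 a2 => \sum_(c <- splits v)
  (-1) ^ (wdeg c.1 * wdeg a2) *: ev (mul_words b p a2 c.2)
         (fun x => F ((wdeg a1 + wdeg c.1, b (wval a1) (wval c.1)) :: x)))) => e.
  apply: hmultilinear_sum => c s1 s2 i a x y; rewrite scalerCD; congr (_ *: _).
  rewrite -evZ -evD; apply: eq_ev_all => z.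
  rewrite (wdeg_entry s1 s2 i _ 0) (wdeg_entry s1 s2 i x 0) (wdeg_entry s1 s2 i y 0).
  by rewrite /wval !map_cat /= (b_linear.1 [seq p.2 | p <- c.1]) (Fm [::]).
apply: hmultilinear_sum => c; apply: (hmultilinear_wdeg (fun n => (-1) ^ (wdeg c.1 * n))).
by apply: IH; apply: hmulti_cons.
Qed.

Lemma mul_words_hmultir (W : lmodType k) p u (F : seq (int * B) -> W) :
  hmultilinear F -> hmultilinear (fun v => ev (mul_words b p u v) F).
Proof.
elim: p u F => [|p IH] u F Fm.
  move=> s1 s2 i a x y; rewrite !ev_mul0 /nilp !size_cat /= addnS /= andbF.
  by rewrite scaler0 addr0.
move=> s1 s2 i a x y; rewrite !ev_mulS scaler_sumr -big_split; apply: eq_bigr => e _.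
move: s1 s2 i a x y.
apply: (big_splits_hmultilinear (F := fun c1 c2 =>
  (-1) ^ (wdeg c1 * wdeg e.2) *: ev (mul_words b p e.2 c2)
         (fun x => F ((wdeg e.1 + wdeg c1, b (wval e.1) (wval c1)) :: x)))) => c.
  apply: (hmultilinear_wdeg (fun n => (-1) ^ (n * wdeg e.2))) => s1 s2 i a x y.
  rewrite -evZ -evD; apply: eq_ev_all => z.
  rewrite (wdeg_entry s1 s2 i _ 0) (wdeg_entry s1 s2 i x 0) (wdeg_entry s1 s2 i y 0).
  by rewrite /wval !map_cat /= b_linear.2 (Fm [::]).
move=> s1 s2 i a x y; rewrite scalerCD; congr (_ *: _); move: s1 s2 i a x y.
by apply: IH; apply: hmulti_cons.
Qed.
End MulMulti.

Section Bihext.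
Context (k : fieldType) (U V : gradedType k) (W : lmodType k).
Context (M : seq (int * U) -> seq (int * V) -> W).
Hypothesis Ml : forall v, hmultilinear (M^~ v).
Hypothesis Mr : forall u, hmultilinear (M u).

Definition bihext u v : W := hext (fun u' => hext (M u') v) u.

Lemma bihext_multil v : multilinear (bihext^~ v).
Proof. by apply: hext_multilinear; apply: hmultilinear_sum. Qed.

Lemma bihext_multir u : multilinear (bihext u).
Proof.
move=> s1 s2 a x y; rewrite /bihext /hext scaler_sumr -big_split.
by apply: eq_bigr => u' _; apply: (hext_multilinear (Mr u')).
Qed.

Lemma bihext_hword u v : hword u -> hword v -> bihext (wval u) (wval v) = M u v.
Proof.
move=> hu hv; rewrite /bihext hext_hword //; first exact: hext_hword.
exact: hmultilinear_sum.
Qed.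
End Bihext.

Lemma multilinear_tlift (k : fieldType) (U V : gradedType k) (W : lmodType k)
    (F : seq U -> seq V -> W) y :
  (forall v, multilinear (F^~ v)) -> (forall u, multilinear (F u)) ->
  multilinear (fun u => tlift (F u) y).
Proof.
move=> Fl Fr s1 s2 a x z; elim/Tplus_ind: y => [|e s t s0 IH].
  by rewrite !(lin0 (tlift_linear (Fr _))) scaler0 addr0.
rewrite !(tlift_linear (Fr _)) IH !tlift_word // Fl.
by rewrite !scalerDr !scalerA [a * e]mulrC addrACA.
Qed.

Section BinfMul.
Context (k : fieldType) (B : gradedType k) (b : seq B -> seq B -> B) (d : seq B -> B).
Hypothesis hB : is_Binf b d.

Definition bprods (u v : seq (int * B)) : Tplus B :=
  \sum_(1 <= p < (size u + size v).+1) bprod b p u v.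

Lemma bprods_hmultil v : hmultilinear (bprods^~ v).
Proof.
move=> s1 s2 i a x z; rewrite /bprods !size_cat /=; move: (size s1 + _ + _).+1 => n.
rewrite scaler_sumr -big_split; apply: eq_bigr => p _ /=; rewrite !bprodE.
have wm := multilinear_hmulti (@word_multilinear k B).
exact: (mul_words_hmultil (binf_b_linear hB)) wm _ _ _ _ _ _.
Qed.

Lemma bprods_hmultir u : hmultilinear (bprods u).
Proof.
move=> s1 s2 i a x z; rewrite /bprods !size_cat /=; move: (size u + _).+1 => n.
rewrite scaler_sumr -big_split; apply: eq_bigr => p _ /=; rewrite !bprodE.
have wm := multilinear_hmulti (@word_multilinear k B).
exact: (mul_words_hmultir (binf_b_linear hB)) wm _ _ _ _ _ _.
Qed.

Lemma binf_mul_linearl y : linear (binf_mul b ^~ y).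
Proof.
apply: tlift_linear; apply: (multilinear_tlift (F := bihext bprods)).
  exact: bihext_multil bprods_hmultil.
exact: bihext_multir bprods_hmultir.
Qed.

Lemma binf_mul_word u v : u != [::] -> v != [::] ->
  binf_mul b (word u) (word v) = bihext bprods u v.
Proof.
move=> u0 v0; have ml := bihext_multil bprods_hmultil.
have mr := bihext_multir bprods_hmultir.
rewrite /binf_mul tlift_word //; last exact: (multilinear_tlift (F := bihext bprods)).
by rewrite tlift_word //; apply: mr.
Qed.

Lemma binf_mul_words (W : lmodType k) (F : seq B -> W) u v :
  multilinear F -> u != [::] -> v != [::] -> hword u -> hword v ->
  tlift F (binf_mul b (word (wval u)) (word (wval v)))
  = ev (binf_words b u v) (fun w => F (wval w)).
Proof.
move=> Fm u0 v0 hu hv.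
have n0 (s : seq (int * B)) : s != [::] -> wval s != [::] by case: s.
rewrite binf_mul_word ?n0 // bihext_hword //;
  [|exact: bprods_hmultil|exact: bprods_hmultir].
have -> : bprods u v = ev (binf_words b u v) (fun w => word (wval w)).
  (* The term [p = 0], absent from [bprods], vanishes because [u] is nonempty. *)
  rewrite ev_binf_words big_ltn // ev_mul0; case: (u) u0 => //= ? ? _; rewrite add0r.
  by apply: eq_bigr => p _; rewrite bprodE.
rewrite (ev_lin _ _ (tlift_linear Fm)); apply: eq_ev => x /binf_wordsP[_ /(_ u0) x0] /=.
by rewrite tlift_word ?n0.
Qed.
End BinfMul.

(** * Coderivations of the tensor coalgebra as sums over cuts *)

Section Coder.
Context (k : fieldType) (V : gradedType k) (f : seq V -> V).
Hypothesis f_multi : multilinear f.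

Lemma multilinear_nil : multilinear (fun s => if nilp s then 0 else f s).
Proof. by move=> s1 s2 a x y; rewrite /nilp !size_cat /= addnS f_multi. Qed.

Definition coder_sum (s : seq V) : Tplus V :=
  \sum_(a <- splits s) \sum_(c <- splits a.2)
    if nilp c.1 then 0 else word ([seq gsign 1 v | v <- a.1] ++ f c.1 :: c.2).

Lemma coder_sumE s : \sum_(1 <= p < (size s).+1) coder_word f p s = coder_sum s.
Proof.
(* Setting the arity zero terms to 0 completes the index set to a triangle, where arity and position
   can be exchanged. *)
pose F i p : Tplus V := if (p == 0)%N then 0 else
  word ([seq gsign 1 v | v <- take i s] ++ f (take p (drop i s)) :: drop (i + p) s).
transitivity (\sum_(0 <= p < (size s).+1) \sum_(0 <= i < ((size s).+1 - p)%N) F i p).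
  rewrite [RHS]big_ltn // [X in _ = X + _]big1 ?add0r //.
  by apply: eq_big_nat => p; case: p.
rewrite exchange_triangle /coder_sum.
rewrite (big_splits (fun a1 a2 => \sum_(c <- splits a2)
  if nilp c.1 then 0 else word ([seq gsign 1 v | v <- a1] ++ f c.1 :: c.2))).
apply: eq_big_nat => i /andP[_ li].
rewrite (big_splits (fun c1 c2 =>
  if nilp c1 then 0 else word ([seq gsign 1 v | v <- take i s] ++ f c1 :: c2))).
rewrite size_drop -subSn //; apply: eq_big_nat => p /andP[_ lp].
rewrite /F /nilp size_takel ?size_drop; last by lia.
by rewrite drop_drop addnC.
Qed.

Lemma map_gsign_multi (W : lmodType k) (F : seq V -> W) :
  multilinear F -> multilinear (fun s => F [seq gsign 1 v | v <- s]).
Proof. by move=> Fm s1 s2 a x y; rewrite !map_cat /= gsign_linear Fm. Qed.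

Lemma coder_sum_multilinear : multilinear coder_sum.
Proof.
pose f' s := if nilp s then 0 else f s.
pose F (a c e : seq V) : Tplus V := word ([seq gsign 1 v | v <- a] ++ f' c :: e).
have wm := @word_multilinear k V.
have E s : coder_sum s = \sum_(a <- splits s) \sum_(c <- splits a.2) F a.1 c.1 c.2.
  apply: eq_bigr => a _; apply: eq_bigr => c _; rewrite /F /f'; case: ifP => // _.
  have h : linear (fun x => word ([seq gsign 1 v | v <- a.1] ++ x :: c.2)).
    by move=> *; apply: wm.
  by rewrite (lin0 h).
move=> s1 s2 a x y; rewrite !E; move: s1 s2 a x y.
apply: (big_splits_multilinear (F := fun a1 a2 => \sum_(c <- splits a2) F a1 c.1 c.2)) => c.
  move=> s1 s2 a x y; rewrite scaler_sumr -big_split; apply: eq_bigr => e _ /=.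
  apply: (map_gsign_multi (F := fun s => word (s ++ f' e.1 :: e.2))) => t1 t2 b z t.
  by rewrite -!catA; apply: wm.
apply: (big_splits_multilinear (F := F c)) => e s1 s2 a x y.
  by rewrite /F /f' multilinear_nil wm.
by have := wm ([seq gsign 1 v | v <- c] ++ f' e :: s1) s2 a x y; rewrite /F -!catA.
Qed.

Lemma coder_ext_sum s : coder_ext f (word s) = coder_sum s.
Proof.
have cm : multilinear (fun s => \sum_(1 <= p < (size s).+1) coder_word f p s).
  by move=> *; rewrite !coder_sumE coder_sum_multilinear.
case: s => [|x s]; last by rewrite /coder_ext tlift_word // coder_sumE.
by rewrite word_nil /coder_ext (lin0 (tlift_linear cm)) /coder_sum big_seq1 /= big_seq1.
Qed.

Lemma coder_ext_linear : linear (coder_ext f).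
Proof.
by apply: tlift_linear => s1 s2 a x y; rewrite !coder_sumE coder_sum_multilinear.
Qed.

Lemma word_gsign (s : seq (int * V)) t :
  hword s ->
  word ([seq gsign 1 v | v <- wval s] ++ t) = (-1) ^ wdeg s *: word (wval s ++ t).
Proof.
elim/last_ind: s t => [|s [i x] IH] t; first by rewrite wdeg_nil expr0z scale1r.
rewrite -cats1 => /hword_cat[hs /hword_cons[hx _]].
rewrite /wval !map_cat -!catA; refine (etrans (IH _ hs) _).
rewrite /= (gsign_homog _ hx) mul1r.
have h : linear (fun x => word (wval s ++ x :: t)) by move=> *; apply: word_multilinear.
by rewrite (linZ h) scalerA wdeg_cat wdeg_cons wdeg_nil addr0 signD.
Qed.

Lemma ev_coder_splits (W : lmodType k) (s : seq (int * V)) (F : _ -> W) :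
  ev (coder_words f s) F = \sum_(a <- splits s) \sum_(c <- splits a.2)
    if nilp c.1 then 0
    else (-1) ^ wdeg a.1 *: F (a.1 ++ (wdeg c.1 + 1, f (wval c.1)) :: c.2).
Proof.
elim: s F => [|x s IH] F; first by rewrite big_seq1 big_seq1 ev_coder_nil.
rewrite ev_coder_cons (big_splits_cons (fun a1 a2 => \sum_(c <- splits a2)
    if nilp c.1 then 0
    else (-1) ^ wdeg a1 *: F (a1 ++ (wdeg c.1 + 1, f (wval c.1)) :: c.2))).
rewrite (big_splits_cons (fun c1 c2 => if nilp c1 then 0
    else (-1) ^ wdeg [::] *: F ([::] ++ (wdeg c1 + 1, f (wval c1)) :: c2))).
rewrite add0r IH scaler_sumr; congr (_ + _).
  by apply: eq_bigr => c _; rewrite /= wdeg_nil expr0z scale1r.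
apply: eq_bigr => a _; rewrite scaler_sumr; apply: eq_bigr => c _.
by case: ifP => _; rewrite ?scaler0 // scalerA wdeg_cons signD.
Qed.

Lemma coder_extE (s : seq (int * V)) : hword s ->
  coder_ext f (word (wval s)) = ev (coder_words f s) (fun w => word (wval w)).
Proof.
move=> hs; rewrite coder_ext_sum ev_coder_splits /coder_sum /wval splits_map big_map.
apply: eq_big_seq => a /(hword_splits hs)[ha _] /=.
rewrite splits_map big_map; apply: eq_bigr => c _ /=.
rewrite /nilp size_map; case: ifP => // _.
by refine (etrans (word_gsign _ ha) _); rewrite /wval map_cat.
Qed.

Lemma tlift_coder (W : lmodType k) (F : seq V -> W) (s : seq (int * V)) :
  multilinear F -> hword s ->
  tlift F (coder_ext f (word (wval s))) = ev (coder_words f s) (fun w => F (wval w)).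
Proof.
move=> Fm hs; rewrite coder_extE // (ev_lin _ _ (tlift_linear Fm)).
apply: eq_ev => x /coder_wordsP[_ x0] /=; rewrite tlift_word //.
by case: x.2 x0.
Qed.

Lemma coder_ext_graded :
  (forall s, s != [::] -> hword s -> homog (wdeg s + 1) (f (wval s))) ->
  graded_map 1 (coder_ext f).
Proof.
move=> fd; apply: Tplus_graded_map coder_ext_linear _ => s _ hs.
rewrite coder_extE //; apply: homog_ev => x /[dup] xs /coder_wordsP[<- _].
by apply: word_homog; apply: coder_words_hword xs hs.
Qed.
End Coder.

(** * The tensor algebra and the extended action *)

Lemma linN (k : fieldType) (V W : lmodType k) (f : V -> W) x : linear f -> f (- x) = - f x.
Proof. by move=> fL; rewrite -[- x]scaleN1r (linZ fL) scaleN1r. Qed.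

Lemma eq_multilinear (k : fieldType) (V W : lmodType k) (f g : seq V -> W) :
  f =1 g -> multilinear g -> multilinear f.
Proof. by move=> fg gm s1 s2 a x y; rewrite !fg gm. Qed.

Lemma multilinear_lin (k : fieldType) (V W W' : lmodType k) (f : W -> W') (g : seq V -> W) :
  linear f -> multilinear g -> multilinear (fun s => f (g s)).
Proof. by move=> fL gm s1 s2 a x y; rewrite gm fL. Qed.

Lemma comp_is_linear (k : fieldType) (U V W : lmodType k) (g : V -> W) (f : U -> V) :
  linear g -> linear f -> linear (fun x => g (f x)).
Proof. by move=> gL fL a x y; rewrite fL gL. Qed.

Lemma add_is_linear (k : fieldType) (U V : lmodType k) (f g : U -> V) :
  linear f -> linear g -> linear (fun x => f x + g x).
Proof. by move=> fL gL a x y; rewrite fL gL scalerDr addrACA. Qed.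

Lemma scale_is_linear (k : fieldType) (U V : lmodType k) (c : k) (f : U -> V) :
  linear f -> linear (fun x => c *: f x).
Proof. by move=> fL a x y; rewrite fL scalerCD. Qed.

Lemma opp_is_linear (k : fieldType) (U V : lmodType k) (f : U -> V) :
  linear f -> linear (fun x => - f x).
Proof. by move=> fL a x y; rewrite fL scalerN opprD. Qed.

Lemma sum_is_linear (k : fieldType) (U V : lmodType k) I (r : seq I) (f : I -> U -> V) :
  (forall i, linear (f i)) -> linear (fun x => \sum_(i <- r) f i x).
Proof.
by move=> fL a x y; rewrite scaler_sumr -big_split; apply: eq_bigr => i _; rewrite fL.
Qed.

Lemma ev_is_linear (k : fieldType) (U V : lmodType k) X (l : seq (k * X)) (f : X -> U -> V) :
  (forall i, linear (f i)) -> linear (fun x => ev l (fun i => f i x)).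
Proof. by move=> fL a x y; rewrite -evZ -evD; apply: eq_ev_all => i; rewrite fL. Qed.

Lemma linear_tlift (k : fieldType) (U V W : lmodType k) (F : U -> seq V -> W) t :
  (forall u, multilinear (F u)) -> (forall s, linear (F^~ s)) ->
  linear (fun u => tlift (F u) t).
Proof.
move=> Fm Fl a x y; elim/Tplus_ind: t => [|c s t s0 IH].
  by rewrite !(lin0 (tlift_linear (Fm _))) scaler0 addr0.
rewrite !(tlift_linear (Fm _)) IH !tlift_word // Fl.
by rewrite !scalerDr !scalerA [a * c]mulrC addrACA.
Qed.

Section TensorAlgebraWords.
Context (k : fieldType) (V : gradedType k).
Implicit Types (x y z : Tplus V).

Lemma word_cat_multil (t : seq V) : multilinear (fun s => word (s ++ t)).
Proof. by move=> s1 s2 a x y; rewrite -!catA; apply: word_multilinear. Qed.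

Lemma word_cat_multir (s : seq V) : multilinear (fun t => word (s ++ t)).
Proof. by move=> s1 s2 a x y; rewrite !catA; apply: word_multilinear. Qed.

Lemma tmul_linearl y : linear (fun x => @tmul k V x y).
Proof.
apply: tlift_linear; apply: (multilinear_tlift (F := fun s t => word (s ++ t))).
  exact: word_cat_multil.
exact: word_cat_multir.
Qed.

Lemma tmul_word_lift (s : seq V) y :
  s != [::] -> tmul (word s) y = tlift (fun t => word (s ++ t)) y.
Proof.
move=> s0; rewrite /tmul tlift_word //.
apply: (multilinear_tlift (F := fun s t => word (s ++ t))).
  exact: word_cat_multil.
exact: word_cat_multir.
Qed.

Lemma tmul_linearr x : linear (@tmul k V x).
Proof.
apply: (linear_tlift (F := fun y s => tlift (fun t => word (s ++ t)) y)) => [y|s].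
  apply: (multilinear_tlift (F := fun s t => word (s ++ t))).
    exact: word_cat_multil.
  exact: word_cat_multir.
exact: tlift_linear (word_cat_multir s).
Qed.

Lemma tmul_bilinear : bilinear_map (@tmul k V).
Proof. by split=> [v|u]; [exact: tmul_linearl|exact: tmul_linearr]. Qed.

Lemma tmul_word (s t : seq V) : s != [::] -> t != [::] -> tmul (word s) (word t) = word (s ++ t).
Proof. by move=> s0 t0; rewrite tmul_word_lift // tlift_word //; apply: word_cat_multir. Qed.

Lemma tmul_wval (s t : seq (int * V)) : s != [::] -> t != [::] ->
  tmul (word (wval s)) (word (wval t)) = word (wval (s ++ t)).
Proof.
move=> s0 t0; refine (etrans (tmul_word (s := wval s) (t := wval t) _ _) _).
- by case: (s) s0.
- by case: (t) t0.
by rewrite /wval map_cat.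
Qed.

Lemma tmulA : associative (@tmul k V).
Proof.
move=> x y z.
apply: (eq_linear_Tplus (f := fun x => tmul x (tmul y z)) (g := fun x => tmul (tmul x y) z)).
- exact: tmul_linearl.
- exact: comp_is_linear (tmul_linearl z) (tmul_linearl y).
move=> s s0 _.
apply: (eq_linear_Tplus (f := fun y => tmul _ (tmul y z)) (g := fun y => tmul (tmul _ y) z)).
- exact: comp_is_linear (tmul_linearr _) (tmul_linearl z).
- exact: comp_is_linear (tmul_linearl z) (tmul_linearr _).
move=> t t0 _.
apply: (eq_linear_Tplus (f := fun z => tmul _ (tmul _ z)) (g := fun z => tmul _ z)).
- exact: comp_is_linear (tmul_linearr _) (tmul_linearr _).
- exact: tmul_linearr.
by move=> u u0 _; rewrite !tmul_wval ?catA //; [case: (s) s0|case: (t) t0].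
Qed.

Lemma tmul_degree i j x y : homog i x -> homog j y -> homog (i + j) (tmul x y).
Proof.
move=> hx hy; elim/Tplus_homog_ind: hx => [|a s x' s0 hs <- IH].
  by rewrite (lin0 (tmul_linearl _)); apply: homog0.
rewrite (tmul_linearl y a (word (wval s)) x'); apply: homog_lin IH.
elim/Tplus_homog_ind: hy => [|b t y' t0 ht <- IH].
  by rewrite (lin0 (tmul_linearr _)); apply: homog0.
rewrite (tmul_linearr _ b (word (wval t)) y'); apply: homog_lin IH; rewrite tmul_wval //.
by rewrite -wdeg_cat; apply: word_homog; apply/hword_cat.
Qed.

Definition deconc_sum (s : seq V) : tens (Tplus V) (Tplus V) :=
  \sum_(a <- splits s) pure (word a.1) (word a.2).

Lemma deconc_sum_multilinear : multilinear deconc_sum.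
Proof.
apply: (big_splits_multilinear (F := fun a c => pure (word a) (word c))) => u.
  exact: (multilinear_lin ((pure_bilinear _ _).1 (word u)) (@word_multilinear k V)).
exact: (multilinear_lin ((pure_bilinear _ _).2 (word u)) (@word_multilinear k V)).
Qed.

(** The two trivial cuts carry a tensor factor [word [::] = 0], so the coproduct without counit may
    be summed over all cuts. *)
Lemma deconc_sumE (s : seq V) :
  \sum_(1 <= i < size s) pure (word (take i s)) (word (drop i s)) = deconc_sum s.
Proof.
rewrite /deconc_sum (big_splits (fun a c => pure (word a) (word c))).
rewrite [RHS]big_ltn // take0 pure0l add0r.
case: s => [|x s]; first by rewrite !big_geq.
by rewrite [RHS]big_nat_recr //= drop_size pure0r addr0.
Qed.

Lemma deconc_multilinear : multilinear (fun s : seq V =>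
  \sum_(1 <= i < size s) pure (word (take i s)) (word (drop i s))).
Proof. by move=> *; rewrite !deconc_sumE deconc_sum_multilinear. Qed.

Lemma deconc_linear : linear (@deconc k V).
Proof. exact: tlift_linear deconc_multilinear. Qed.

Lemma deconc_word (s : seq V) :
  deconc (word s) = \sum_(a <- splits s) pure (word a.1) (word a.2).
Proof.
case: s => [|x s]; last by rewrite /deconc (tlift_word deconc_multilinear) // deconc_sumE.
by rewrite word_nil (lin0 deconc_linear) big_seq1 pure0l.
Qed.

Lemma deconc_wval (s : seq (int * V)) :
  deconc (word (wval s)) = \sum_(a <- splits s) pure (word (wval a.1)) (word (wval a.2)).
Proof. by rewrite deconc_word /wval splits_map big_map. Qed.

Lemma deconc_graded : graded_map 0 (@deconc k V).
Proof.
apply: Tplus_graded_map deconc_linear _ => s _ hs; rewrite deconc_wval addr0.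
apply: homog_sum_seq => a /[dup] sa /wdeg_splits ->.
by have [h1 h2] := hword_splits hs sa; apply: homog_pure; apply: word_homog.
Qed.

Lemma corest_linear : linear (@corest k V).
Proof.
by apply: tlift_linear => -[|? [|? ?]] [|? ?] a x y //=; rewrite scaler0 addr0.
Qed.

Lemma corest_word (s : seq V) : corest (word s) = if s is [:: v] then v else 0 :> V.
Proof.
case: s => [|x s]; first by rewrite word_nil (lin0 corest_linear).
by rewrite /corest tlift_word // => -[|? [|? ?]] [|? ?] a y z //=; rewrite scaler0 addr0.
Qed.

(** Concatenation with a first letter recovers, from the deconcatenation, the part of
    word length at least 2. *)
Definition tens_cons : tens (Tplus V) (Tplus V) -> Tplus V :=
  tens_lift (fun x y => tmul (word [:: corest x]) y).

Lemma word1_linear : linear (fun x : V => word [:: x]).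
Proof. by move=> a x y; apply: (word_multilinear [::]). Qed.

Lemma tens_cons_bilinear : bilinear_map (fun x y : Tplus V => tmul (word [:: corest x]) y).
Proof.
split=> [v|u]; last exact: tmul_linearr.
by apply: comp_is_linear (tmul_linearl v) (comp_is_linear word1_linear corest_linear).
Qed.

Lemma tens_cons_deconc x : tens_cons (deconc x) + word [:: corest x] = x.
Proof.
have cL := tens_lift_linear tens_cons_bilinear.
apply: (eq_linear_Tplus (f := fun x => tens_cons (deconc x) + word [:: corest x])) => //.
  apply: add_is_linear; first exact: comp_is_linear cL deconc_linear.
  exact: comp_is_linear word1_linear corest_linear.
move=> + + _; case=> // p s _; rewrite /tens_cons /= deconc_word (lin_sum cL).
under eq_bigr do rewrite (tens_lift_pure tens_cons_bilinear).
have w0 : word [:: 0] = 0 :> Tplus V by exact: lin0 word1_linear.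
rewrite /= big_cons big_map /= corest_word w0 (lin0 (tmul_linearl _)) add0r corest_word.
case: (wval s) => [|y r]; first by rewrite /= big_seq1 corest_word (lin0 (tmul_linearr _)) add0r.
rewrite w0 addr0 /= big_cons big_map big1 ?addr0 => [|a _].
  by rewrite corest_word tmul_word.
by rewrite corest_word w0 (lin0 (tmul_linearl _)).
Qed.

(** The kernel of deconcatenation consists of the letters, and these are detected by [corest]. *)
Lemma deconc_inj x y : deconc x = deconc y -> corest x = corest y -> x = y.
Proof. by move=> dxy cxy; rewrite -(tens_cons_deconc x) dxy cxy tens_cons_deconc. Qed.
End TensorAlgebraWords.

(** * The extended action on words and its compatibility with product and coproduct *)

Section ActExt.
Context (k : fieldType) (B V : gradedType k) (theta : seq B -> V -> V).
Hypothesis theta_linear : (forall w, multilinear (theta^~ w)) /\ (forall u, linear (theta u)).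
Hypothesis theta_degree : forall v i w, hword v -> homog i w ->
    homog (wdeg v + i) (theta (wval v) w).
Hypothesis theta_id : forall w, theta [::] w = w.
Implicit Types (v : seq (int * B)) (s : seq (int * V)).

Definition act_sum v s : Tplus V := ev (act_words theta v s) (fun x => word (wval x)).

Definition act_ext (v : seq B) (t : Tplus V) : Tplus V :=
  tlift (bihext act_sum v) t.

Lemma act_sum_multil s : hmultilinear (act_sum^~ s).
Proof.
exact: act_words_hmultil theta_linear (multilinear_hmulti (@word_multilinear k V)).
Qed.

Lemma act_sum_multir v : hmultilinear (act_sum v).
Proof.
exact: act_words_hmultir theta_linear.2 (multilinear_hmulti (@word_multilinear k V)).
Qed.

Lemma act_ext_linear u : linear (act_ext u).
Proof. exact: tlift_linear (bihext_multir act_sum_multir u). Qed.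

Lemma act_ext_multi t : multilinear (act_ext^~ t).
Proof.
exact: multilinear_tlift (bihext_multil act_sum_multil) (bihext_multir act_sum_multir).
Qed.

Lemma act_ext_word v s : hword v -> hword s ->
  act_ext (wval v) (word (wval s)) = act_sum v s.
Proof.
move=> hv hs; case: s hs => [|p s] hs.
  by rewrite word_nil (lin0 (@act_ext_linear _)) /act_sum ev_act_nil; case: v {hv}.
rewrite /act_ext tlift_word //; last exact: bihext_multir act_sum_multir _.
by rewrite bihext_hword //; [exact: act_sum_multil|exact: act_sum_multir].
Qed.

Lemma tlift_act (W : lmodType k) (F : seq V -> W) v s :
  multilinear F -> s != [::] -> hword v -> hword s ->
  tlift F (act_ext (wval v) (word (wval s)))
  = ev (act_words theta v s) (fun x => F (wval x)).
Proof.
move=> Fm s0 hv hs; rewrite act_ext_word // /act_sum (ev_lin _ _ (tlift_linear Fm)).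
apply: eq_ev => x /act_wordsP[_ sx] /=; rewrite tlift_word //.
by rewrite -size_eq0 size_map sx size_eq0.
Qed.

Lemma act_ext_degree v i t : hword v -> homog i t -> homog (wdeg v + i) (act_ext (wval v) t).
Proof.
move=> hv; elim/Tplus_homog_ind => [|a s t' s0 hs <- IH].
  by rewrite (lin0 (@act_ext_linear _)); apply: homog0.
rewrite (act_ext_linear _ a (word (wval s)) t'); apply: homog_lin IH.
rewrite act_ext_word //; apply: homog_ev => x /[dup] xs /act_wordsP[<- _].
by apply: word_homog; apply: act_words_hword xs hv hs.
Qed.

Lemma act_sum_nil s : hword s -> act_sum [::] s = word (wval s).
Proof.
rewrite /act_sum => hs.
suff E (F : seq V -> Tplus V) :
  ev (act_words theta [::] s) (fun x => F (wval x)) = F (wval s) by exact: E.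
elim: s {hs} F => [|c s IH] F; first by rewrite ev_act_nil.
rewrite ev_act_cons big_seq1 /= wdeg_nil mulr0 expr0z scale1r theta_id.
by rewrite (IH (fun x => F (_ :: x))).
Qed.

Lemma act_ext_id t : act_ext [::] t = t.
Proof.
apply: (eq_linear_Tplus (f := act_ext [::]) (g := id)) => [||s s0 hs].
- exact: act_ext_linear.
- by [].
- by rewrite -[[::]]/(wval [::]) act_ext_word // act_sum_nil.
Qed.

Lemma act_sum1 v c : act_sum v [:: c] = word [:: theta (wval v) c.2].
Proof.
by rewrite /act_sum ev_act1.
Qed.

Lemma act_ext_letter u c : act_ext u (word [:: c]) = word [:: theta u c].
Proof.
apply: (multilinear_eq (f := act_ext^~ _) (g := fun u => word [:: theta u c])).
- exact: act_ext_multi.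
- exact: (multilinear_lin (@word1_linear k V) (theta_linear.1 c)).
move=> v hv _.
apply: (gsum_eq (f := fun c => act_ext _ (word [:: c])) (g := fun c => word [:: theta _ c])).
- exact: comp_is_linear (@act_ext_linear _) (@word1_linear k V).
- exact: comp_is_linear (@word1_linear k V) (theta_linear.2 _).
move=> i y hy; rewrite -[[:: y]]/(wval [:: (i, y)]) act_ext_word ?act_sum1 //.
by apply/hword_cons.
Qed.

Lemma act_ext_mul v j x y : hword v -> homog j x ->
  act_ext (wval v) (tmul x y)
  = \sum_(a <- splits v) (-1) ^ (j * wdeg a.2) *:
      tmul (act_ext (wval a.1) x) (act_ext (wval a.2) y).
Proof.
move=> hv hx; apply: (eq_linear_homog (f := fun x => act_ext _ (tmul x y))
  (g := fun x => \sum_(a <- splits v) _ *: tmul (act_ext _ x) _) _ _ hx).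
- exact: comp_is_linear (@act_ext_linear _) (tmul_linearl y).
- apply: sum_is_linear => a; apply: scale_is_linear.
  exact: comp_is_linear (tmul_linearl _) (@act_ext_linear _).
move=> s s0 hs <-.
apply: (eq_linear_Tplus (f := fun y => act_ext _ (tmul _ y))
  (g := fun y => \sum_(a <- splits v) _ *: tmul _ (act_ext _ y))).
- exact: comp_is_linear (@act_ext_linear _) (tmul_linearr _).
- apply: sum_is_linear => a; apply: scale_is_linear.
  exact: comp_is_linear (tmul_linearr _) (@act_ext_linear _).
move=> t t0 ht; rewrite tmul_wval // act_ext_word //; last exact/hword_cat.
rewrite /act_sum ev_act_cat; apply: eq_big_seq => a /(hword_splits hv)[h1 h2].
congr (_ *: _); rewrite !act_ext_word // /act_sum (ev_lin _ _ (tmul_linearl _)).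
apply: eq_ev => z /act_wordsP[_ sz] /=; rewrite (ev_lin _ _ (tmul_linearr _)).
apply: eq_ev => w /act_wordsP[_ sw] /=; rewrite tmul_wval //.
  by rewrite -size_eq0 sz size_eq0.
by rewrite -size_eq0 sw size_eq0.
Qed.

Lemma act_ext_comul_word v s : hword v -> hword s ->
  deconc (act_ext (wval v) (word (wval s)))
  = \sum_(a <- splits v) \sum_(c <- splits s) (-1) ^ (wdeg c.1 * wdeg a.2) *:
      pure (act_ext (wval a.1) (word (wval c.1))) (act_ext (wval a.2) (word (wval c.2))).
Proof.
move=> hv hs; rewrite act_ext_word // /act_sum (ev_lin _ _ (@deconc_linear k V)).
(* The action preserves word length, so the cuts of all resulting words are indexed by the cuts of
   [s]. *)
have -> : ev (act_words theta v s) (@deconc k V \o (fun x => word (wval x)))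
  = \sum_(0 <= i < (size s).+1) ev (act_words theta v s) (fun x =>
      pure (word (wval (take i x))) (word (wval (drop i x)))).
  rewrite -ev_sum; apply: eq_ev => x /act_wordsP[_ sx] /=; rewrite deconc_wval.
  by rewrite (big_splits (fun a c => pure (word (wval a)) (word (wval c)))) sx.
rewrite [RHS]exchange_big.
rewrite [RHS](big_splits (fun c1 c2 => \sum_(a <- splits v) (-1) ^ (wdeg c1 * wdeg a.2) *:
      pure (act_ext (wval a.1) (word (wval c1))) (act_ext (wval a.2) (word (wval c2))))).
apply: eq_big_nat => i /andP[_ li].
rewrite -{1}(cat_take_drop i s) ev_act_cat.
apply: eq_big_seq => a /(hword_splits hv)[h1 h2]; congr (_ *: _).
have [h3 h4] : hword (take i s) /\ hword (drop i s) by apply/hword_cat; rewrite cat_take_drop.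
rewrite !act_ext_word // /act_sum (ev_lin _ _ ((pure_bilinear _ _).1 _)).
apply: eq_ev => z /act_wordsP[_ sz] /=; rewrite (ev_lin _ _ ((pure_bilinear _ _).2 _)).
apply: eq_ev => w _ /=; rewrite take_size_cat ?drop_size_cat // sz size_takel //.
Qed.

Lemma act_pure_bilinear (u1 u2 : seq B) e : bilinear_map (fun x y : Tplus V =>
  pure (act_ext u1 (gsign e x)) (act_ext u2 y)).
Proof.
split=> [y|x].
  apply: comp_is_linear ((pure_bilinear _ _).1 _) _.
  exact: comp_is_linear (@act_ext_linear _) (gsign_linear e).
exact: comp_is_linear ((pure_bilinear _ _).2 _) (@act_ext_linear _).
Qed.

Lemma act_ext_comul v x : hword v ->
  deconc (act_ext (wval v) x)
  = \sum_(a <- splits v) tens_lift (fun x y =>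
      pure (act_ext (wval a.1) (gsign (wdeg a.2) x)) (act_ext (wval a.2) y)) (deconc x).
Proof.
move=> hv; apply: (eq_linear_Tplus (f := fun x => deconc (act_ext _ x))
  (g := fun x => \sum_(a <- splits v) tens_lift _ (deconc x))).
- exact: comp_is_linear (@deconc_linear k V) (@act_ext_linear _).
- apply: sum_is_linear => a; apply: comp_is_linear (@deconc_linear k V).
  exact: tens_lift_linear (act_pure_bilinear _ _ _).
move=> s s0 hs; rewrite act_ext_comul_word //; apply: eq_bigr => a _.
rewrite deconc_wval (lin_sum (tens_lift_linear (act_pure_bilinear _ _ _))).
apply: eq_big_seq => c /(hword_splits hs)[h1 h2].
rewrite (tens_lift_pure (act_pure_bilinear _ _ _)) (gsign_homog _ (word_homog h1)).
rewrite (linZ (@act_ext_linear _)) (linZ ((pure_bilinear _ _).1 _)).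
by rewrite mulrC.
Qed.
End ActExt.

Lemma word_ind_letters (k : fieldType) (V : gradedType k) (P : Tplus V -> Prop) :
  (forall i x, homog i x -> P (word [:: x])) ->
  (forall i x s, homog i x -> s != [::] -> hword s -> P (word [:: x]) ->
     P (word (wval s)) -> P (tmul (word [:: x]) (word (wval s)))) ->
  forall s, s != [::] -> hword s -> P (word (wval s)).
Proof.
move=> P1 PM; elim=> [|[i x] [|q s] IH] // _ /hword_cons[hx hs]; first exact: P1 hx.
have := PM i x (q :: s) hx isT hs (P1 i x hx) (IH isT hs).
by rewrite tmul_word.
Qed.

(** * The module axioms for the extended action *)

Section Assoc.
Context (k : fieldType) (B : gradedType k) (b : seq B -> seq B -> B) (d : seq B -> B).
Hypothesis hB : is_Binf b d.
Implicit Types (u v : seq (int * B)).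

Let b00 : b [::] [::] = 0. Proof. exact: (binf_b0n hB). Qed.

(** [mod_assoc] concerns nonempty words; since the empty word is a unit for [binf_words] and acts as
    the identity, the rule extends to all words. This is needed because cuts of nonempty words may
    have empty pieces. *)
Lemma module_assoc_hword (W : gradedType k) (dW : W -> W) beta u v x :
  is_module b d dW beta -> hword u -> hword v ->
  beta (wval u) (beta (wval v) x) = ev (binf_words b u v) (fun w => beta (wval w) x).
Proof.
move=> hm hu hv; have bm := (mod_linear hm).1 x.
have kb := hmultilinear_kills (multilinear_hmulti bm).
case: (altP (u =P [::])) => [->|u0].
  rewrite (mod_id hm) (@binf_words_nil1 _ _ _ b00 _ v (fun w => beta (wval w) x)) //.
    exact: binf_b01 hB.
  exact: binf_b0n hB.
case: (altP (v =P [::])) => [->|v0].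
  rewrite (mod_id hm) (@binf_words_nil2 _ _ _ b00 _ u (fun w => beta (wval w) x)) //.
    exact: binf_b10 hB.
  exact: binf_bn0 hB.
rewrite -(mod_assoc hm); [|by case: (u) u0|by case: (v) v0].
by rewrite (binf_mul_words hB).
Qed.

Context (V : gradedType k) (theta : seq B -> V -> V).
Hypothesis theta_linear : (forall w, multilinear (theta^~ w)) /\ (forall y, linear (theta y)).
Hypothesis theta_degree : forall v i w, hword v -> homog i w ->
    homog (wdeg v + i) (theta (wval v) w).
Hypothesis theta_id : forall w, theta [::] w = w.
Hypothesis theta_assoc : forall u v x, hword u -> hword v ->
  theta (wval u) (theta (wval v) x) = ev (binf_words b u v) (fun w => theta (wval w) x).

Local Notation act := (act_ext theta).
Let actL y : linear (act y). Proof. exact: act_ext_linear. Qed.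
Let actM t : multilinear (act^~ t). Proof. exact: act_ext_multi. Qed.

Lemma act_ext_assoc u v t : hword u -> hword v ->
  act (wval u) (act (wval v) t) = ev (binf_words b u v) (fun w => act (wval w) t).
Proof.
move=> hu hv; apply: (eq_linear_Tplus (f := fun t => act _ (act _ t))
  (g := fun t => ev (binf_words b u v) (fun w => act (wval w) t))).
- exact: comp_is_linear (actL _) (actL _).
- by apply: ev_is_linear => w; apply: actL.
move=> s s0 hs; pose P x := forall u v, hword u -> hword v ->
   act (wval u) (act (wval v) x) = ev (binf_words b u v) (fun w => act (wval w) x).
suff H : P (word (wval s)) by exact: H.
apply: (@word_ind_letters k V P) s0 hs.
  move=> i x hx {hu hv}u {}v hu hv; rewrite !act_ext_letter // theta_assoc //.
  rewrite (ev_lin _ _ (@word1_linear k V)); apply: eq_ev => w _ /=.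
  by rewrite act_ext_letter.
move=> {hu hv s}i x s hx s0 hs IHx IHs {}u {}v hu hv.
have hx1 : homog i (word [:: x]).
  by have := @word_homog k V [:: (i, x)]; rewrite wdeg_cons wdeg_nil addr0; apply; apply/hword_cons.
set y := word (wval s) in IHs *; set z := word [:: x] in IHx hx1 *.
have -> : ev (binf_words b u v) (fun w => act (wval w) (tmul z y))
  = ev (binf_words b u v) (fun w => \sum_(a <- splits w) (-1) ^ (i * wdeg a.2) *:
      tmul (act (wval a.1) z) (act (wval a.2) y)).
  by apply: eq_ev => w /(binf_words_hword (binf_b_degree hB)) hw; apply: act_ext_mul; auto.
pose H w1 w2 := (-1) ^ (i * wdeg w2) *: tmul (act (wval w1) z) (act (wval w2) y).
(* Here the product being a morphism of coalgebras is used: cutting a product of [u] and [v] amounts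
   to multiplying pieces of [u] with pieces of [v]. *)
rewrite (@binf_words_splits _ _ _ b00 _ u v H); last first.
- move=> w; apply: hmultilinear_kills => s1 s2 j c p q; rewrite /H scalerCD; congr (_ *: _).
  rewrite -(tmul_linearl (act (wval w) y)); congr tmul.
  exact: (multilinear_hmulti (actM z)).
- move=> w; apply: hmultilinear_kills; apply: (hmultilinear_wdeg (fun n => (-1) ^ (i * n))).
  exact: (multilinear_hmulti (multilinear_lin (tmul_linearr _) (actM y))).
rewrite (act_ext_mul theta_linear _ hv hx1) (lin_sum (actL _)) [RHS]exchange_big.
rewrite [LHS]big_seq [RHS]big_seq; apply: eq_bigr => c cv.
have [hc1 hc2] := hword_splits hv cv.
(* The block [c.1] has raised the degree of [z], so moving [a.2] across it produces the additional
   exponent [wdeg c.1 * wdeg a.2], which is exactly the Koszul sign of the product. *)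
have hx2 := act_ext_degree theta_linear theta_degree hc1 hx1.
rewrite (linZ (actL _)) (act_ext_mul theta_linear _ hu hx2).
rewrite scaler_sumr [LHS]big_seq [RHS]big_seq; apply: eq_bigr => a au.
have [ha1 ha2] := hword_splits hu au.
have -> := IHx _ _ ha1 hc1; have -> := IHs _ _ ha2 hc2.
rewrite scalerA -signD (ev_lin _ _ (tmul_linearl _)).
have -> : ev (binf_words b a.1 c.1) (fun w => ev (binf_words b a.2 c.2) (H w)) =
   (-1) ^ (i * (wdeg a.2 + wdeg c.2)) *:
   ev (binf_words b a.1 c.1)
     ((fun x0 => tmul x0 (ev (binf_words b a.2 c.2) (fun w => act (wval w) y)))
     \o (fun w => act (wval w) z)).
  rewrite -evZ; apply: eq_ev => w _ /=; rewrite (ev_lin _ _ (tmul_linearr _)) -evZ.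
  by apply: eq_ev => w' /binf_wordsP[dw' _]; rewrite /H dw'.
by rewrite scalerA -signD; congr (_ ^ _ *: _); ring.
Qed.

Lemma act_ext_is_module (D : Tplus V -> Tplus V) :
  (forall v t, hword v -> D (act (wval v) t)
     = ev (coder_words d v) (fun w => act (wval w) t) + (-1) ^ wdeg v *: act (wval v) (D t)) ->
  is_module b d D act.
Proof.
move=> hD; split.
- by split=> [w|u]; [exact: actM|exact: actL].
- by move=> v i w hv hw; apply: act_ext_degree.
- exact: act_ext_id.
- move=> u v w u0 v0; have tL := tlift_linear (actM w).
  apply: (multilinear_eq (f := fun y => tlift (act^~ w) (binf_mul b (word y) (word v)))
    (g := fun y => act y (act v w))).
  + apply: (multilinear_lin (f := fun x => tlift (act^~ w) (binf_mul b x (word v)))).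
      exact: comp_is_linear tL (binf_mul_linearl hB _).
    exact: word_multilinear.
  + exact: actM.
  move=> u' hu' su'.
  have u0' : u' != [::] by rewrite -size_eq0 su' size_eq0.
  have u0'' : wval u' != [::] by rewrite -size_eq0 size_map su' size_eq0.
  (* [multilinear_eq] asks for a function that is multilinear on all lists. [bihext] is known to be
     so, and it agrees with the product on nonempty lists; the value 0 on the empty list does not
     disturb multilinearity. *)
  pose g y := tlift (act^~ w) (if nilp y then 0 else bihext (bprods b) (wval u') y).
  have gE (v1 : seq B) : v1 != [::] ->
      g v1 = tlift (act^~ w) (binf_mul b (word (wval u')) (word v1)).
    by move=> v1n; rewrite /g /nilp size_eq0 (negPf v1n) (binf_mul_word hB).
  rewrite -gE //; apply: (multilinear_eq (f := g) (g := fun y => act (wval u') (act y w))).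
  + move=> s1 s2 a x y; rewrite /g /nilp !size_cat /= addnS.
    by rewrite (bihext_multir (bprods_hmultir hB)) tL.
  + exact: multilinear_lin (actL _) (actM w).
  move=> v' hv' sv'.
  have v0' : v' != [::] by rewrite -size_eq0 sv' size_eq0.
  rewrite gE; last by rewrite -size_eq0 size_map sv' size_eq0.
  by rewrite (binf_mul_words hB) // act_ext_assoc.
- by move=> v w hv; rewrite hD // (tlift_coder (binf_d_linear hB)).
Qed.
End Assoc.

(** * Compatibility of an action with differentials, through a bilinear pairing *)

Section DiffPairing.
Context (k : fieldType) (B : gradedType k) (A W : lmodType k) (d : seq B -> B).
Context (D : A -> A) (act : seq B -> A -> A) (m : A -> A -> W).
Hypothesis mL : forall y, linear (m^~ y).
Hypothesis mR : forall x, linear (m x).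

Definition act_commutes_diff x := forall v, hword v ->
  D (act (wval v) x)
  = ev (coder_words d v) (fun w => act (wval w) x) + (-1) ^ wdeg v *: act (wval v) (D x).

(** [m] is the product on the cobar side and the tensor product on the bar side. *)
Lemma act_diff_pairing (i : int) x y v :
  act_commutes_diff x -> act_commutes_diff y -> hword v ->
  \sum_(a <- splits v) (-1) ^ (i * wdeg a.2) *:
    (m (D (act (wval a.1) x)) (act (wval a.2) y)
     + (-1) ^ (wdeg a.1 + i) *: m (act (wval a.1) x) (D (act (wval a.2) y)))
  = ev (coder_words d v) (fun w => \sum_(a <- splits w) (-1) ^ (i * wdeg a.2) *:
      m (act (wval a.1) x) (act (wval a.2) y))
  + (-1) ^ wdeg v *:
    (\sum_(a <- splits v) (-1) ^ ((i + 1) * wdeg a.2) *: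
       m (act (wval a.1) (D x)) (act (wval a.2) y)
     + (-1) ^ i *: \sum_(a <- splits v) (-1) ^ (i * wdeg a.2) *:
       m (act (wval a.1) x) (act (wval a.2) (D y))).
Proof.
move=> Cx Cy hv.
rewrite (coder_words_splits d v (fun w1 w2 => (-1) ^ (i * wdeg w2) *:
      m (act (wval w1) x) (act (wval w2) y))).
rewrite scalerDr !scaler_sumr -!big_split.
rewrite [LHS]big_seq [RHS]big_seq; apply: eq_bigr => a av /=.
have [ha1 ha2] := hword_splits hv av; have ea := wdeg_splits av.
rewrite (Cx _ ha1) (Cy _ ha2).
set X := ev (coder_words d a.1) _; set Y := ev (coder_words d a.2) _.
rewrite (linD (mL _)) (linZ (mL _)) (linD (mR _)) (linZ (mR _)).
have -> : ev (coder_words d a.1) (fun w => (-1) ^ (i * wdeg a.2) *: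
    m (act (wval w) x) (act (wval a.2) y))
  = (-1) ^ (i * wdeg a.2) *: m X (act (wval a.2) y).
  by rewrite evZ (ev_lin _ _ (mL _)).
have -> : ev (coder_words d a.2) (fun w => (-1) ^ (i * wdeg w) *:
    m (act (wval a.1) x) (act (wval w) y))
  = (-1) ^ (i * (wdeg a.2 + 1)) *: m (act (wval a.1) x) Y.
  by rewrite (ev_lin _ _ (mR _)) -evZ; apply: eq_ev => w /coder_wordsP[-> _].
(* Each cut of [v] contributes four terms: [d] in [a.1], [d] in [a.2], [D] on [x], [D] on [y]. They
   are matched one by one, only the signs remaining. *)
rewrite !scalerDr !scalerA -!signD -!addrA; congr (_ + _).
rewrite [LHS]addrCA; congr (_ + _); first by congr (_ *: _); apply: (@sign_eq _ 0); ring.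
congr (_ + _); congr (_ *: _); rewrite ea.
  by apply: (@sign_eq _ (- wdeg a.2)); ring.
by apply: (@sign_eq _ 0); ring.
Qed.

(** For an induction on word length. At a trivial cut one factor is the whole word, for which the
    induction hypothesis says nothing; but then the other factor is 0 and both sides vanish. *)
Lemma act_diff_pairing_or0 (i : int) x y v : (forall u, act u 0 = 0) -> D 0 = 0 ->
  hword v -> (x = 0 \/ y = 0) \/ (act_commutes_diff x /\ act_commutes_diff y) ->
  \sum_(a <- splits v) (-1) ^ (i * wdeg a.2) *:
    (m (D (act (wval a.1) x)) (act (wval a.2) y)
     + (-1) ^ (wdeg a.1 + i) *: m (act (wval a.1) x) (D (act (wval a.2) y)))
  = ev (coder_words d v) (fun w => \sum_(a <- splits w) (-1) ^ (i * wdeg a.2) *: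
      m (act (wval a.1) x) (act (wval a.2) y))
  + (-1) ^ wdeg v *:
    (\sum_(a <- splits v) (-1) ^ ((i + 1) * wdeg a.2) *:
       m (act (wval a.1) (D x)) (act (wval a.2) y)
     + (-1) ^ i *: \sum_(a <- splits v) (-1) ^ (i * wdeg a.2) *:
       m (act (wval a.1) x) (act (wval a.2) (D y))).
Proof.
move=> a0 D0 hv [xy|[Cx Cy]]; last exact: act_diff_pairing Cx Cy hv.
have E p q : p = 0 \/ q = 0 -> m p q = 0.
  by case=> ->; [exact: lin0 (mL q)|exact: lin0 (mR p)].
have H u p q : p = 0 \/ q = 0 -> m (act u.1 p) (act u.2 q) = 0.
  by case=> ->; rewrite a0 E; auto.
rewrite big1 => [|a _]; last first.
  by case: xy => ->; rewrite !(a0, D0) !E ?scaler0 ?addr0 ?scaler0; auto.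
have -> : ev (coder_words d v) (fun w => \sum_(a <- splits w) (-1) ^ (i * wdeg a.2) *:
    m (act (wval a.1) x) (act (wval a.2) y)) = 0.
  rewrite -[RHS](ev0 W (coder_words d v)); apply: eq_ev_all => w; apply: big1 => a _.
  by rewrite (H (wval a.1, wval a.2)) ?scaler0.
rewrite !big1 ?scaler0 ?addr0 ?scaler0 ?addr0 // => a _.
  by case: xy => ->; rewrite ?D0 a0 E ?scaler0; auto.
by case: xy => ->; rewrite ?D0 a0 E ?scaler0; auto.
Qed.
End DiffPairing.

Lemma eq_sum_combine (k : fieldType) (W : lmodType k) (I : eqType) (r : seq I)
    (F G H : I -> W) e : (forall i, i \in r -> F i = G i + e *: H i) ->
  \sum_(i <- r) F i = \sum_(i <- r) G i + e *: \sum_(i <- r) H i.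
Proof.
by move=> FGH; rewrite scaler_sumr -big_split; apply: eq_big_seq => i /FGH.
Qed.


Section DiffMul.
Context (k : fieldType) (B A : gradedType k) (d : seq B -> B).
Context (mul : A -> A -> A) (D : A -> A) (act : seq B -> A -> A).
Hypothesis d_degree : forall v, v != [::] -> hword v -> homog (wdeg v + 1) (d (wval v)).
Hypothesis mulL : forall y, linear (mul^~ y).
Hypothesis mulR : forall x, linear (mul x).
Hypothesis actL : forall v, linear (act v).
Hypothesis act_degree : forall v i x, hword v -> homog i x ->
  homog (wdeg v + i) (act (wval v) x).
Hypothesis act_mul : forall v j x y, hword v -> homog j x ->
  act (wval v) (mul x y)
  = \sum_(a <- splits v) (-1) ^ (j * wdeg a.2) *:
      mul (act (wval a.1) x) (act (wval a.2) y).
Hypothesis D_linear : linear D.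
Hypothesis D_degree : forall i x, homog i x -> homog (i + 1) (D x).
Hypothesis D_leibniz : forall i x y, homog i x ->
  D (mul x y) = mul (D x) y + (-1) ^ i *: mul x (D y).

Lemma act_commutes_diff_mul i x y : homog i x ->
  act_commutes_diff d D act x -> act_commutes_diff d D act y ->
  act_commutes_diff d D act (mul x y).
Proof.
move=> hx Cx Cy v hv.
have -> : ev (coder_words d v) (fun w => act (wval w) (mul x y))
  = ev (coder_words d v) (fun w => \sum_(a <- splits w) (-1) ^ (i * wdeg a.2) *:
      mul (act (wval a.1) x) (act (wval a.2) y)).
  apply: eq_ev => w wv; apply: act_mul => //.
  exact: coder_words_hword d_degree wv hv.
rewrite (D_leibniz _ hx) (linD (actL _)) (linZ (actL _)) (act_mul _ hv (D_degree hx)).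
rewrite !(act_mul _ hv hx) -(act_diff_pairing mulL mulR i Cx Cy hv).
rewrite (lin_sum D_linear); apply: eq_big_seq => a /(hword_splits hv)[ha1 ha2].
by rewrite (linZ D_linear) (D_leibniz _ (act_degree ha1 hx)).
Qed.
End DiffMul.

Section Derivations.
Context (k : fieldType) (A : gradedType k) (mul : A -> A -> A) (D : A -> A).
Hypothesis mulL : forall y, linear (mul^~ y).
Hypothesis mulR : forall x, linear (mul x).
Hypothesis mulA : associative mul.
Hypothesis D_linear : linear D.

(** Associativity lets the Leibniz rule for a left factor be proved one letter at a time: [x] is the
    letter split off, [s] the rest. *)
Lemma leibniz_mul (x dx s y : A) (e1 e2 : k) :
  (forall z, D (mul x z) = mul dx z + e1 *: mul x (D z)) ->
  D (mul s y) = mul (D s) y + e2 *: mul s (D y) ->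
  D (mul (mul x s) y) = mul (D (mul x s)) y + (e1 * e2) *: mul (mul x s) (D y).
Proof.
move=> Dx Ds; rewrite -mulA !Dx Ds (linD (mulR _)) (linZ (mulR _)).
by rewrite (linD (mulL _)) (linZ (mulL _)) -!mulA scalerDr scalerA addrA.
Qed.

Hypothesis D_degree : forall i x, homog i x -> homog (i + 1) (D x).
Hypothesis D_leibniz : forall i x y, homog i x ->
  D (mul x y) = mul (D x) y + (-1) ^ i *: mul x (D y).

(** The two mixed terms carry the signs [(-1) ^ (i + 1)] and [(-1) ^ i] and cancel. *)
Lemma square_zero_mul i x y : homog i x ->
  D (D x) = 0 -> D (D y) = 0 -> D (D (mul x y)) = 0.
Proof.
move=> hx Dx Dy; rewrite (D_leibniz _ hx) (linD D_linear) (linZ D_linear).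
rewrite (D_leibniz _ (D_degree hx)) (D_leibniz _ hx) Dx Dy.
rewrite (lin0 (mulL _)) (lin0 (mulR _)) scaler0 addr0 add0r -scalerDl.
by rewrite (@sign_opp _ 0 (i + 1) i) ?addNr ?scale0r //; ring.
Qed.
End Derivations.

(** * Derivations of the free algebra *)

Section DerExt.
Context (k : fieldType) (V : gradedType k) (g : V -> Tplus V).
Hypothesis g_linear : linear g.

(** The letter to be differentiated is the head of the right piece of a cut; the last cut, whose
    right piece is empty, adds 0. *)
Definition der_sum (s : seq V) : Tplus V :=
  \sum_(a <- splits s) if a.2 is x :: r
    then tlift (fun t => word ([seq gsign 1 v | v <- a.1] ++ t ++ r)) (g x) else 0.

Lemma der_sumE s :
  \sum_(0 <= i < size s)
    tlift (fun t => word ([seq gsign 1 v | v <- take i s] ++ t ++ drop i.+1 s))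
          (g (nth 0 s i)) = der_sum s.
Proof.
rewrite /der_sum (big_splits (fun a1 a2 => if a2 is x :: r
    then tlift (fun t => word ([seq gsign 1 v | v <- a1] ++ t ++ r)) (g x) else 0)).
rewrite [RHS]big_nat_recr //= drop_size addr0.
by apply: eq_big_nat => i /andP[_ li]; rewrite [in RHS](drop_nth 0).
Qed.

Lemma word_mid_multi (s r : seq V) : multilinear (fun t => word (s ++ t ++ r)).
Proof.
move=> s1 s2 a x y; have := word_multilinear (s ++ s1) (s2 ++ r) a x y.
by rewrite -!catA.
Qed.

Lemma der_sum_multilinear : multilinear der_sum.
Proof.
pose F (a c : seq V) : Tplus V := if c is x :: r
    then tlift (fun t => word ([seq gsign 1 v | v <- a] ++ t ++ r)) (g x) else 0.
apply: (big_splits_multilinear (F := F)) => [[|x r]|a].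
- by move=> s1 s2 a x y; rewrite /F scaler0 addr0.
- apply: (multilinear_tlift (F := fun a t => word ([seq gsign 1 v | v <- a] ++ t ++ r))).
    move=> t; apply: (map_gsign_multi (F := fun s => word (s ++ t ++ r))).
    exact: word_cat_multil.
  by move=> s; apply: word_mid_multi.
case=> [|z s1] s2 e x y; rewrite /F /=.
  by rewrite g_linear (tlift_linear (word_mid_multi _ _)).
move: s1 s2 e x y.
apply: (multilinear_tlift (F := fun r t => word ([seq gsign 1 v | v <- a] ++ t ++ r))).
  by move=> t s1 s2 e x y; rewrite !catA; apply: word_multilinear.
by move=> s; apply: word_mid_multi.
Qed.

Local Notation D := (der_ext g).

Lemma der_ext_linear : linear D.
Proof. exact: tlift_linear (eq_multilinear der_sumE der_sum_multilinear). Qed.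

Lemma der_ext_word s : D (word s) = der_sum s.
Proof.
case: s => [|x s]; first by rewrite word_nil (lin0 der_ext_linear) /der_sum big_seq1.
by rewrite /der_ext (tlift_word (eq_multilinear der_sumE der_sum_multilinear)) ?der_sumE.
Qed.

Lemma der_ext_letter x : D (word [:: x]) = g x.
Proof.
rewrite der_ext_word /der_sum /= big_cons big_seq1 /= addr0.
apply: (eq_linear_Tplus (f := tlift (fun t => word (t ++ [::]))) (g := id)) => //.
  exact: tlift_linear (word_mid_multi [::] [::]).
move=> s s0 _; rewrite (tlift_word (word_mid_multi [::] [::])) ?cats0 //.
by case: (s) s0.
Qed.

Lemma der_ext_cons x s : s != [::] ->
  D (word (x :: s)) = tmul (g x) (word s) + tmul (word [:: gsign 1 x]) (D (word s)).
Proof.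
move=> s0; have n0 (t : seq (int * V)) : t != [::] -> wval t != [::] by case: t.
rewrite !der_ext_word /der_sum (big_splits_cons (fun a1 a2 => if a2 is x :: r
    then tlift (fun t => word ([seq gsign 1 v | v <- a1] ++ t ++ r)) (g x) else 0)).
refine (f_equal2 +%R _ _).
  apply: (eq_linear_Tplus (f := tlift (fun t => word (t ++ s))) (g := fun y => tmul y _)).
  - exact: tlift_linear (word_mid_multi [::] s).
  - exact: tmul_linearl.
  by move=> t t0 _; rewrite (tlift_word (word_mid_multi [::] s)) ?tmul_word ?n0.
rewrite (lin_sum (tmul_linearr _)); apply: eq_bigr => -[a1 [|y r]] _ /=.
  by rewrite (lin0 (tmul_linearr _)).
apply: (eq_linear_Tplus (f := tlift _) (g := fun y => tmul _ (tlift _ y))).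
- exact: tlift_linear (word_mid_multi (_ :: _) r).
- exact: comp_is_linear (tmul_linearr _) (tlift_linear (word_mid_multi _ r)).
move=> t t0 _; rewrite (tlift_word (word_mid_multi (_ :: _) r)) ?n0 //.
rewrite (tlift_word (word_mid_multi _ r)) ?n0 // tmul_word //.
by case: (t) t0 => // ? ?; case: [seq _ | _ <- _].
Qed.

Lemma der_ext_letter_mul x y :
  D (tmul (word [:: x]) y) = tmul (g x) y + tmul (word [:: gsign 1 x]) (D y).
Proof.
apply: (eq_linear_Tplus (f := fun y => D (tmul _ y))
  (g := fun y => tmul _ y + tmul _ (D y))).
- exact: comp_is_linear der_ext_linear (tmul_linearr _).
- apply: add_is_linear; first exact: tmul_linearr.
  exact: comp_is_linear (tmul_linearr _) der_ext_linear.
by move=> [|p s] // _ _; rewrite tmul_word // der_ext_cons.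
Qed.

Lemma der_ext_leibniz i x y : homog i x ->
  D (tmul x y) = tmul (D x) y + (-1) ^ i *: tmul x (D y).
Proof.
move=> hx; apply: (eq_linear_homog (f := fun x => D (tmul x y))
  (g := fun x => tmul (D x) y + _ *: tmul x (D y)) _ _ hx).
- exact: comp_is_linear der_ext_linear (tmul_linearl y).
- apply: add_is_linear; first exact: comp_is_linear (tmul_linearl y) der_ext_linear.
  by apply: scale_is_linear; apply: tmul_linearl.
move=> + + + <- {x hx}; elim=> [|[j x] s IH]; first by [].
move=> _ /hword_cons[/= hx hs].
have sx : word [:: gsign 1 x] = (-1) ^ j *: word [:: x] :> Tplus V.
  by rewrite (gsign_homog _ hx) mul1r (linZ (@word1_linear k V)).
case: s IH hs => [|q s] IH hs.
  rewrite der_ext_letter_mul der_ext_letter sx wdeg_cons wdeg_nil addr0.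
  by rewrite (linZ (tmul_linearl _)).
rewrite wdeg_cons signD.
have -> : word (wval [:: (j, x), q & s]) = tmul (word [:: x]) (word (wval (q :: s))).
  by rewrite tmul_word.
apply: (leibniz_mul (@tmul_linearl k V) (@tmul_linearr k V) (@tmulA k V) (dx := g x)).
  move=> z; rewrite der_ext_letter_mul sx; refine (f_equal2 +%R (erefl _) _).
  exact: linZ (tmul_linearl _) _ _.
exact: (IH isT hs).
Qed.

Hypothesis g_degree : forall i x, homog i x -> homog (i + 1) (g x).

Lemma word1_homog i (x : V) : homog i x -> homog i (word [:: x]).
Proof.
move=> hx; have := @word_homog k V [:: (i, x)].
by rewrite wdeg_cons wdeg_nil addr0; apply; apply/hword_cons.
Qed.

Lemma der_ext_graded : graded_map 1 D.
Proof.
apply: Tplus_graded_map der_ext_linear _.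
elim=> [|[j x] s IH]; first by [].
move=> _ /hword_cons[/= hx hs].
case: s IH hs => [|q s] IH hs.
  by rewrite der_ext_letter wdeg_cons wdeg_nil addr0; apply: g_degree.
rewrite der_ext_cons //; apply: homogD.
  rewrite wdeg_cons addrAC; apply: tmul_degree; first exact: g_degree.
  exact: (word_homog hs).
rewrite (gsign_homog _ hx) (linZ (@word1_linear k V)) (linZ (tmul_linearl _)).
rewrite wdeg_cons -addrA; apply: homogZ; apply: tmul_degree; first exact: word1_homog.
exact: (IH isT hs).
Qed.

Lemma der_ext_square : (forall x, D (g x) = 0) -> forall t, D (D t) = 0.
Proof.
move=> Dg t; apply: (eq_linear_Tplus (f := fun t => D (D t)) (g := fun=> 0)).
- exact: comp_is_linear der_ext_linear der_ext_linear.
- by move=> a x y; rewrite scaler0 addr0.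
apply: (@word_ind_letters k V (fun t => D (D t) = 0)) => [i x _|i x s hx s0 hs _ IH].
  by rewrite der_ext_letter.
have hw := word1_homog hx.
apply: (square_zero_mul (@tmul_linearl k V) (@tmul_linearr k V) der_ext_linear
  der_ext_graded.2 der_ext_leibniz hw _ IH).
by rewrite der_ext_letter.
Qed.
End DerExt.

(** * The cobar construction *)

Section TensHomog.
Context (k : fieldType) (U V : gradedType k).

Lemma tens_graded_map (W : gradedType k) e (f : tens U V -> W) : linear f ->
  (forall i j u v, homog i u -> homog j v -> homog (i + j + e) (f (pure u v))) ->
  graded_map e f.
Proof.
move=> fL fh; split=> // n t; rewrite {1}/homog /gproj /= => <-.
elim/tens_ind: t => [|a u v t IH].
  by rewrite (lin0 (tens_proj_linear n)) (lin0 fL); apply: homog0.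
rewrite tens_proj_linear fL; apply: homog_lin IH; rewrite tens_proj_pure /gsum (lin_sum fL).
apply: homog_sum => i.
by have := fh _ _ _ _ (homog_gproj i u) (homog_gproj (n - i) v); rewrite [i + _]addrC subrK.
Qed.

Lemma eq_linear_tens_homog (W : lmodType k) (f g : tens U V -> W) t :
  linear f -> linear g ->
  (forall i j u v, homog i u -> homog j v -> f (pure u v) = g (pure u v)) -> f t = g t.
Proof.
move=> fL gL fg; apply: eq_linear_tens => // u v.
apply: (gsum_eq (f := fun u => f (pure u v)) (g := fun u => g (pure u v))).
- exact: comp_is_linear fL ((pure_bilinear _ _).1 v).
- exact: comp_is_linear gL ((pure_bilinear _ _).1 v).
move=> i x hx; apply: (gsum_eq (f := fun v => f (pure x v)) (g := fun v => g (pure x v))).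
- exact: comp_is_linear fL ((pure_bilinear _ _).2 x).
- exact: comp_is_linear gL ((pure_bilinear _ _).2 x).
by move=> j y hy; apply: fg hx hy.
Qed.

Lemma gsign_gsign (x : U) : gsign 1 (gsign 1 x) = x.
Proof.
apply: (gsum_eq (f := fun x => gsign 1 (gsign 1 x)) (g := id)) => //.
  exact: comp_is_linear (gsign_linear 1) (gsign_linear 1).
move=> i y hy; rewrite (gsign_homog _ hy) (linZ (gsign_linear _)) (gsign_homog _ hy).
by rewrite scalerA sign_sqr scale1r.
Qed.

Lemma gsign_diff (f : U -> U) x : graded_map 1 f -> gsign 1 (f x) = - f (gsign 1 x).
Proof.
move=> [fL fh]; apply: (gsum_eq (f := fun x => gsign 1 (f x)) (g := fun x => - f (gsign 1 x))).
- exact: comp_is_linear (gsign_linear 1) fL.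
- exact: opp_is_linear (comp_is_linear fL (gsign_linear 1)).
move=> i y hy; rewrite (gsign_homog _ hy) (gsign_homog _ (fh _ _ hy)) (linZ fL) !mul1r.
by rewrite (@sign_opp _ 0 (i + 1) i) ?scaleNr //; ring.
Qed.

(** The same element has degree larger by [n] in [shift n U]. For [n = 1] this explains the minus
    sign that appears when the Leibniz sign of the cobar construction is expressed by degrees in
    [C]. *)
Lemma gsign_shift n (x : U) : gsign 1 (x : shift n U) = (-1) ^ n *: gsign 1 x :> U.
Proof.
pose f (x : U) : U := gsign 1 (x : shift n U).
apply: (@gsum_eq k U U f (fun x => (-1) ^ n *: gsign 1 x)).
- exact: (@gsign_linear k (shift n U) 1).
- exact: scale_is_linear (gsign_linear 1).
move=> i y hy; rewrite (gsign_homog _ hy).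
have hy' : homog (i + n) (y : shift n U) by rewrite /homog /gproj /= /shift_proj addrK.
by rewrite /f (gsign_homog 1 hy') scalerA !mul1r signD mulrC.
Qed.
End TensHomog.

Section Coleibniz.
Context (k : fieldType) (T : gradedType k) (D : T -> T).
Hypothesis hD : graded_map 1 D.

(** The differential of the tensor square of [T]; [dgcoalg_coleibniz] says that the coproduct
    intertwines [D] with it. *)
Definition coleib : tens T T -> tens T T :=
  tens_lift (fun x y => pure (D x) y + pure (gsign 1 x) (D y)).

Lemma coleib_bilinear :
  bilinear_map (fun x y => pure (D x) y + pure (gsign 1 x) (D y) : tens T T).
Proof.
split=> [y|x]; apply: add_is_linear.
- exact: comp_is_linear ((pure_bilinear _ _).1 y) hD.1.
- exact: comp_is_linear ((pure_bilinear _ _).1 _) (gsign_linear 1).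
- exact: (pure_bilinear _ _).2.
- exact: comp_is_linear ((pure_bilinear _ _).2 _) hD.1.
Qed.

Lemma coleib_linear : linear coleib.
Proof. exact: tens_lift_linear coleib_bilinear. Qed.

Lemma coleib_pure i x y : homog i x ->
  coleib (pure x y) = pure (D x) y + (-1) ^ i *: pure x (D y).
Proof.
move=> hx; rewrite /coleib (tens_lift_pure coleib_bilinear) (gsign_homog _ hx) mul1r.
by rewrite (linZ ((pure_bilinear _ _).1 _)).
Qed.

Lemma coleib_sum (I J : eqType) (r : seq I) (q : seq J) (e : I -> J -> k)
    (n : I -> J -> int) (x y : I -> J -> T) :
  (forall i j, i \in r -> j \in q -> homog (n i j) (x i j)) ->
  coleib (\sum_(i <- r) \sum_(j <- q) e i j *: pure (x i j) (y i j))
  = \sum_(i <- r) \sum_(j <- q) e i j *: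
      (pure (D (x i j)) (y i j) + (-1) ^ n i j *: pure (x i j) (D (y i j))).
Proof.
move=> hx; rewrite (lin_sum coleib_linear); apply: eq_big_seq => i ir.
rewrite (lin_sum coleib_linear); apply: eq_big_seq => j jq.
by rewrite (linZ coleib_linear) (coleib_pure _ (hx _ _ ir jq)).
Qed.

Lemma coleib_square i x y : homog i x ->
  coleib (coleib (pure x y)) = pure (D (D x)) y + pure x (D (D y)).
Proof.
move=> hx; rewrite (coleib_pure _ hx) (linD coleib_linear) (linZ coleib_linear).
rewrite (coleib_pure _ (hD.2 _ _ hx)) (coleib_pure _ hx).
rewrite scalerDr scalerA sign_sqr scale1r -addrA [X in _ + X]addrA -scalerDl.
by rewrite (@sign_opp _ 0 (i + 1) i) ?addNr ?scale0r ?add0r //; ring.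
Qed.
End Coleibniz.

Section TensAssoc.
Context (k : fieldType) (U V W : lmodType k).

Let assoc2 (z : W) (t : tens U V) : tens U (tens V W) :=
  tens_lift (fun x y => pure x (pure y z)) t.

Let assoc2_bilinear z : bilinear_map (fun x y => pure x (pure y z) : tens U (tens V W)).
Proof.
split=> [y|x]; first exact: (pure_bilinear _ _).1.
exact: comp_is_linear ((pure_bilinear _ _).2 x) ((pure_bilinear _ _).1 z).
Qed.

Let assoc_bilinear : bilinear_map (fun (t : tens U V) z => assoc2 z t).
Proof.
split=> [z|t]; first exact: tens_lift_linear (assoc2_bilinear z).
move=> a x y.
apply: (eq_linear_tens (f := assoc2 (a *: x + y))
  (g := fun t => a *: assoc2 x t + assoc2 y t)).
- exact: tens_lift_linear (assoc2_bilinear _).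
- apply: add_is_linear; last exact: tens_lift_linear (assoc2_bilinear _).
  by apply: scale_is_linear; apply: tens_lift_linear (assoc2_bilinear _).
have E z u v : assoc2 z (pure u v) = pure u (pure v z).
  exact: tens_lift_pure (assoc2_bilinear z) u v.
move=> u v; rewrite !E ((pure_bilinear V W).2 v a x y).
exact: (pure_bilinear U (tens V W)).2.
Qed.

Lemma tens_assoc_linear : linear (@tens_assoc k U V W).
Proof. exact: tens_lift_linear assoc_bilinear. Qed.

Lemma tens_assoc_pure x y z :
  tens_assoc (pure (pure x y) z) = pure x (pure y z) :> tens U (tens V W).
Proof.
rewrite /tens_assoc (tens_lift_pure assoc_bilinear).
exact: tens_lift_pure (assoc2_bilinear z) x y.
Qed.
End TensAssoc.

(** [W], [w1], [w2], [w3] stand for the cobar construction and its words of length 1, 2, 3. *)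
Section CobarLetters.
Context (k : fieldType) (C : gradedType k) (Delta : C -> tens C C) (dC : C -> C).
Hypothesis hC : is_dgcoalg Delta dC.
Context (W : lmodType k) (w1 : C -> W) (w2 : C -> C -> W).
Hypothesis w1L : linear w1.
Hypothesis w2L : bilinear_map w2.

(** The quadratic part of the cobar differential. With an abstract target [W] the arguments stay in
    [C], so every [gsign] of this section refers to the degree in [C] and not in its
    desuspension. *)
Definition cobar_quad : tens C C -> W := tens_lift (fun x y => - w2 (gsign 1 x) y).

Lemma cobar_quad_bilinear : bilinear_map (fun x y => - w2 (gsign 1 x) y).
Proof.
split=> [y|x]; apply: opp_is_linear; last exact: w2L.2.
exact: comp_is_linear (w2L.1 y) (gsign_linear 1).
Qed.

Lemma cobar_quad_linear : linear cobar_quad.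
Proof. exact: tens_lift_linear cobar_quad_bilinear. Qed.

Lemma cobar_quad_pure x y : cobar_quad (pure x y) = - w2 (gsign 1 x) y.
Proof. exact: tens_lift_pure cobar_quad_bilinear x y. Qed.

Definition cobar_letter x : W := w1 (dC x) + cobar_quad (Delta x).

Let dL : linear dC := (dgcoalg_diff hC).1.1.
Let DeltaL : linear Delta := (dgcoalg_graded hC).1.

Lemma cobar_letter_linear : linear cobar_letter.
Proof. exact: add_is_linear (comp_is_linear w1L dL) (comp_is_linear cobar_quad_linear DeltaL). Qed.

Section Square.
Context (w3 : C -> C -> C -> W) (mul : W -> W -> W) (D : W -> W).
Hypothesis w3L1 : forall y z, linear (fun x => w3 x y z).
Hypothesis w3L2 : forall x z, linear (fun y => w3 x y z).
Hypothesis w3L3 : forall x y, linear (w3 x y).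
Hypothesis mulL : forall y, linear (mul^~ y).
Hypothesis mulR : forall x, linear (mul x).
Hypothesis mul11 : forall x y, mul (w1 x) (w1 y) = w2 x y.
Hypothesis mul12 : forall x y z, mul (w1 x) (w2 y z) = w3 x y z.
Hypothesis mul21 : forall x y z, mul (w2 x y) (w1 z) = w3 x y z.
Hypothesis D_linear : linear D.
Hypothesis D1 : forall x, D (w1 x) = cobar_letter x.
Hypothesis D2 : forall x y,
  D (w2 x y) = mul (cobar_letter x) (w1 y) - mul (w1 (gsign 1 x)) (cobar_letter y).

(** The cubic term left after applying the quadratic part twice. Of the signs produced on the way,
    the two on the first factor cancel and only the one on the middle factor remains. *)
Let psi2 x := tens_lift (fun y z => w3 x (gsign 1 y) z).

Let psi2_bilinear x : bilinear_map (fun y z => w3 x (gsign 1 y) z).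
Proof.
split=> [z|y]; last exact: w3L3.
exact: comp_is_linear (w3L2 x z) (gsign_linear 1).
Qed.

Let psi : tens C (tens C C) -> W := tens_lift psi2.

Let psi_bilinear : bilinear_map psi2.
Proof.
split=> [t a x y|x]; last exact: tens_lift_linear (psi2_bilinear x).
apply: (eq_linear_tens (f := psi2 (a *: x + y)) (g := fun t => a *: psi2 x t + psi2 y t)).
- exact: tens_lift_linear (psi2_bilinear _).
- apply: add_is_linear; last exact: tens_lift_linear (psi2_bilinear _).
  by apply: scale_is_linear; apply: tens_lift_linear (psi2_bilinear _).
by move=> u v; rewrite /psi2 !(tens_lift_pure (psi2_bilinear _)) w3L1.
Qed.

Let psi_linear : linear psi. Proof. exact: tens_lift_linear psi_bilinear. Qed.

Let left t : tens C (tens C C) := tens_assoc (tens_lift (fun x y => pure (Delta x) y) t).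
Let right t := tens_lift (fun x y => pure x (Delta y)) t : tens C (tens C C).

Let left_bilinear : bilinear_map (fun x y => pure (Delta x) y : tens (tens C C) C).
Proof.
split=> [y|x]; last exact: (pure_bilinear _ _).2.
exact: comp_is_linear ((pure_bilinear _ _).1 y) DeltaL.
Qed.

Let right_bilinear : bilinear_map (fun x y => pure x (Delta y) : tens C (tens C C)).
Proof.
split=> [y|x]; first exact: (pure_bilinear _ _).1.
exact: comp_is_linear ((pure_bilinear _ _).2 x) DeltaL.
Qed.

Let Delta_gsign x : cobar_quad (Delta (gsign 1 x))
  = tens_lift (fun x y => - w2 x (gsign 1 y)) (Delta x).
Proof.
have bil : bilinear_map (fun x y => - w2 x (gsign 1 y)).
  split=> [z|z]; apply: opp_is_linear; first exact: w2L.1.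
  exact: comp_is_linear (w2L.2 z) (gsign_linear 1).
apply: (gsum_eq (f := fun x => cobar_quad (Delta (gsign 1 x)))
  (g := fun x => tens_lift _ (Delta x))).
- exact: comp_is_linear cobar_quad_linear (comp_is_linear DeltaL (gsign_linear 1)).
- exact: comp_is_linear (tens_lift_linear bil) DeltaL.
move=> n {}x hx; have /= := (dgcoalg_graded hC).2 _ _ hx; rewrite addr0.
rewrite (gsign_homog _ hx) (linZ DeltaL) (linZ cobar_quad_linear); move: (Delta x) => t.
(* [Delta x] is homogeneous of degree [n], hence equal to its projection, whose terms have degrees
   [i] and [n - i]. So a sign on both factors is the total sign of [x]. *)
rewrite /homog => <-; rewrite /gproj /=.
elim/tens_ind: t => [|a u v t IH].
  rewrite !(lin0 (tens_proj_linear _)) (lin0 cobar_quad_linear).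
  by rewrite (lin0 (tens_lift_linear bil)) scaler0.
rewrite tens_proj_linear cobar_quad_linear (tens_lift_linear bil) scalerDr IH; congr (_ + _).
rewrite scalerA mulrC -scalerA; congr (_ *: _); rewrite tens_proj_pure /gsum.
rewrite (lin_sum cobar_quad_linear) (lin_sum (tens_lift_linear bil)) scaler_sumr.
apply: eq_bigr => i _; rewrite cobar_quad_pure (tens_lift_pure bil).
rewrite (gsign_homog _ (homog_gproj i u)) (gsign_homog _ (homog_gproj _ v)).
rewrite (linZ (w2L.1 _)) (linZ (w2L.2 _)) scalerN scalerA -signD; congr (- (_ *: _)).
by apply: (@sign_eq _ i); ring.
Qed.

(** The terms containing [dC] cancel between the two summands on the left, leaving the defect of
    coassociativity of the two cubic expressions. Taking [t = Delta x] then gives the square-zero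
    property on letters. *)
Lemma cobar_quad_diff t :
  D (cobar_quad t) + cobar_quad (coleib dC t) = psi (left t) - psi (right t).
Proof.
apply: (eq_linear_tens (f := fun t => D (cobar_quad t) + cobar_quad (coleib dC t))
  (g := fun t => psi (left t) - psi (right t))).
- apply: add_is_linear; first exact: comp_is_linear D_linear cobar_quad_linear.
  exact: comp_is_linear cobar_quad_linear (coleib_linear (dgcoalg_diff hC).1).
- apply: add_is_linear; last apply: opp_is_linear.
    apply: comp_is_linear psi_linear _.
    exact: comp_is_linear (@tens_assoc_linear k C C C) (tens_lift_linear left_bilinear).
  exact: comp_is_linear psi_linear (tens_lift_linear right_bilinear).
move=> x y.
have -> : psi (left (pure x y)) = - mul (cobar_quad (Delta (gsign 1 x))) (w1 y).
  rewrite /left (tens_lift_pure left_bilinear) Delta_gsign; move: (Delta x) => t'.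
  have bil : bilinear_map (fun x y => - w2 x (gsign 1 y)).
    split=> [z|z]; apply: opp_is_linear; first exact: w2L.1.
    exact: comp_is_linear (w2L.2 z) (gsign_linear 1).
  apply: (eq_linear_tens (f := fun t => psi (tens_assoc (pure t y)))
    (g := fun t => - mul (tens_lift _ t) (w1 y))).
  - apply: comp_is_linear psi_linear _.
    exact: comp_is_linear (@tens_assoc_linear k C C C) ((pure_bilinear _ _).1 y).
  - exact: opp_is_linear (comp_is_linear (mulL _) (tens_lift_linear bil)).
  move=> u v; rewrite tens_assoc_pure (tens_lift_pure bil).
  rewrite /psi (tens_lift_pure psi_bilinear) /psi2 (tens_lift_pure (psi2_bilinear _)).
  by rewrite (linN _ (mulL _)) opprK mul21.
have -> : psi (right (pure x y)) = - mul (w1 x) (cobar_quad (Delta y)).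
  rewrite /right (tens_lift_pure right_bilinear) /psi (tens_lift_pure psi_bilinear).
  move: (Delta y) => t'.
  apply: (eq_linear_tens (f := psi2 x) (g := fun t => - mul (w1 x) (cobar_quad t))).
  - exact: tens_lift_linear (psi2_bilinear x).
  - exact: opp_is_linear (comp_is_linear (mulR _) cobar_quad_linear).
  move=> u v; rewrite /psi2 (tens_lift_pure (psi2_bilinear x)) cobar_quad_pure.
  by rewrite (linN _ (mulR _)) opprK mul12.
rewrite /coleib (tens_lift_pure (coleib_bilinear (dgcoalg_diff hC).1)) (linD cobar_quad_linear).
rewrite !cobar_quad_pure.
rewrite (linN _ D_linear) D2 gsign_gsign /cobar_letter.
rewrite (linD (mulL _)) (linD (mulR _)) !mul11 (gsign_diff _ (dgcoalg_diff hC).1).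
rewrite (linN _ (w2L.1 _)) opprK.
(* [a] and [e] contain [dC] and occur with both signs; [m] and [n] are the cubic terms on the
   right-hand side. *)
set a := w2 _ _; set e := w2 _ _; set m := mul _ _; set n := mul _ _.
rewrite opprK !opprD !opprK -!addrA addrC -!addrA [- m + _]addrCA.
by rewrite [a + _]addrCA subrr addr0 addrC -addrA subrK.
Qed.

Lemma cobar_letter_square x : D (cobar_letter x) = 0.
Proof.
rewrite {1}/cobar_letter (linD D_linear) D1 /cobar_letter (dgcoalg_diff hC).2 (lin0 w1L) add0r.
rewrite (dgcoalg_coleibniz hC) addrC cobar_quad_diff.
have -> : left (Delta x) = right (Delta x) by exact: dgcoalg_coassoc hC x.
by rewrite subrr.
Qed.
End Square.

Section Action.
Context (B : gradedType k) (b : seq B -> seq B -> B) (d : seq B -> B).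
Context (beta : seq B -> C -> C) (hbeta : is_coalg_action b d Delta dC beta).
Context (act : seq B -> W -> W).
Hypothesis d_multi : multilinear d.
Hypothesis actL : forall v, linear (act v).
Hypothesis act1 : forall v x, act v (w1 x) = w1 (beta v x).
Hypothesis act2 : forall v i x y, hword v -> homog i x ->
  act (wval v) (w2 x y) = \sum_(a <- splits v) (-1) ^ ((i + 1) * wdeg a.2) *:
    w2 (beta (wval a.1) x) (beta (wval a.2) y).

Let hm := coalg_action_module hbeta.

Let betaL v : linear (beta v) := (mod_linear hm).2 v.

Let comul_bilinear v1 v2 e : bilinear_map (fun c1 c2 =>
  pure (beta v1 (gsign e c1)) (beta v2 c2) : tens C C).
Proof.
split=> [y|x]; last exact: comp_is_linear ((pure_bilinear _ _).2 _) (betaL _).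
apply: comp_is_linear ((pure_bilinear _ _).1 _) _.
exact: comp_is_linear (betaL _) (gsign_linear _).
Qed.

Let comul v t : tens C C := \sum_(a <- splits v) tens_lift (fun c1 c2 =>
  pure (beta (wval a.1) (gsign (wdeg a.2) c1)) (beta (wval a.2) c2)) t.

Let Delta_beta v c : hword v -> Delta (beta (wval v) c) = comul v (Delta c).
Proof.
move=> hv; rewrite (coalg_action_comul hbeta _ hv) /comul.
by rewrite (big_splits (fun a1 a2 => tens_lift (fun c1 c2 =>
  pure (beta (wval a1) (gsign (wdeg a2) c1)) (beta (wval a2) c2)) (Delta c))).
Qed.

(** The sign appears because [v] crosses the quadratic part of the differential, a map of degree one
    on the cobar construction. Letters of the cobar construction have degree [i + 1], whence the
    factor in [act2] that turns the Koszul sign of [C] into this one. *)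
Lemma cobar_quad_act v t : hword v ->
  cobar_quad (comul v t) = (-1) ^ wdeg v *: act (wval v) (cobar_quad t).
Proof.
move=> hv; apply: (eq_linear_tens_homog (f := fun t => cobar_quad (comul v t))
  (g := fun t => (-1) ^ wdeg v *: act (wval v) (cobar_quad t))).
- apply: comp_is_linear cobar_quad_linear _; apply: sum_is_linear => a.
  exact: tens_lift_linear (comul_bilinear _ _ _).
- exact: scale_is_linear (comp_is_linear (actL _) cobar_quad_linear).
move=> i j x y hx hy; rewrite cobar_quad_pure /comul (lin_sum cobar_quad_linear).
rewrite (gsign_homog _ hx) (linZ (w2L.1 _)) (linN _ (actL _)) (linZ (actL _)) (act2 _ hv hx).
rewrite -scaleN1r !scaler_sumr; apply: eq_big_seq => a av.
have [h1 h2] := hword_splits hv av; rewrite (wdeg_splits av).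
rewrite (tens_lift_pure (comul_bilinear _ _ _)) cobar_quad_pure (gsign_homog _ hx).
rewrite (linZ (betaL _)) (linZ (gsign_linear _)) (gsign_homog _ (mod_degree hm h1 hx)).
rewrite scalerA (linZ (w2L.1 _)) -scaleN1r !scalerA -[-1]/((-1) ^ (1 : int)) -!signD.
by congr (_ *: _); apply: (@sign_eq _ (- wdeg a.2)); ring.
Qed.

Lemma cobar_letter_act v x (D : W -> W) : (forall y, D (w1 y) = cobar_letter y) ->
  hword v ->
  D (act (wval v) (w1 x))
  = ev (coder_words d v) (fun w => act (wval w) (w1 x))
    + (-1) ^ wdeg v *: act (wval v) (D (w1 x)).
Proof.
move=> D1 hv; rewrite D1 act1 D1 /cobar_letter (mod_diff hm _ hv) Delta_beta //.
rewrite (linD (actL _)) act1 cobar_quad_act // (linD w1L) (linZ w1L) scalerDr addrA.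
congr (_ + _ + _); rewrite (tlift_coder d_multi ((mod_linear hm).1 x) hv) (ev_lin _ _ w1L).
by apply: eq_ev_all => w; rewrite /= act1.
Qed.
End Action.
End CobarLetters.

Section Cobar.
Context (k : fieldType) (C : gradedType k) (Delta : C -> tens C C) (dC : C -> C).
Hypothesis hC : is_dgcoalg Delta dC.

Local Notation V := (desusp C).
Local Notation g := (cobar_gen Delta dC).
Local Notation D := (cobar_diff Delta dC).

Let w1 (x : C) : cobar C := word [:: to_desusp x].
Let w2 (x y : C) : cobar C := word [:: to_desusp x; to_desusp y].
Let w3 (x y z : C) : cobar C := word [:: to_desusp x; to_desusp y; to_desusp z].

Let w1L : linear w1. Proof. exact: (@word1_linear k V). Qed.

Let w2L : bilinear_map w2.
Proof.
split=> [y|x] a u v; first exact: (@word_multilinear k V [::]).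
exact: (@word_multilinear k V [:: x]).
Qed.

Let gL : linear g. Proof. exact: (cobar_letter_linear hC w1L w2L). Qed.

Let D1 x : D (w1 x) = cobar_letter Delta dC w1 w2 x.
Proof. exact: (der_ext_letter gL). Qed.

Let g_degree i (x : V) : homog i x -> homog (i + 1) (g x).
Proof.
move=> hx; have hx' : homog (i - 1) (x : C) by [].
have hd (y : C) j : homog j y -> homog (j + 1) (y : V).
  by move=> hy; rewrite /homog /gproj /= /shift_proj addrK.
apply: homogD.
  apply: word1_homog; have := (dgcoalg_diff hC).1.2 _ _ hx'; rewrite subrK => /hd; exact.
have h := (dgcoalg_graded hC).2 _ _ hx'; rewrite addr0 in h.
(* In [C] the element has degree [i - 1], [Delta] preserves it, and each of the two desuspensions
   adds one. *)
have [_ Q] : graded_map 2 (cobar_quad w2).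
  apply: tens_graded_map (cobar_quad_linear w2L) _ => p q u v hu hv.
  rewrite (cobar_quad_pure w2L) (gsign_homog _ hu) (linZ (w2L.1 v)); apply: homogN; apply: homogZ.
  have := @word_homog k V [:: (p + 1, u); (q + 1, v)].
  rewrite !wdeg_cons wdeg_nil addr0 /= (_ : p + 1 + (q + 1) = p + q + 2); last by ring.
  by apply; apply/hword_cons; split; [exact: hd|apply/hword_cons; split; [exact: hd|]].
by have := Q _ _ h; rewrite (_ : i - 1 + 2 = i + 1); last by ring.
Qed.

Lemma cobar_dgalg : is_dgalg (@tmul k V) D.
Proof.
split.
- split; first exact: (der_ext_graded gL g_degree).
  apply: (der_ext_square gL g_degree) => x.
  apply: (cobar_letter_square hC w1L w2L (w3 := w3) (mul := @tmul k V) (D := D)).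
  + by move=> y z a u v; apply: (@word_multilinear k V [::]).
  + by move=> y z a u v; apply: (@word_multilinear k V [:: y]).
  + by move=> y z a u v; apply: (@word_multilinear k V [:: y; z]).
  + exact: tmul_linearl.
  + exact: tmul_linearr.
  + by move=> y z; apply: tmul_word.
  + by move=> y z t; apply: tmul_word.
  + by move=> y z t; apply: tmul_word.
  + exact: der_ext_linear gL.
  + exact: D1.
  move=> y z; rewrite /D /cobar_diff (der_ext_cons gL) // (der_ext_letter gL).
  (* The Leibniz sign of a letter uses its degree in the desuspension, one more than in [C], hence
     the minus sign required by [cobar_letter_square]. *)
  refine (f_equal2 +%R (erefl _) _); rewrite (gsign_shift 1 y).
  rewrite (_ : (-1) ^ 1 *: gsign 1 y = - gsign 1 y :> V); last by rewrite expr1z scaleN1r.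
  rewrite -[word [:: - _]]/(w1 (- gsign 1 y)) (linN _ w1L).
  exact: (linN _ (tmul_linearl _)).
- exact: tmul_bilinear.
- exact: tmul_degree.
- exact: tmulA.
- move=> i x y; exact: (der_ext_leibniz gL).
Qed.

Context (B : gradedType k) (b : seq B -> seq B -> B) (d : seq B -> B).
Hypothesis hB : is_Binf b d.
Context (beta : seq B -> C -> C) (hbeta : is_coalg_action b d Delta dC beta).

Let hm := coalg_action_module hbeta.
Let theta : seq B -> V -> V := beta.

Let theta_linear : (forall w, multilinear (theta^~ w)) /\ (forall y, linear (theta y)).
Proof. exact: mod_linear hm. Qed.

Let theta_degree v i (w : V) : hword v -> homog i w -> homog (wdeg v + i) (theta (wval v) w).
Proof.
move=> hv hw; have := mod_degree hm hv (hw : homog (i - 1) (w : C)).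
by rewrite addrA.
Qed.

Let theta_id w : theta [::] w = w. Proof. exact: mod_id hm w. Qed.

Let theta_assoc u v (x : V) : hword u -> hword v ->
  theta (wval u) (theta (wval v) x) = ev (binf_words b u v) (fun w => theta (wval w) x).
Proof. move=> hu hv. have := module_assoc_hword hB (x : C) hm hu hv. exact. Qed.

Definition cobar_act : seq B -> cobar C -> cobar C := act_ext theta.

Lemma cobar_act_letter v c : cobar_act v (word [:: to_desusp c]) = word [:: to_desusp (beta v c)].
Proof. exact: (act_ext_letter theta_linear). Qed.

Lemma cobar_act_module : is_module b d D cobar_act.
Proof.
apply: (act_ext_is_module hB theta_linear theta_degree theta_id theta_assoc).
have actL := act_ext_linear theta_linear.
have DL : linear D := der_ext_linear gL.
move=> v t hv; apply: (eq_linear_Tplus (f := fun t => D (cobar_act (wval v) t))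
  (g := fun t => ev (coder_words d v) (fun w => cobar_act (wval w) t)
     + (-1) ^ wdeg v *: cobar_act (wval v) (D t))).
- exact: comp_is_linear DL (actL _).
- apply: add_is_linear; first by apply: ev_is_linear => w; apply: actL.
  exact: scale_is_linear (comp_is_linear (actL _) DL).
move=> s s0 hs; pose P x := act_commutes_diff d D cobar_act x.
suff H : P (word (wval s)) by exact: H.
(* The exponent involves [j + 1], the degree of [y] as a letter of the cobar construction. *)
have act2 u j y z : hword u -> homog j y ->
  cobar_act (wval u) (w2 y z) = \sum_(a <- splits u) (-1) ^ ((j + 1) * wdeg a.2) *:
    w2 (beta (wval a.1) y) (beta (wval a.2) z).
  move=> hu hy; have hy' : homog (j + 1) (y : V) by rewrite /homog /gproj /= /shift_proj addrK.
  transitivity (cobar_act (wval u) (tmul (word [:: (y : V)]) (word [:: (z : V)]))).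
    exact: (f_equal (cobar_act (wval u)) (esym (@tmul_word k V [:: y] [:: z] isT isT))).
  apply: (etrans (act_ext_mul theta_linear _ hu (word1_homog hy'))); apply: eq_bigr => a _.
  refine (f_equal ( *:%R _) _).
  have E1 := act_ext_letter theta_linear (wval a.1) (y : V).
  have E2 := act_ext_letter theta_linear (wval a.2) (z : V).
  refine (etrans (f_equal2 (@tmul k V) E1 E2) _); exact: (@tmul_word k V [:: _] [:: _]).
apply: (@word_ind_letters k V P) s0 hs => [i x _|i x r hx r0 hr].
  move=> u hu.
  exact: (cobar_letter_act w1L w2L hbeta (binf_d_linear hB) actL cobar_act_letter act2 x D1 hu).
apply: (act_commutes_diff_mul (binf_d_degree hB) (@tmul_linearl k V) (@tmul_linearr k V)
  actL (act_ext_degree theta_linear theta_degree)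
  (fun v j x y => act_ext_mul theta_linear y (v := v) (j := j) (x := x)) DL
  (der_ext_graded gL g_degree).2 (fun i x y => der_ext_leibniz gL y) (word1_homog hx)).
Qed.

Lemma cobar_act_alg : is_alg_action b d (@tmul k V) D cobar_act.
Proof.
split; first exact: cobar_act_module.
move=> v j x y hv hx; apply: (etrans (act_ext_mul theta_linear y hv hx)).
exact: (big_splits (fun a1 a2 => (-1) ^ (j * wdeg a2) *:
  tmul (cobar_act (wval a1) x) (cobar_act (wval a2) y)) v).
Qed.

Lemma cobar_act_unique gamma : is_alg_action b d (@tmul k V) D gamma ->
  (forall v c, gamma v (word [:: to_desusp c]) = word [:: to_desusp (beta v c)]) ->
  cobar_act = gamma.
Proof.
move=> hg gl; have hgm := alg_action_module hg.
have actL := act_ext_linear theta_linear; have gaL := (mod_linear hgm).2.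
apply/funext => v; apply/funext => t.
apply: (multilinear_eq (f := cobar_act^~ t) (g := gamma^~ t)).
- exact: act_ext_multi.
- exact: (mod_linear hgm).1.
move=> {}v hv _.
apply: (eq_linear_Tplus (f := cobar_act (wval v)) (g := gamma (wval v)) t (actL _) (gaL _)).
move=> s s0 hs.
pose P x := forall v, hword v -> cobar_act (wval v) x = gamma (wval v) x.
suff H : P (word (wval s)) by exact: H.
apply: (@word_ind_letters k V P) s0 hs => [i x _|i x r hx r0 hr Px Pr] u hu.
  by rewrite cobar_act_letter gl.
rewrite (alg_action_mul hg _ hu (word1_homog hx)).
apply: (etrans (act_ext_mul theta_linear _ hu (word1_homog hx))).
rewrite -(big_splits (fun a1 a2 => (-1) ^ (i * wdeg a2) *:
  tmul (gamma (wval a1) (word [:: x])) (gamma (wval a2) (word (wval r))))).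
apply: eq_big_seq => a /(hword_splits hu)[h1 h2].
by refine (f_equal ( *:%R _) (f_equal2 (@tmul k V) _ _)); [exact: Px|exact: Pr].
Qed.
End Cobar.

(** * The bar construction *)

Section DeconcCoassoc.
Context (k : fieldType) (V : gradedType k).
Local Notation T := (Tplus V).

Lemma deconc_coassoc (c : T) :
  tens_assoc (tens_lift (fun x y => pure (deconc x) y) (deconc c))
  = tens_lift (fun x y => pure x (deconc y)) (deconc c) :> tens T (tens T T).
Proof.
have dL := @deconc_linear k V.
have bl : bilinear_map (fun x y : T => pure (deconc x) y : tens (tens T T) T).
  split=> [y|x]; last exact: (pure_bilinear _ _).2.
  exact: comp_is_linear ((pure_bilinear _ _).1 y) dL.
have br : bilinear_map (fun x y : T => pure x (deconc y) : tens T (tens T T)).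
  split=> [y|x]; first exact: (pure_bilinear _ _).1.
  exact: comp_is_linear ((pure_bilinear _ _).2 x) dL.
have aL := @tens_assoc_linear k T T T.
apply: (eq_linear_Tplus (f := fun c => tens_assoc (tens_lift _ (deconc c)))
  (g := fun c => tens_lift _ (deconc c))).
- exact: comp_is_linear aL (comp_is_linear (tens_lift_linear bl) dL).
- exact: comp_is_linear (tens_lift_linear br) dL.
move=> s _ _; rewrite deconc_wval (lin_sum (tens_lift_linear bl)) (lin_sum aL).
rewrite (lin_sum (tens_lift_linear br)).
transitivity (\sum_(a <- splits s) \sum_(c <- splits a.1)
    pure (word (wval c.1)) (pure (word (wval c.2)) (word (wval a.2))) : tens T (tens T T)).
  apply: eq_bigr => a _; rewrite (tens_lift_pure bl) deconc_wval.
  rewrite (lin_sum ((pure_bilinear _ _).1 _)) (lin_sum aL).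
  by apply: eq_bigr => e _; apply: tens_assoc_pure.
rewrite (splits_coassoc (fun x y z => pure (word (wval x))
   (pure (word (wval y)) (word (wval z))))).
apply: eq_bigr => a _; rewrite (tens_lift_pure br) deconc_wval.
by rewrite (lin_sum ((pure_bilinear _ _).2 _)).
Qed.
End DeconcCoassoc.

(** * Coderivations of the cofree coalgebra and their squares *)

Section Coderivation.
Context (k : fieldType) (V : gradedType k) (f : seq V -> V).
Hypothesis f_multi : multilinear f.
Hypothesis f_degree : forall s, s != [::] -> hword s -> homog (wdeg s + 1) (f (wval s)).
Local Notation T := (Tplus V).
Local Notation D := (coder_ext f).
Implicit Types (s : seq (int * V)).

Let DL : linear D. Proof. exact: coder_ext_linear. Qed.
Let Dgr : graded_map 1 D. Proof. exact: coder_ext_graded. Qed.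

Lemma deconc_coder_word s : hword s ->
  deconc (D (word (wval s)))
  = \sum_(a <- splits s) (pure (D (word (wval a.1))) (word (wval a.2))
      + (-1) ^ wdeg a.1 *: pure (word (wval a.1)) (D (word (wval a.2)))).
Proof.
move=> hs; rewrite coder_extE // (ev_lin _ _ (@deconc_linear k V)).
have -> : ev (coder_words f s) (@deconc k V \o (fun w => word (wval w)))
  = ev (coder_words f s) (fun w =>
      \sum_(a <- splits w) pure (word (wval a.1)) (word (wval a.2))).
  by apply: eq_ev_all => w; rewrite /= deconc_wval.
rewrite (coder_words_splits f s (fun a c => pure (word (wval a)) (word (wval c)))).
apply: eq_big_seq => a /(hword_splits hs)[h1 h2].
have E1 := coder_extE f_multi h1; have E2 := coder_extE f_multi h2.
refine (f_equal2 +%R _ (f_equal ( *:%R _) _)).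
  refine (etrans _ (esym (f_equal (fun t : T => pure t (word (wval a.2))) E1))).
  exact: (esym (ev_lin (coder_words f a.1) _ ((pure_bilinear T T).1 (word (wval a.2))))).
refine (etrans _ (esym (f_equal (fun t : T => pure (word (wval a.1)) t) E2))).
exact: (esym (ev_lin (coder_words f a.2) _ ((pure_bilinear T T).2 (word (wval a.1))))).
Qed.

Lemma deconc_coder x : deconc (D x) = coleib D (deconc x).
Proof.
have cL := coleib_linear Dgr.
apply: (eq_linear_Tplus (f := fun x => deconc (D x)) (g := fun x => coleib D (deconc x))).
- exact: comp_is_linear (@deconc_linear k V) DL.
- exact: comp_is_linear cL (@deconc_linear k V).
move=> s _ hs; rewrite deconc_coder_word // deconc_wval (lin_sum cL).
apply: eq_big_seq => a /(hword_splits hs)[h1 h2].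
by rewrite (coleib_pure Dgr _ (word_homog h1)).
Qed.

Lemma ev_coder2 (W : lmodType k) (p q : int * V) (F : seq V -> W) :
  ev (coder_words f [:: p; q]) (fun w => F (wval w))
  = F [:: f [:: p.2]; q.2] + F [:: f [:: p.2; q.2]] + (-1) ^ p.1 *: F [:: p.2; f [:: q.2]].
Proof.
rewrite !ev_coder_cons ev_coder_nil scaler0 addr0 big_seq1.
by rewrite [splits _]/= big_cons big_seq1.
Qed.

Lemma ev_coder3 (W : lmodType k) (p q r : int * V) (F : seq V -> W) :
  ev (coder_words f [:: p; q; r]) (fun w => F (wval w))
  = F [:: f [:: p.2]; q.2; r.2] + (F [:: f [:: p.2; q.2]; r.2] + F [:: f [:: p.2; q.2; r.2]])
    + (-1) ^ p.1 *: (F [:: p.2; f [:: q.2]; r.2] + F [:: p.2; f [:: q.2; r.2]]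
                     + (-1) ^ q.1 *: F [:: p.2; q.2; f [:: r.2]]).
Proof.
rewrite ev_coder_cons (ev_coder2 q r (fun w => F (p.2 :: w))).
by rewrite [splits _]/= !big_cons big_nil addr0.
Qed.

(** Applying [f] to a block leaves a single letter only if the block is the whole word. *)
Lemma ev_coder_corest (W : lmodType k) s (F : seq V -> W) :
  (forall r, size r != 1%N -> F r = 0) ->
  ev (coder_words f s) (fun w => F (wval w)) = if nilp s then 0 else F [:: f (wval s)].
Proof.
move=> F0; case: s => [|x s]; first exact: ev_coder_nil.
rewrite ev_coder_cons [X in _ + _ *: X](_ : _ = 0) ?scaler0 ?addr0.
  rewrite (splits_nilr (F := fun c1 c2 =>
    F (wval ((wdeg (x :: c1) + 1, f (wval (x :: c1))) :: c2)))) //.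
  by move=> y a c; apply: F0.
rewrite -(ev0 _ (coder_words f s)); apply: eq_ev => w /coder_wordsP[_ w0].
by apply: F0; case: w.2 w0.
Qed.

Lemma corest_coder s : hword s ->
  corest (D (word (wval s))) = if nilp s then 0 else f (wval s).
Proof.
move=> hs; rewrite coder_extE // (ev_lin _ _ (@corest_linear k V)).
pose F (r : seq V) : V := if r is [:: v] then v else 0.
rewrite -(@ev_coder_corest _ s F); last by case=> [|? []].
by apply: eq_ev_all => w; rewrite /= corest_word.
Qed.

(** On tensors the square of [coleib D] has no mixed terms ([coleib_square]), so [D] squared is
    again a coderivation and its vanishing can be tested on the corestriction. *)
Lemma coder_square :
  (forall s, hword s -> ev (coder_words f s) (fun w => f (wval w)) = 0) ->
  forall t, D (D t) = 0.
Proof.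
move=> ff t; apply: (eq_linear_Tplus (f := fun t => D (D t)) (g := fun=> 0)).
- exact: comp_is_linear DL DL.
- by move=> a x y; rewrite scaler0 addr0.
move=> s _; have [n] := ubnP (size s); elim: n s => // n IH s sn hs.
apply: deconc_inj; last first.
  rewrite [D (word _)]coder_extE // (ev_lin _ _ DL) (ev_lin _ _ (@corest_linear k V)).
  rewrite (lin0 (@corest_linear k V)) -[RHS](ff s hs); apply: eq_ev => w ws /=.
  rewrite corest_coder; last exact: coder_words_hword f_degree ws hs.
  by have [_] := coder_wordsP ws; case: w.2.
have cL := coleib_linear Dgr.
rewrite !deconc_coder deconc_wval (lin0 (@deconc_linear k V)).
refine (etrans (lin_sum (comp_is_linear cL cL) _ _) _).
apply: big1_seq => a /= sa; have [h1 h2] := hword_splits hs sa.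
have es := mem_splits sa.
refine (etrans (coleib_square Dgr _ (word_homog h1)) _).
(* At a proper cut the factor is shorter and the induction hypothesis applies; at a trivial one the
   tensor has a factor [word [::] = 0]. *)
have Z1 : pure (D (D (word (wval a.1)))) (word (wval a.2)) = 0.
  case a2 : (nilp a.2); first by rewrite (nilP a2) pure0r.
  have lt : (size a.1 < n)%N.
    apply: (@leq_trans (size s)); last by rewrite -ltnS.
    rewrite es size_cat -[X in (X < _)%N]addn0 ltn_add2l.
    by rewrite lt0n; move: a2 => /negbT.
  by have -> := IH _ lt h1; rewrite pure0l.
have Z2 : pure (word (wval a.1)) (D (D (word (wval a.2)))) = 0.
  case a1 : (nilp a.1); first by rewrite (nilP a1) pure0l.
  have lt : (size a.2 < n)%N.
    apply: (@leq_trans (size s)); last by rewrite -ltnS.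
    rewrite es size_cat -[X in (X < _)%N]add0n ltn_add2r.
    by rewrite lt0n; move: a1 => /negbT.
  by have -> := IH _ lt h2; rewrite pure0r.
by rewrite Z1 Z2 addr0.
Qed.
End Coderivation.

(** * The bar differential *)

Section Bar.
Context (k : fieldType) (A : gradedType k) (mul : A -> A -> A) (dA : A -> A).
Hypothesis hA : is_dgalg mul dA.
Local Notation V := (susp A).
Local Notation f := (bar_cogen mul dA).

Let dL : linear dA := (dgalg_diff hA).1.1.

Lemma bar_cogen_multilinear : multilinear f.
Proof.
have [mL mR] := dgalg_bilinear hA.
move=> [|p [|q [|r s]]] [|u [|w t]] a x y //=; rewrite ?scaler0 ?addr0 //.
- exact: dL.
- exact: (opp_is_linear (comp_is_linear (mL u) (gsign_linear 1))).
- exact: (opp_is_linear (mR _)).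
Qed.

Lemma homog_of_susp i (x : V) : homog i x -> homog (i + 1) (x : A).
Proof. by rewrite /homog {1}/gproj /= /shift_proj opprK. Qed.

Lemma homog_susp i (x : A) : homog (i + 1) x -> homog i (x : V).
Proof. by rewrite /homog {2}/gproj /= /shift_proj opprK. Qed.

(** The degree of [x] in [A] is [i + 1]; together with the minus sign in [bar_cogen] this leaves the
    sign of the suspended degree [i]. *)
Lemma bar_cogen2 i (x y : V) : homog i x ->
  f [:: x; y] = (-1) ^ i *: mul x y :> A.
Proof.
move=> hx; rewrite /= (gsign_homog _ (homog_of_susp hx)) (linZ ((dgalg_bilinear hA).1 _)).
by rewrite mul1r signD expr1z mulrN1 scaleNr opprK.
Qed.

Lemma bar_cogen_big s : (2 < size s)%N -> f s = 0.
Proof. by case: s => [|? [|? [|? ?]]]. Qed.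

Lemma bar_cogen_degree s : s != [::] -> hword s -> homog (wdeg s + 1) (f (wval s)).
Proof.
case: s => [|p [|q [|r s]]] // _ hs; last exact: homog0.
  have [hp _] := (hword_cons _ _).1 hs; rewrite wdeg_cons wdeg_nil addr0.
  by apply: homog_susp; apply: (dgalg_diff hA).1.2; apply: homog_of_susp.
have [hp /hword_cons[hq _]] := (hword_cons _ _).1 hs.
apply: homog_susp; rewrite (bar_cogen2 q.2 hp) !wdeg_cons wdeg_nil addr0; apply: homogZ.
have := dgalg_degree hA (homog_of_susp hp) (homog_of_susp hq).
by rewrite addrACA addrA.
Qed.

(** Only arities one and two occur, and two such operations consume at most three letters: a word of
    length above three leaves the inner or the outer operation with at least three arguments. *)
Lemma bar_cogen_square_big (u : seq (int * V)) : (3 < size u)%N ->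
  ev (coder_words f u) (fun w => f (wval w)) = 0.
Proof.
move=> su; have fk := hmultilinear_kills (multilinear_hmulti bar_cogen_multilinear).
rewrite ev_coder_splits; apply: big1_seq => a /= /mem_splits ea.
apply: big1_seq => c /= /mem_splits ec; case: ifP => // _.
case: (ltnP 2 (size c.1)) => sc; last first.
  rewrite bar_cogen_big ?scaler0 // size_map size_cat /=.
  move: su sc; rewrite ea ec !size_cat.
  by move: (size a.1) (size c.1) (size c.2) => n1 n2 n3; lia.
have -> : f (wval c.1) = 0 by rewrite bar_cogen_big // size_map.
exact: etrans (f_equal ( *:%R _) (fk _ _ _)) (scaler0 _ _).
Qed.

(** In lengths one, two and three this is, respectively, that [dA] squares to zero, the Leibniz
    rule, and associativity. *)
Lemma bar_cogen_square s : hword s -> ev (coder_words f s) (fun w => f (wval w)) = 0.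
Proof.
have [mL mR] := dgalg_bilinear hA.
case: s => [|p [|q [|r [|t s]]]] hs.
- exact: ev_coder_nil.
- by rewrite ev_coder_cons big_seq1 ev_coder_nil scaler0 addr0 /=; apply: (dgalg_diff hA).2.
- have [hp _] := (hword_cons _ _).1 hs.
  rewrite ev_coder2.
  have hdp : homog (p.1 + 1) (dA p.2 : V).
    by apply: homog_susp; apply: (dgalg_diff hA).1.2; apply: homog_of_susp.
  have E1 := bar_cogen2 q.2 hdp; have E2 := bar_cogen2 q.2 hp.
  have E3 := bar_cogen2 (dA q.2 : V) hp.
  have L := dgalg_leibniz hA q.2 (homog_of_susp hp).
  (* [susp A] and [A] are the same module, so the equation is moved to [A], where the Leibniz rule
     is available. *)
  refine (etrans (f_equal2 (fun x y : A => x + y) (f_equal2 (fun x y : A => x + y) E1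
    (f_equal dA E2)) (f_equal (fun x : A => _ *: x) E3)) _).
  rewrite (linZ dL) L scalerDr !scalerA sign_sqr scale1r -signD.
  rewrite (@sign_opp _ 0 (p.1 + 1) p.1) ?(@sign_opp _ p.1 (p.1 + (p.1 + 1)) 0); [|ring..].
  by rewrite expr0z !scaleNr scale1r addrA addNr add0r addNr.
- have [hp /hword_cons[hq _]] := (hword_cons _ _).1 hs.
  rewrite ev_coder3.
  have hpq : homog (p.1 + q.1 + 1) (f [:: p.2; q.2]).
    have := @bar_cogen_degree [:: p; q] isT; rewrite !wdeg_cons wdeg_nil addr0; apply.
    by apply/hword_cons; split=> //; apply/hword_cons.
  have E1 := bar_cogen2 q.2 hp; have E2 := bar_cogen2 r.2 hq.
  have E3 := etrans (bar_cogen2 r.2 hpq) (f_equal (fun x => _ *: mul x _) E1).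
  have E4 := etrans (bar_cogen2 (f [:: q.2; r.2]) hp) (f_equal (fun x => _ *: mul _ x) E2).
  have d0 : f [:: f [:: p.2; q.2; r.2]] = 0 by exact: lin0 dL.
  rewrite d0 !add0r !addr0 scaler0 addr0.
  refine (etrans (f_equal2 (fun x y : A => x + y) E3 (f_equal (fun x : A => _ *: x) E4)) _).
  rewrite (linZ (mL _)) (linZ (mR _)) (dgalg_assoc hA) !scalerA sign_sqr mul1r -signD.
  by rewrite -scalerDl (@sign_opp _ p.1 _ q.1) ?addNr ?scale0r //; ring.
exact: bar_cogen_square_big.
Qed.

Lemma bar_dgcoalg : is_dgcoalg (@deconc k V) (bar_diff mul dA).
Proof.
have fm := bar_cogen_multilinear; have fd := bar_cogen_degree.
split.
- split; first exact: coder_ext_graded fm fd.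
  exact: coder_square fm fd bar_cogen_square.
- exact: deconc_graded.
- exact: deconc_coassoc.
- exact: deconc_coder fm fd.
Qed.
End Bar.

Lemma size_splits_left (T : eqType) (s : seq T) c : c \in splits s -> c.2 != [::] ->
  (size c.1 < size s)%N.
Proof. by move=> /mem_splits -> c0; rewrite size_cat -addn1 leq_add2l lt0n size_eq0. Qed.

Lemma size_splits_right (T : eqType) (s : seq T) c : c \in splits s -> c.1 != [::] ->
  (size c.2 < size s)%N.
Proof. by move=> /mem_splits -> c0; rewrite size_cat -add1n leq_add2r lt0n size_eq0. Qed.

(** * The extended action on a cofree coalgebra with a coderivation *)

Section CoderAct.
Context (k : fieldType) (B V : gradedType k) (b : seq B -> seq B -> B) (d : seq B -> B).
Hypothesis hB : is_Binf b d.
Context (theta : seq B -> V -> V).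
Hypothesis theta_linear : (forall w, multilinear (theta^~ w)) /\ (forall y, linear (theta y)).
Hypothesis theta_degree : forall v i w, hword v -> homog i w ->
    homog (wdeg v + i) (theta (wval v) w).
Hypothesis theta_id : forall w, theta [::] w = w.
Hypothesis theta_assoc : forall u v x, hword u -> hword v ->
  theta (wval u) (theta (wval v) x) = ev (binf_words b u v) (fun w => theta (wval w) x).
Context (f : seq V -> V).
Hypothesis f_multi : multilinear f.
Hypothesis f_degree : forall s, s != [::] -> hword s -> homog (wdeg s + 1) (f (wval s)).
Hypothesis f_act : forall v s, hword v -> hword s -> s != [::] ->
  ev (act_words theta v s) (fun x => f (wval x))
  = ev (coder_words d v) (fun w => theta (wval w) (corest (word (wval s))))
    + (-1) ^ wdeg v *: theta (wval v) (f (wval s)).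

Local Notation T := (Tplus V).
Local Notation D := (coder_ext f).
Local Notation act := (act_ext theta).

Let actL v : linear (act v). Proof. exact: act_ext_linear. Qed.
Let actM t : multilinear (act^~ t). Proof. exact: act_ext_multi. Qed.
Let DL : linear D. Proof. exact: coder_ext_linear f_multi. Qed.
Let Dgr : graded_map 1 D. Proof. exact: coder_ext_graded f_multi f_degree. Qed.
Let deL := @deconc_linear k V.
Let coL := @corest_linear k V.

(** Word length is preserved by the action, so only letters contribute, and on letters the extended
    action is [theta]. *)
Lemma corest_act v t : corest (act v t) = theta v (corest t).
Proof.
apply: (multilinear_eq (f := fun v => corest (act v t)) (g := fun v => theta v (corest t))).
- exact: multilinear_lin coL (actM t).
- exact: theta_linear.1.
move=> {}v hv _; apply: (eq_linear_Tplus (f := fun t => corest (act (wval v) t))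
   (g := fun t => theta (wval v) (corest t)) t).
- exact: comp_is_linear coL (actL _).
- exact: comp_is_linear (theta_linear.2 _) coL.
move=> [|p [|q s]] // _ hs.
  rewrite [X in word X](_ : _ = [:: p.2]) // (act_ext_letter theta_linear).
  by rewrite !corest_word.
have fL : multilinear (fun s : seq V => if s is [:: v] then v else 0).
  by move=> [|? [|? ?]] [|? ?] a x y //=; rewrite scaler0 addr0.
rewrite corest_word (lin0 (theta_linear.2 _)).
have n0 : [:: p, q & s] != [::] by [].
refine (etrans (tlift_act theta_linear fL n0 hv hs) _).
refine (etrans _ (ev0 _ (act_words theta v [:: p, q & s]))); apply: eq_ev => x /act_wordsP[_].
by case: x.2 => [|? []].
Qed.

Lemma deconc_act_word v s : hword v -> hword s ->
  deconc (act (wval v) (word (wval s)))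
  = \sum_(c <- splits s) \sum_(a <- splits v) (-1) ^ (wdeg c.1 * wdeg a.2) *:
      pure (act (wval a.1) (word (wval c.1))) (act (wval a.2) (word (wval c.2))).
Proof.
move=> hv hs; refine (etrans (act_ext_comul_word theta_linear hv hs) _).
exact: exchange_big.
Qed.

(** [D] raises the degree of the left factor, whence [wdeg c.1 + 1] in the first sum. At each cut
    [c] the right-hand side has the form of the last term of [act_diff_pairing]. *)
Lemma deconc_act_diff v s : hword v -> hword s ->
  deconc (act (wval v) (D (word (wval s))))
  = \sum_(c <- splits s)
    (\sum_(a <- splits v) (-1) ^ ((wdeg c.1 + 1) * wdeg a.2) *:
       pure (act (wval a.1) (D (word (wval c.1)))) (act (wval a.2) (word (wval c.2)))
     + (-1) ^ wdeg c.1 *: \sum_(a <- splits v) (-1) ^ (wdeg c.1 * wdeg a.2) *: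
       pure (act (wval a.1) (word (wval c.1))) (act (wval a.2) (D (word (wval c.2))))).
Proof.
move=> hv hs; refine (etrans (act_ext_comul theta_linear _ hv) _).
pose P a (x y : T) : tens T T := pure (act (wval a.1) (gsign (wdeg a.2) x)) (act (wval a.2) y).
have PB a : bilinear_map (P a) by exact: (act_pure_bilinear theta_linear).
have Pp a i (x y : T) : homog i x ->
  tens_lift (P a) (pure x y) = (-1) ^ (i * wdeg a.2) *: pure (act (wval a.1) x) (act (wval a.2) y).
  move=> hx; rewrite (tens_lift_pure (PB a)) /P (gsign_homog _ hx).
  have E := linZ (actL (wval a.1)) ((-1) ^ (wdeg a.2 * i)) x.
  refine (etrans (f_equal (fun t : T => pure t _) E) _).
  by rewrite (linZ ((pure_bilinear _ _).1 _)) mulrC.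
have E := deconc_coder_word f_multi hs.
transitivity (\sum_(a <- splits v) \sum_(c <- splits s)
  ((-1) ^ ((wdeg c.1 + 1) * wdeg a.2) *:
       pure (act (wval a.1) (D (word (wval c.1)))) (act (wval a.2) (word (wval c.2)))
     + (-1) ^ wdeg c.1 *: ((-1) ^ (wdeg c.1 * wdeg a.2) *:
       pure (act (wval a.1) (word (wval c.1))) (act (wval a.2) (D (word (wval c.2))))))).
  apply: eq_bigr => a _; refine (etrans (f_equal (tens_lift (P a)) E) _).
  have PL := tens_lift_linear (PB a).
  refine (etrans (lin_sum PL _ _) _).
  apply: eq_big_seq => c /(hword_splits hs)[h1 h2].
  refine (etrans (linD PL _ _) (f_equal2 +%R _ _)).
    by apply: Pp; apply: Dgr.2; apply: word_homog.
  refine (etrans (linZ PL _ _) (f_equal ( *:%R _) _)).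
  by apply: Pp; apply: word_homog.
rewrite exchange_big; apply: eq_bigr => c _.
by rewrite big_split scaler_sumr.
Qed.

Lemma deconc_diff_act v s : hword v -> hword s ->
  deconc (D (act (wval v) (word (wval s))))
  = \sum_(c <- splits s) \sum_(a <- splits v) (-1) ^ (wdeg c.1 * wdeg a.2) *:
    (pure (D (act (wval a.1) (word (wval c.1)))) (act (wval a.2) (word (wval c.2)))
     + (-1) ^ (wdeg a.1 + wdeg c.1) *:
       pure (act (wval a.1) (word (wval c.1))) (D (act (wval a.2) (word (wval c.2))))).
Proof.
move=> hv hs; rewrite (deconc_coder f_multi f_degree) (deconc_act_word hv hs).
apply: (coleib_sum Dgr (n := fun c a => wdeg a.1 + wdeg c.1)
  (x := fun c a => act (wval a.1) (word (wval c.1)))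
  (fun c a => (-1) ^ (wdeg c.1 * wdeg a.2))
  (fun c a => act (wval a.2) (word (wval c.2)))).
move=> c a /(hword_splits hs)[h1 h2] /(hword_splits hv)[h3 h4].
by apply: (act_ext_degree theta_linear theta_degree) => //; apply: word_homog.
Qed.

(** The deconcatenations agree cut by cut, through the pairing lemma for the tensor product; the
    corestrictions agree by [f_act]. *)
Lemma act_coder_word v s : hword s -> hword v ->
  D (act (wval v) (word (wval s)))
  = ev (coder_words d v) (fun w => act (wval w) (word (wval s)))
    + (-1) ^ wdeg v *: act (wval v) (D (word (wval s))).
Proof.
have [n] := ubnP (size s); elim: n s v => // n IH s v sn hs hv.
case: (altP (s =P [::])) => [->|s0].
  rewrite word_nil (lin0 (actL _)) (lin0 DL) (lin0 (actL _)) scaler0 addr0.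
  by under eq_ev_all do rewrite (lin0 (actL _)); rewrite ev0.
apply: deconc_inj.
- pose G (c : seq (int * V) * seq (int * V)) := ev (coder_words d v) (fun w =>
        \sum_(a <- splits w) (-1) ^ (wdeg c.1 * wdeg a.2) *:
      pure (act (wval a.1) (word (wval c.1))) (act (wval a.2) (word (wval c.2)))).
  pose H (c : seq (int * V) * seq (int * V)) :=
    \sum_(a <- splits v) (-1) ^ ((wdeg c.1 + 1) * wdeg a.2) *:
       pure (act (wval a.1) (D (word (wval c.1)))) (act (wval a.2) (word (wval c.2)))
     + (-1) ^ wdeg c.1 *: \sum_(a <- splits v) (-1) ^ (wdeg c.1 * wdeg a.2) *:
       pure (act (wval a.1) (word (wval c.1))) (act (wval a.2) (D (word (wval c.2)))).
  transitivity (\sum_(c <- splits s) G c + (-1) ^ wdeg v *: \sum_(c <- splits s) H c).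
    refine (etrans (deconc_diff_act hv hs) _).
    refine (@eq_sum_combine k (tens T T) _ (splits s) _ G H _ _) => c cs.
    have [h1 h2] := hword_splits hs cs.
    have PB := pure_bilinear T T.
    (* Cuts of [s] with both pieces nonempty have shorter pieces, covered by the induction
       hypothesis; the trivial cuts have a zero factor. *)
    apply: (@act_diff_pairing_or0 k B T (tens T T) d D act (@pure k T T) PB.1 PB.2
      (wdeg c.1) (word (wval c.1)) (word (wval c.2)) v (fun u => lin0 (actL u)) (lin0 DL) hv).
    case: (altP (c.1 =P [::])) => [->|c10]; first by left; left.
    case: (altP (c.2 =P [::])) => [->|c20]; first by left; right.
    have lt1 := leq_trans (size_splits_left cs c20) sn.
    have lt2 := leq_trans (size_splits_right cs c10) sn.
    by right; split=> u hu; apply: IH.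
  refine (etrans _ (esym (linD deL _ _))); refine (f_equal2 +%R _ _).
    refine (etrans _ (esym (ev_lin _ _ deL))).
    refine (etrans (esym (ev_sum _ _ _)) _).
    apply: eq_ev => w wv; apply: esym; apply: deconc_act_word => //.
    exact: coder_words_hword (binf_d_degree hB) wv hv.
  have Z := linZ deL ((-1) ^ wdeg v) (act (wval v) (D (word (wval s)))).
  refine (etrans _ (esym Z)); refine (f_equal ( *:%R _) _).
  exact: esym (deconc_act_diff hv hs).
rewrite (linD coL) (linZ coL) corest_act (ev_lin _ _ coL).
rewrite (corest_coder f_multi hs); case: ifP s0 => [/nilP -> //|_ s0].
(* No word produced by the action is empty, since [s] is not, so corestricting [D] on each of them
   gives [f] of the whole word. *)
transitivity (ev (act_words theta v s) (fun x => f (wval x))).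
  have E := act_ext_word theta_linear hv hs.
  refine (etrans (f_equal (fun t => corest (D t)) E) _).
  refine (etrans (ev_lin _ _ (comp_is_linear coL DL)) _); apply: eq_ev => x xs /=.
  rewrite (corest_coder f_multi (act_words_hword theta_degree xs hv hs)).
  by have [_ sx] := act_wordsP xs; rewrite /nilp sx size_eq0 (negPf s0).
rewrite (f_act hv hs s0); refine (f_equal2 +%R _ (erefl _)).
by apply: eq_ev_all => w; rewrite /= corest_act.
Qed.

Lemma coder_act_module : is_module b d D act.
Proof.
apply: (act_ext_is_module hB theta_linear theta_degree theta_id theta_assoc) => v t hv.
apply: (eq_linear_Tplus (f := fun t => D (act (wval v) t))
  (g := fun t => ev (coder_words d v) (fun w => act (wval w) t)
     + (-1) ^ wdeg v *: act (wval v) (D t)) t).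
- exact: comp_is_linear DL (actL _).
- apply: add_is_linear; first by apply: ev_is_linear => w; apply: actL.
  exact: scale_is_linear (comp_is_linear (actL _) DL).
by move=> s _ hs; apply: act_coder_word.
Qed.

Lemma coder_act_coalg : is_coalg_action b d (@deconc k V) D act.
Proof.
split; first exact: coder_act_module.
move=> v x hv; refine (etrans (act_ext_comul theta_linear x hv) _).
exact: (big_splits (fun a1 a2 => tens_lift (fun x y => pure (act (wval a1)
  (gsign (wdeg a2) x)) (act (wval a2) y)) (deconc x))).
Qed.

Lemma coalg_action_deconc gamma v s : is_coalg_action b d (@deconc k V) D gamma ->
  hword v -> hword s ->
  deconc (gamma (wval v) (word (wval s)))
  = \sum_(a <- splits v) \sum_(c <- splits s) (-1) ^ (wdeg a.2 * wdeg c.1) *: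
      pure (gamma (wval a.1) (word (wval c.1))) (gamma (wval a.2) (word (wval c.2))).
Proof.
move=> hg hv hs; have gL := (mod_linear (coalg_action_module hg)).2.
rewrite (coalg_action_comul hg _ hv) -(big_splits (fun a1 a2 => tens_lift (fun x y =>
  pure (gamma (wval a1) (gsign (wdeg a2) x)) (gamma (wval a2) y)) (deconc (word (wval s))))).
apply: eq_bigr => a _.
have PB : bilinear_map (fun x y : T =>
    pure (gamma (wval a.1) (gsign (wdeg a.2) x)) (gamma (wval a.2) y)).
  split=> [y|x]; last exact: comp_is_linear ((pure_bilinear _ _).2 _) (gL _).
  apply: comp_is_linear ((pure_bilinear _ _).1 _) _.
  exact: comp_is_linear (gL _) (gsign_linear _).
rewrite deconc_wval (lin_sum (tens_lift_linear PB)).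
apply: eq_big_seq => c /(hword_splits hs)[h1 h2].
rewrite (tens_lift_pure PB) (gsign_homog _ (word_homog h1)) (linZ (gL _)).
exact: (linZ ((pure_bilinear _ _).1 _)).
Qed.

Lemma coder_act_unique gamma : is_coalg_action b d (@deconc k V) D gamma ->
  (forall v s, (1 < size s)%N -> corest (gamma v (word s)) = 0) ->
  (forall v x, gamma v (word [:: x]) = word [:: theta v x]) -> act = gamma.
Proof.
move=> hg g0 g1; have hgm := coalg_action_module hg; have gL := (mod_linear hgm).2.
apply/funext => v; apply/funext => t.
apply: (multilinear_eq (f := act^~ t) (g := gamma^~ t)).
- exact: actM.
- exact: (mod_linear hgm).1.
move=> {}v hv _.
apply: (eq_linear_Tplus (f := act (wval v)) (g := gamma (wval v)) t (actL _) (gL _)).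
move=> s _; have [n] := ubnP (size s); elim: n s v hv => // n IH s v hv sn hs.
apply: deconc_inj; last first.
  rewrite corest_act corest_word; case: s {sn IH hs} => [|p [|q s]].
  - by rewrite word_nil (lin0 (gL _)) (lin0 (theta_linear.2 _)) (lin0 coL).
  - by rewrite [X in word X](_ : _ = [:: p.2]) // g1 corest_word.
  by rewrite g0 // (lin0 (theta_linear.2 _)).
(* Every coalgebra action obeys the same recursion under deconcatenation, so the two actions are
   compared on the shorter pieces of each cut. *)
rewrite (coalg_action_deconc hg hv hs) (coalg_action_deconc coder_act_coalg hv hs).
apply: eq_big_seq => a /(hword_splits hv)[ha1 ha2]; apply: eq_big_seq => c cs.
have [h1 h2] := hword_splits hs cs; refine (f_equal ( *:%R _) _).
case: (altP (c.1 =P [::])) => [->|c10].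
  by rewrite word_nil (lin0 (actL _)) (lin0 (gL _)) !pure0l.
case: (altP (c.2 =P [::])) => [->|c20].
  by rewrite word_nil (lin0 (actL _)) (lin0 (gL _)) !pure0r.
have lt1 := leq_trans (size_splits_left cs c20) sn.
have lt2 := leq_trans (size_splits_right cs c10) sn.
exact: (f_equal2 (@pure k T T) (IH _ _ ha1 lt1 h1) (IH _ _ ha2 lt2 h2)).
Qed.
End CoderAct.

(** * The action on the bar construction *)

Section Bar.
Context (k : fieldType) (A : gradedType k) (mul : A -> A -> A) (dA : A -> A).
Hypothesis hA : is_dgalg mul dA.
Context (B : gradedType k) (b : seq B -> seq B -> B) (d : seq B -> B).
Hypothesis hB : is_Binf b d.
Context (beta : seq B -> A -> A) (hbeta : is_alg_action b d mul dA beta).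

Local Notation V := (susp A).
Local Notation f := (bar_cogen mul dA).
Local Notation D := (bar_diff mul dA).

Let hm := alg_action_module hbeta.
Let theta : seq B -> V -> V := beta.

Let theta_linear : (forall w, multilinear (theta^~ w)) /\ (forall y, linear (theta y)).
Proof. exact: mod_linear hm. Qed.

Let theta_degree v i (w : V) : hword v -> homog i w -> homog (wdeg v + i) (theta (wval v) w).
Proof.
move=> hv hw; apply: homog_susp; have := mod_degree hm hv (homog_of_susp hw).
by rewrite addrA.
Qed.

Let theta_id w : theta [::] w = w. Proof. exact: mod_id hm w. Qed.

Let theta_assoc u v (x : V) : hword u -> hword v ->
  theta (wval u) (theta (wval v) x) = ev (binf_words b u v) (fun w => theta (wval w) x).
Proof. by move=> hu hv; exact: (module_assoc_hword hB (x : A) hm hu hv). Qed.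

(** In length one this is the module axiom for differentials, in length two the rule for the action
    on a product. For longer words every term is 0, because the action preserves length and
    [bar_cogen] has arity at most two. *)
Lemma bar_cogen_act v s : hword v -> hword s -> s != [::] ->
  ev (act_words theta v s) (fun x => f (wval x))
  = ev (coder_words d v) (fun w => theta (wval w) (corest (word (wval s))))
    + (-1) ^ wdeg v *: theta (wval v) (f (wval s)).
Proof.
move=> hv; have Z r : (1 < size r)%N ->
    ev (coder_words d v) (fun w => theta (wval w) (corest (word (wval r)))) = 0.
  move=> sr; rewrite -[RHS](ev0 _ (coder_words d v)); apply: eq_ev_all => w.
  rewrite corest_word; case: r sr => [|? [|? ?]] // _; exact: lin0 (theta_linear.2 _).
case: s => [|p [|q [|r s]]] // hs _.
- rewrite corest_word ev_act1; refine (etrans (mod_diff hm (p.2 : A) hv) _).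
  refine (f_equal2 +%R _ (erefl _)).
  exact: (tlift_coder (binf_d_linear hB) ((mod_linear hm).1 (p.2 : A)) hv).
- have [hp _] := (hword_cons _ _).1 hs.
  rewrite Z // add0r ev_act_cons.
  pose G a1 a2 : A := mul (beta (wval a1) p.2) (beta (wval a2) q.2).
  have E : theta (wval v) (f [:: p.2; q.2])
    = (-1) ^ p.1 *: \sum_(a <- splits v) (-1) ^ ((p.1 + 1) * wdeg a.2) *: G a.1 a.2 :> A.
    refine (etrans (f_equal (beta (wval v)) (bar_cogen2 hA q.2 hp)) _).
    refine (etrans (linZ ((mod_linear hm).2 _) _ _) (f_equal ( *:%R _) _)).
    refine (etrans (alg_action_mul hbeta _ hv (homog_of_susp hp)) _).
    by rewrite (big_splits (fun a1 a2 => (-1) ^ ((p.1 + 1) * wdeg a2) *: G a1 a2)).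
  refine (etrans _ (esym (f_equal (fun x : A => _ *: x) E))).
  rewrite scalerA scaler_sumr; apply: eq_big_seq => a av.
  have [h1 _] := hword_splits hv av; rewrite ev_act1 scalerA (wdeg_splits av).
  have E2 := bar_cogen2 hA (theta (wval a.2) q.2) (theta_degree h1 hp).
  refine (etrans (f_equal (fun x : A => _ *: x) E2) _).
  rewrite scalerA -!signD; refine (f_equal (fun e : k => e *: _) _).
  (* The first letter has degree [p.1] in the suspension and [p.1 + 1] in [A]. The resulting sign of
     [wdeg a.2] combines with that of [wdeg a.1], coming from [bar_cogen2], to the sign of
     [wdeg v]. *)
  by apply: (@sign_eq _ (- wdeg a.2)); ring.
- rewrite Z // add0r (bar_cogen_big _ _ (s := wval _)) //.
  rewrite (lin0 (theta_linear.2 _)) scaler0.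
  refine (etrans _ (ev0 _ (act_words theta v [:: p, q, r & s]))).
  apply: eq_ev => x /act_wordsP[_ sx]; apply: bar_cogen_big.
  by rewrite size_map sx.
Qed.


Definition bar_act : seq B -> bar A -> bar A := act_ext theta.

Lemma bar_act_letter v a : bar_act v (word [:: to_susp a]) = word [:: to_susp (beta v a)].
Proof. exact: (act_ext_letter theta_linear). Qed.

Lemma corest_bar_act v s : (1 < size s)%N -> corest (bar_act v (word s)) = 0.
Proof.
move=> ss; rewrite /bar_act (corest_act theta_linear) corest_word.
by case: s ss => [|? [|? ?]] // _; exact: lin0 (theta_linear.2 _).
Qed.

Lemma bar_act_coalg : is_coalg_action b d (@deconc k V) D bar_act.
Proof.
exact: (coder_act_coalg hB theta_linear theta_degree theta_id theta_assoc
  (bar_cogen_multilinear hA) (bar_cogen_degree hA) bar_cogen_act).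
Qed.

Lemma bar_act_unique gamma : is_coalg_action b d (@deconc k V) D gamma ->
  (forall v s, (1 < size s)%N -> corest (gamma v (word s)) = 0) ->
  (forall v a, gamma v (word [:: to_susp a]) = word [:: to_susp (beta v a)]) ->
  bar_act = gamma.
Proof.
exact: (coder_act_unique hB theta_linear theta_degree theta_id theta_assoc
  (bar_cogen_multilinear hA) (bar_cogen_degree hA) bar_cogen_act).
Qed.
End Bar.

Theorem lemma3 (k : fieldType) (k_char0 : [pchar k] =i pred0)
    (C : gradedType k) (Delta : C -> tens C C) (dC : C -> C)
    (hC : is_dgcoalg Delta dC)
    (A : gradedType k) (mul : A -> A -> A) (dA : A -> A)
    (hA : is_dgalg mul dA)
    (B : gradedType k) (b : seq B -> seq B -> B) (d : seq B -> B)
    (hB : is_Binf b d)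
    (beta : seq B -> C -> C) (hbeta : is_coalg_action b d Delta dC beta)
    (beta' : seq B -> A -> A) (hbeta' : is_alg_action b d mul dA beta') :
  (is_dgalg (@tmul k (desusp C)) (cobar_diff Delta dC)
   /\ exists! gamma : seq B -> cobar C -> cobar C,
        is_alg_action b d (@tmul k (desusp C)) (cobar_diff Delta dC) gamma
        /\ forall v c,
             gamma v (word [:: to_desusp c]) = word [:: to_desusp (beta v c)])
  /\
  (is_dgcoalg (@deconc k (susp A)) (bar_diff mul dA)
   /\ exists! gamma : seq B -> bar A -> bar A,
        is_coalg_action b d (@deconc k (susp A)) (bar_diff mul dA) gamma
        /\ (forall v s, (1 < size s)%N -> corest (gamma v (word s)) = 0)
        /\ forall v a,
             gamma v (word [:: to_susp a]) = word [:: to_susp (beta' v a)]).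
Proof.
split; split.
- exact: cobar_dgalg hC.
- exists (cobar_act beta); split.
    split; first exact: (cobar_act_alg hC hB hbeta).
    exact: (cobar_act_letter hbeta).
  by move=> gamma [hg gl]; apply: (cobar_act_unique hbeta hg gl).
- exact: bar_dgcoalg hA.
exists (bar_act beta'); split.
  split; first exact: (bar_act_coalg hA hB hbeta').
  split; [exact: (corest_bar_act hbeta')|exact: (bar_act_letter hbeta')].
by move=> gamma [hg [g0 gl]]; apply: (bar_act_unique hA hB hbeta' hg g0 gl).
Qed.
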